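(* Let $n\ge 3$, let $p\in\{2,\ldots,n-1\}$, and let $D$ be a bounded domain in $\mathbb{R}^n$ with boundary $bD$ of class $\mathscr{C}^{r,\alpha}$ for some integer $r\ge 2$ and some $0<\alpha\le 1$. Suppose that the principal interior curvatures $\nu_1(\mathbf{x})\le \nu_2(\mathbf{x})\le\cdots\le\nu_{n-1}(\mathbf{x})$ of $bD$ at every point $\mathbf{x}\in bD$ satisfy $$\nu_1(\mathbf{x})+\nu_2(\mathbf{x})+\cdots+\nu_p(\mathbf{x})\ge 0.$$ Then there exists a defining function $\rho$ of class $\mathscr{C}^{r,\alpha}$ for $D$ such that $$\mathrm{tr}_\Lambda\,\mathrm{Hess}_\rho(\mathbf{x})\ge 0\quad\text{for all } \mathbf{x}\in\overline{D}\ \text{and all } \Lambda\in G_p(\mathbb{R}^n).$$ If, in addition, there is no point $\mathbf{x}\in bD$ with $\nu_i(\mathbf{x})=0$ for all $i=1,\ldots,p$, then $\rho$ can be chosen such that moreover $\mathrm{tr}_\Lambda\,\mathrm{Hess}_\rho(\mathbf{x})>0$ for all $\mathbf{x}\in D$ and all $\Lambda\in G_p(\mathbb{R}^n)$.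
   Context: A domain is a connected open set. $G_p(\mathbb{R}^n)$ is the Grassmann manifold of $p$-dimensional linear subspaces ($p$-planes) of $\mathbb{R}^n$. For a $\mathscr{C}^2$ function $\rho$, $\mathrm{Hess}_\rho(\mathbf{x})$ is the quadratic form on $\mathbb{R}^n$ given by the matrix $\big(\frac{\partial^2\rho}{\partial x_i\partial x_j}(\mathbf{x})\big)$, and $\mathrm{tr}_\Lambda\,\mathrm{Hess}_\rho(\mathbf{x})$ is the trace of the restriction of this form to $\Lambda$ (computed in any orthonormal basis of $\Lambda$ for the Euclidean inner product). A defining function for $D$ is a function $\rho$ on a neighbourhood of $\overline D$ with $D=\{\rho<0\}$, $bD=\{\rho=0\}$, and $d\rho\ne 0$ at every point of $bD$. The principal interior curvatures of $bD$ at $\mathbf{x}\in bD$ are the eigenvalues of the second fundamental form of $bD$ at $\mathbf{x}$ with respect to the inner unit normal; equivalently, they are the eigenvalues of $\mathrm{Hess}_\delta(\mathbf{x})$ restricted to the tangent space $T_{\mathbf{x}}bD$, where $\delta(\mathbf{x})=\mathrm{dist}(\mathbf{x},D)-\mathrm{dist}(\mathbf{x},\mathbb{R}^n\setminus D)$ is the signed distance function (so they are nonnegative if $D$ is convex). $\mathscr{C}^{r,\alpha}$ denotes the Hölder class of $r$ times continuously differentiable functions whose derivatives of order $r$ are (locally) $\alpha$-Hölder continuous. *)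

(* Defs.v *)
From HB Require Import structures.
From mathcomp Require Import all_boot all_order all_algebra.
From mathcomp Require Import all_classical all_reals all_analysis.

Set Implicit Arguments.
Unset Strict Implicit.
Unset Printing Implicit Defensive.

Import Order.TTheory GRing.Theory Num.Theory.
Import numFieldNormedType.Exports.

Local Open Scope classical_set_scope.
Local Open Scope ring_scope.

Section Euclidean.
Variables (R : realType) (n : nat).
Implicit Types (u v x : 'rV[R]_n) (A : 'M[R]_n) (L : {vspace 'rV[R]_n}).

Definition dot u v : R := \sum_(i < n) u 0 i * v 0 i.

(* The norm `|u| that the library puts on 'rV[R]_n is the sup norm. *)
Definition enorm u : R := Num.sqrt (dot u u).

Definition edist_to (S : set 'rV[R]_n) x : R :=
  inf [set enorm (x - y) | y in S].

Definition orthonormal_basis L k (e : k.-tuple 'rV[R]_n) : bool :=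
  basis_of L e &&
  [forall i, forall j, dot (tnth e i) (tnth e j) == (i == j)%:R].

(* Matrix of the restriction to span e of the bilinear form u A v^T. *)
Definition form_mx A k (e : k.-tuple 'rV[R]_n) : 'M[R]_k :=
  \matrix_(i, j) dot (tnth e i *m A) (tnth e j).

(* Some orthonormal basis of L: one exists by onb_of_spec below. *)
Definition onb_of L : (\dim L).-tuple 'rV[R]_n :=
  xget (vbasis L) [set e | orthonormal_basis L e].

(* The next two do not depend on the orthonormal basis of L that is used:
   see trace_onE and char_poly_onE. *)
Definition trace_on L A : R := \tr (form_mx A (onb_of L)).

Definition char_poly_on L A : {poly R} := char_poly (form_mx A (onb_of L)).

End Euclidean.

Section WellDefined.
Variables (R : realType) (n : nat).
Implicit Types (u v x : 'rV[R]_n) (A : 'M[R]_n) (L : {vspace 'rV[R]_n}).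

Lemma dotE u v : dot u v = (u *m v^T) 0 0.
Proof. by rewrite mxE; apply: eq_bigr => i _; rewrite mxE. Qed.

Lemma dotDl u v w : dot (u + v) w = dot u w + dot v w.
Proof. by rewrite !dotE mulmxDl mxE. Qed.

Lemma dotZl a u v : dot (a *: u) v = a * dot u v.
Proof. by rewrite !dotE -scalemxAl mxE. Qed.

Lemma dotC u v : dot u v = dot v u.
Proof. by apply: eq_bigr => i _; rewrite mulrC. Qed.

Lemma dot_suml (I : Type) (s : seq I) (F : I -> 'rV[R]_n) v :
  dot (\sum_(i <- s) F i) v = \sum_(i <- s) dot (F i) v.
Proof. by rewrite dotE mulmx_suml summxE; apply: eq_bigr => i _; rewrite dotE. Qed.

Lemma dot_gt0 u : u != 0 -> 0 < dot u u.
Proof.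
move=> /rV0Pn[i ui]; rewrite /dot (bigD1 i) //= ltr_pwDl //.
  by rewrite -expr2 exprn_even_gt0.
by apply: sumr_ge0 => j _; rewrite -expr2 sqr_ge0.
Qed.

Lemma orthonormal_basisP L k (e : k.-tuple 'rV[R]_n) :
  reflect (basis_of L e /\
           forall i j, dot (tnth e i) (tnth e j) = (i == j)%:R)
          (orthonormal_basis L e).
Proof.
apply: (iffP andP) => -[eL eo]; split => //.
  by move=> i j; move/forallP: eo => /(_ i)/forallP/(_ j)/eqP.
by apply/forallP => i; apply/forallP => j; apply/eqP.
Qed.

Let rows k (e : k.-tuple 'rV[R]_n) : 'M[R]_(k, n) := \matrix_i tnth e i.

Lemma form_mxE A k (e : k.-tuple 'rV[R]_n) :
  form_mx A e = rows e *m A *m (rows e)^T.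
Proof.
apply/matrixP => i j; rewrite !mxE; apply: eq_bigr => a _; rewrite !mxE.
by congr (_ * _); apply: eq_bigr => b _; rewrite !mxE.
Qed.

Lemma orthonormal_free k (e : k.-tuple 'rV[R]_n) :
  (forall i j, dot (tnth e i) (tnth e j) = (i == j)%:R) -> free e.
Proof.
move=> eo; apply/freeP => c c0 i.
have := congr1 (fun w => dot w (tnth e i)) c0.
rewrite dot_suml (bigD1 i) //= big1 ?addr0 => [|j ji].
  by rewrite -tnth_nth dotZl eo eqxx mulr1 => ->; rewrite dotE mul0mx mxE.
by rewrite -tnth_nth dotZl eo (negbTE ji) mulr0.
Qed.

Lemma orthonormal_ext L k : (k <= \dim L)%N ->
  exists e : k.-tuple 'rV[R]_n, (forall i, tnth e i \in L) /\
    forall i j, dot (tnth e i) (tnth e j) = (i == j)%:R.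
Proof.
elim: k => [_|k IH kL]; first by exists [tuple]; split => -[].
have [e [eL eo]] := IH (ltnW kL).
have : ~~ (L <= <<e>>)%VS.
  apply: contraTN kL => /dimvS Le; rewrite -leqNgt (leq_trans Le) //.
  by rewrite (leq_trans (dim_span _)) // size_tuple.
case/subvPn => v vL ve.
pose w := v - \sum_(i < k) dot v (tnth e i) *: tnth e i.
have wL : w \in L.
  by rewrite rpredB // rpred_sum // => i _; rewrite rpredZ.
have w0 : w != 0.
  apply: contraNneq ve => /eqP; rewrite subr_eq0 => /eqP ->.
  by rewrite rpred_sum // => i _; rewrite rpredZ // memv_span // mem_tnth.
have we i : dot w (tnth e i) = 0.
  rewrite dotDl -[- _]scaleN1r dotZl dot_suml (bigD1 i) //= big1 => [|j ji].
    by rewrite addr0 dotZl eo eqxx mulr1 mulN1r subrr.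
  by rewrite dotZl eo (negbTE ji) mulr0.
have sw : 0 < enorm w by rewrite sqrtr_gt0 dot_gt0.
pose z := (enorm w)^-1 *: w.
have zz : dot z z = 1.
  rewrite dotZl dotC dotZl -{3}[w]scale1r mulrA -expr2 dotZl mul1r.
  by rewrite -[dot w w]sqr_sqrtr ?ltW ?dot_gt0 // exprVn mulVf // expf_neq0 ?gt_eqF.
have ze i : dot z (tnth e i) = 0 by rewrite dotZl we mulr0.
exists [tuple of z :: e]; split.
  by move=> i; case: (unliftP ord0 i) => [j|] ->; rewrite ?tnthS ?tnth0 ?rpredZ.
move=> i j; case: (unliftP ord0 i) => [i'|] ->; case: (unliftP ord0 j) => [j'|] ->;
  by rewrite ?tnthS ?tnth0 ?eo ?(inj_eq (@lift_inj _ _)) // dotC ze.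
Qed.

Lemma onb_of_spec L : orthonormal_basis L (onb_of L).
Proof.
rewrite /onb_of; case: xgetP => [e _ ->//|].
have [e [eL eo]] := orthonormal_ext (leqnn (\dim L)).
move=> /(_ e) []; apply/orthonormal_basisP; split => //.
have fe := orthonormal_free eo.
rewrite basisEfree fe size_tuple leqnn andbT.
by apply/span_subvP => _ /tnthP[i ->].
Qed.

Lemma change_onb L k (e f : k.-tuple 'rV[R]_n) :
  orthonormal_basis L e -> orthonormal_basis L f ->
  exists2 U : 'M[R]_k, U *m U^T = 1%:M &
    forall A, form_mx A f = U *m form_mx A e *m U^T.
Proof.
move=> /orthonormal_basisP[eL eo] /orthonormal_basisP[fL fo].
have on g : (forall i j, dot (tnth g i) (tnth g j) = (i == j)%:R) ->
    rows g *m (rows g)^T = 1%:M.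
  move=> go; apply/matrixP => i j; rewrite !mxE -go.
  by apply: eq_bigr => a _; rewrite !mxE.
pose U : 'M[R]_k := \matrix_(i, j) coord e j (tnth f i).
have fU : rows f = U *m rows e.
  apply/row_matrixP => i; rewrite rowK row_mul mulmx_sum_row.
  rewrite [LHS](coord_basis eL) ?(basis_mem fL) ?mem_tnth //.
  by apply: eq_bigr => j _; rewrite rowK !mxE -tnth_nth.
exists U => [|A].
  by rewrite -(on _ f fo) fU trmx_mul mulmxA -(mulmxA U) (on _ e eo) mulmx1.
by rewrite !form_mxE fU trmx_mul !mulmxA.
Qed.

Lemma trace_onE L A (e : (\dim L).-tuple 'rV[R]_n) :
  orthonormal_basis L e ->
  trace_on L A = \sum_(i < \dim L) dot (tnth e i *m A) (tnth e i).
Proof.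
move=> eL; have [U UU UA] := change_onb eL (onb_of_spec L).
rewrite /trace_on UA mxtrace_mulC mulmxA (mulmx1C UU) mul1mx.
by apply: eq_bigr => i _; rewrite mxE.
Qed.

Lemma char_poly_onE L A (e : (\dim L).-tuple 'rV[R]_n) :
  orthonormal_basis L e -> char_poly_on L A = char_poly (form_mx A e).
Proof.
move=> eL; have [U UU UA] := change_onb eL (onb_of_spec L).
rewrite /char_poly_on UA /char_poly.
pose V := map_mx (@polyC R) U.
have VV : V *m V^T = 1%:M by rewrite /V map_trmx -map_mxM UU map_mx1.
have -> : char_poly_mx (U *m form_mx A e *m U^T) =
    V *m char_poly_mx (form_mx A e) *m V^T.
  rewrite /char_poly_mx mulmxBr mulmxBl mul_mx_scalar -scalemxAl VV.
  by rewrite scalemx1 !map_mxM /V map_trmx.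
rewrite det_mulmx [X in X * _]det_mulmx mulrAC -det_mulmx.
by rewrite VV det1 mul1r.
Qed.

End WellDefined.

Section Smoothness.
Variables (R : realType) (n : nat).
Implicit Types (f : 'rV[R]_n -> R) (x : 'rV[R]_n) (U : set 'rV[R]_n).

Definition partial (i : 'I_n) f : 'rV[R]_n -> R :=
  fun x => 'D_(delta_mx 0 i) f x.

(* iter_partial [:: i1; ...; ik] f is the partial derivative of f of order k
   in the variables i1, ..., ik. *)
Definition iter_partial (s : seq 'I_n) f : 'rV[R]_n -> R :=
  foldr partial f s.

Definition grad f x : 'rV[R]_n := \row_i partial i f x.

Definition Hess f x : 'M[R]_n := \matrix_(i, j) partial i (partial j f) x.

(* Replacing the sup norm by the Euclidean norm only changes the constant C. *)
Definition locally_holder (alpha : R) U f : Prop :=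
  forall x, U x -> exists C : R, exists2 V, nbhs x V &
    forall y z, V y -> V z -> `|f y - f z| <= C * `|y - z| `^ alpha.

(* The class C^{r,alpha} on an open set U. *)
Definition holder_class (r : nat) (alpha : R) U f : Prop :=
  [/\ forall s x i, (size s < r)%N -> U x ->
        derivable (iter_partial s f) x (delta_mx 0 i),
      forall s x, (size s <= r)%N -> U x ->
        {for x, continuous (iter_partial s f)} &
      forall s, size s = r -> locally_holder alpha U (iter_partial s f)].

End Smoothness.

Section Domains.
Variables (R : realType) (n : nat).
Implicit Types (D U : set 'rV[R]_n) (x : 'rV[R]_n) (rho : 'rV[R]_n -> R).

Definition boundary D : set 'rV[R]_n := closure D `\` interior D.

Definition holder_boundary (r : nat) (alpha : R) D : Prop :=
  forall x, boundary D x -> exists U phi,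
    [/\ open U /\ U x, holder_class r alpha U phi,
        D `&` U = [set y | phi y < 0] `&` U,
        boundary D `&` U = [set y | phi y = 0] `&` U &
        forall y, boundary D y -> U y -> grad phi y != 0].

(* rho is total as a Rocq function, but only its values on U matter. *)
Definition holder_defining_function (r : nat) (alpha : R) D rho : Prop :=
  exists U,
    [/\ open U /\ closure D `<=` U, holder_class r alpha U rho,
        D = [set y | rho y < 0] `&` U,
        boundary D = [set y | rho y = 0] `&` U &
        forall y, boundary D y -> grad rho y != 0].

Definition signed_dist D x : R := edist_to D x - edist_to (~` D) x.

(* The kernel of the differential of the signed distance at x. *)
Definition tangent_space D x : {vspace 'rV[R]_n} :=
  lker (linfun (mulmxr (grad (signed_dist D) x)^T : 'rV[R]_n -> 'rV[R]_1)).

(* nu lists, in increasing order and with multiplicity, the principal interior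
   curvatures of the boundary of D at x. The second fundamental form for the
   inner unit normal - grad (signed_dist D) is the restriction of
   Hess (signed_dist D) x to the tangent space. *)
Definition principal_curvatures D x (nu : seq R) : Prop :=
  sorted <=%R nu /\
  char_poly_on (tangent_space D x) (Hess (signed_dist D) x)
    = \prod_(a <- nu) ('X - a%:P).

Lemma mem_tangent_space D x v :
  (v \in tangent_space D x) = (dot v (grad (signed_dist D) x) == 0).
Proof.
rewrite memv_ker lfunE /= dotE; apply/eqP/eqP => [->|v0]; first by rewrite mxE.
by apply/rowP => i; rewrite ord1 v0 mxE.
Qed.

End Domains.

(* Main.v *)
(** Let d be the signed distance to bD and g its gradient. A nearest boundary
    point q x of x satisfies x = q x + d x *: N (q x) with N the unit normal, so
    g x = N (q x) solves g = N (x - d g), a contraction near bD. Hence g is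
    Lipschitz, d is differentiable with gradient g, and differentiating the
    fixed point equation gives Dg (1 + d DN) = (1 - g^T g) DN, from which the
    regularity C^{r,alpha} of d is bootstrapped. Applied at x and at y = q x the
    same formula gives H_x + d(x) H_x H_y = H_y for the Hessians of d, so
    H_x >= H_y for x inside D: the curvature condition propagates from bD to the
    collar. By Ky Fan's inequality the trace of H_y + kappa g^T g over a p-plane
    is at least nu_1 + ... + nu_p as soon as kappa >= nu_p.

    Put m = r + 1, s = ((d/c + 1)_+)^m - 1 and t = eps |x|^2 - 3/4, where c and
    eps are small. Then Hess s is a nonnegative multiple of H_x + kappa g^T g with
    kappa >= 1/c in the collar and s = -1 where d <= -c. The function
    rho = s + v^m / m with v = (t - s)_+ equals s near bD, and
    Hess rho = (1 - v^(m-1)) Hess s + v^(m-1) Hess t + (m-1) v^(m-2) (Dv)^T Dv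
    is strictly positive on p-planes wherever v > 0, in particular wherever s is
    flat. Where v = 0 its p-traces are those of Hess s, and they vanish only over
    a boundary point with nu_1 = ... = nu_p = 0. *)

Require Import Defs.
From mathcomp Require Import all_boot all_order all_algebra.
From mathcomp Require Import all_classical all_reals all_analysis.
From mathcomp Require Import ring lra.
Import Order.TTheory GRing.Theory Num.Theory.
Import numFieldNormedType.Exports.
Local Open Scope classical_set_scope.
Local Open Scope ring_scope.

Set Implicit Arguments.
Unset Strict Implicit.
Unset Printing Implicit Defensive.

(** * Calculus in coordinates *)

(** The signed distance is smooth only near bD, so s has to be constant in the depth, where its
    Hessian says nothing; t, whose p-traces are 2 eps p, takes over there. The levels are chosen for
    this: t stays in [-3/4, -1/2), above the value -1 of s in the depth and below its value 0 on bD.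
    Hence v > 0 wherever s = -1, while v = 0 near bD. Moreover v <= 1/2, so the weight 1 - v^(m-1)
    is positive and v^m / m <= v, which gives rho <= t < 0 where v > 0. The exponent m = r + 1 is
    the least integer for which the m-th power of the positive part has r continuous derivatives.

    A p-plane with a normal component sees less than p tangent directions, perhaps mainly negatively
    curved ones. The second derivative of s across its level sets pays for this: 1/c exceeds the
    bound M of the curvatures because c M <= 1/2. Strictness needs more than H_x >= H_y: the
    comparison leaves a surplus (|d|/2) |v H_x|^2, so a vanishing trace inside the collar puts the
    plane into the kernel of H_x, then of H_y, and makes the p smallest curvatures vanish. *)

Section Directional.
Context {R : realType} {n : nat}.
Implicit Types (f : 'rV[R]_n -> R) (x y z a v : 'rV[R]_n).

(** Multiplying the difference quotient out removes the division and the exclusion of h = 0, so that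
    error terms can simply be added in the estimates below. *)
Lemma is_derive_normE (V : normedModType R) (x v : V) (f : V -> R) l :
  is_derive x v f l <-> forall e : R, 0 < e ->
    exists2 d : R, 0 < d & forall h : R, `|h| < d ->
      `|f (h *: v + x) - f x - h * l| <= e * `|h|.
Proof.
split=> [[df dl] e e0|H].
  have : (fun h => h^-1 *: (f (h *: v + x) - f x)) @ 0^' --> l.
    by rewrite -dl; exact: df.
  move=> /cvgrPdist_le /(_ e e0).
  rewrite /= near_withinE => /nbhs_normP[d /= d0 dP].
  exists d => // h hd; have [->|h0] := eqVneq h 0.
    by rewrite scale0r add0r subrr mul0r subrr normr0 mulr0.
  have := dP h; rewrite /ball_ /= sub0r normrN => /(_ hd h0).
  rewrite distrC -[X in `|_ - X|](mulKf h0) -mulrBr normrM normfV mulrC.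
  by rewrite ler_pdivrMr ?normr_gt0.
have cv : (fun h => h^-1 *: (f (h *: v + x) - f x)) @ 0^' --> l.
  apply/cvgrPdist_le => e e0; have [d d0 dP] := H e e0.
  rewrite /= near_withinE; apply/nbhs_normP; exists d => //= h.
  rewrite /ball_ /= sub0r normrN => hd h0.
  rewrite distrC -[X in `|_ - X|](mulKf h0) -mulrBr normrM normfV mulrC.
  by rewrite ler_pdivrMr ?normr_gt0 // dP.
split; first by apply/cvg_ex; exists l.
exact: cvg_lim cv.
Qed.

Lemma nbhs_normE x (A : set 'rV[R]_n) :
  nbhs x A <-> exists2 e : R, 0 < e & forall y, `|y - x| < e -> A y.
Proof.
split=> [/(@nbhs_normP _ _ x A)[e /= e0 eA]|[e e0 eA]].
  by exists e => // y yx; apply: eA; rewrite /ball_ /= distrC.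
by apply/(@nbhs_normP _ _ x A); exists e => //= y; rewrite /ball_ /= distrC; exact: eA.
Qed.

Lemma continuous_normE x f :
  {for x, continuous f} <-> forall e : R, 0 < e ->
    exists2 d : R, 0 < d & forall y, `|y - x| < d -> `|f y - f x| < e.
Proof.
have E := @cvgrPdist_lt _ R _ (nbhs x) _ f (f x).
split=> [/E cf e e0|cf].
  by have /nbhs_normE[d d0 dP] := cf e e0; exists d => // y /dP; rewrite distrC.
apply/E => e e0; have [d d0 dP] := cf e e0.
by apply/nbhs_normE; exists d => // y yx; rewrite distrC; exact: dP.
Qed.

Lemma is_derive_line x v f (s : R) : derivable f (s *: v + x) v ->
  is_derive s 1 (fun t : R => f (t *: v + x)) ('D_v f (s *: v + x)).
Proof.
move=> df; rewrite /derive.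
have E : (fun h : R => h^-1 *: (f ((h *: 1 + s) *: v + x) - f (s *: v + x))) =
    (fun h : R => h^-1 *: (f (h *: v + (s *: v + x)) - f (s *: v + x))).
  by apply/funext => h; rewrite [h *: 1]mulr1 scalerDl addrA.
by split; rewrite /derivable /derive E.
Qed.

Lemma mean_value_line x v f (h : R) :
  (forall s : R, `|s| <= `|h| -> derivable f (s *: v + x) v) ->
  exists2 s : R, `|s| <= `|h| & f (h *: v + x) - f x = h * 'D_v f (s *: v + x).
Proof.
move=> df; pose u (t : R) := f (t *: v + x).
have du (s : R) : `|s| <= `|h| -> is_derive s 1 u ('D_v f (s *: v + x)).
  by move=> sh; apply/is_derive_line/df.
have cu (a b : R) : (forall s, a <= s <= b -> `|s| <= `|h|) ->
    {within `[a, b], continuous u}.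
  move=> ab; apply: derivable_within_continuous => s sab.
  have sh : `|s| <= `|h| by apply: ab; rewrite in_itv /= in sab.
  by have [] := du s sh.
have [h0|h0] := leP 0 h.
  have sh s : 0 <= s <= h -> `|s| <= `|h|.
    by move=> /andP[s0 sh]; rewrite !ger0_norm.
  have [||s] := @MVT_segment _ u (fun s => 'D_v f (s *: v + x)) 0 h h0.
  - move=> s; rewrite in_itv /= => /andP[s0 s1].
    by apply: du; rewrite sh // !ltW.
  - exact: cu.
  rewrite in_itv /= => /sh shh; rewrite /u scale0r add0r subr0 mulrC => E.
  by exists s.
have sh s : h <= s <= 0 -> `|s| <= `|h|.
  by move=> /andP[s0 sh]; rewrite !ler0_norm ?lerN2 // ltW.
have [||s] := @MVT_segment _ u (fun s => 'D_v f (s *: v + x)) h 0 (ltW h0).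
- move=> s; rewrite in_itv /= => /andP[s0 s1].
  by apply: du; rewrite sh // !ltW.
- exact: cu.
rewrite in_itv /= => /sh shh; rewrite /u scale0r add0r sub0r mulrN => E.
by exists s => //; rewrite mulrC -[RHS]opprK -E opprB.
Qed.

End Directional.

(** * Strict differentiability of C^1 functions *)

Section StrictDifferentiability.
Context {R : realType} {n : nat}.
Implicit Types (f : 'rV[R]_n -> R) (x y z a v : 'rV[R]_n).

Lemma coord_le_norm x i : `|x 0 i| <= `|x|.
Proof.
have /mapP[j Hj ->] : `|x 0 i| \in [seq `|x k.1 k.2| | k : 'I_1 * 'I_n].
  by apply/mapP; exists (0, i) => //=; rewrite mem_enum.
by rewrite [leRHS]/Num.norm /= mx_normrE; apply/bigmax_geP; right => /=; exists j.
Qed.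

Lemma coord_sub_le x y i : `|x 0 i - y 0 i| <= `|x - y|.
Proof. by have := coord_le_norm (x - y) i; rewrite !mxE. Qed.

Lemma norm_le_coord x (e : R) : 0 <= e -> (forall i, `|x 0 i| <= e) -> `|x| <= e.
Proof.
move=> e0 xe; rewrite [leLHS]/Num.norm /= mx_normrE.
by apply/bigmax_leP; split=> // -[i j] _; rewrite ord1; exact: xe.
Qed.

Lemma norm_delta_le i : `|delta_mx 0 i : 'rV[R]_n| <= 1.
Proof.
by apply: norm_le_coord => // j; rewrite mxE eqxx /=; case: eqP; rewrite ?normr1 ?normr0.
Qed.

Lemma norm_dot_le x y : `|dot x y| <= n%:R * `|x| * `|y|.
Proof.
apply: le_trans (ler_norm_sum _ _ _) _.
apply: le_trans (_ : \sum_(i < n) `|x| * `|y| <= _).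
  by apply: ler_sum => i _; rewrite normrM ler_pM // coord_le_norm.
by rewrite sumr_const card_ord -mulrA mulr_natl.
Qed.

(** Turns estimates for each coordinate into one for the vector: by monotonicity the minimum of the
    radii serves all indices. *)
Lemma fin_radius (I : finType) (P : I -> R -> Prop) :
  (forall i e e', e' <= e -> P i e -> P i e') ->
  (forall i, exists2 e : R, 0 < e & P i e) -> exists2 e : R, 0 < e & forall i, P i e.
Proof.
move=> mono H; pose E i := sval (cid2 (H i)); exists (\big[Num.min/1]_i E i).
  by apply/bigmin_gtP; split=> // i _; rewrite /E; case: cid2.
move=> i; apply: mono (bigmin_le 1 i E) _.
by rewrite /E; case: cid2.
Qed.

(** Both points move. Continuity of the partial derivatives at x gives this form directly, and
    unlike differentiability at x it contains a Lipschitz bound near x. *)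
Definition strict_diff f x a := forall e : R, 0 < e ->
  exists2 d : R, 0 < d & forall y z, `|y - x| < d -> `|z - x| < d ->
    `|f y - f z - dot (y - z) a| <= e * `|y - z|.

(** Corners of a path from z to y parallel to the axes: the first k coordinates are already those of
    y. *)
Let hybrid y z (k : nat) : 'rV[R]_n := \row_i if (i < k)%N then y 0 i else z 0 i.

(** The increment telescopes over the corners [hybrid y z k]; on each edge the mean value theorem
    turns it into a partial derivative at a point near x, where it is close to its value at x. *)
Lemma C1_strict_diff f x :
  (exists2 r : R, 0 < r &
     forall y i, `|y - x| < r -> derivable f y (delta_mx 0 i)) ->
  (forall i, {for x, continuous (partial i f)}) -> strict_diff f x (grad f x).
Proof.
move=> [r r0 df] cf e e0; pose e' := e / n.+1%:R.
have e'0 : 0 < e' by rewrite divr_gt0.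
have [d d0 dP] : exists2 d : R, 0 < d &
    forall i y, `|y - x| < d -> `|partial i f y - partial i f x| < e'.
  apply: fin_radius => [i c c' cc' H y yx|i].
    by apply: H; exact: lt_le_trans cc'.
  exact: (continuous_normE x (partial i f)).1.
pose m := Num.min d r; have m0 : 0 < m by rewrite lt_min d0 r0.
have mr : m <= r by rewrite ge_min lexx orbT.
(* A point of an edge is within |y - z| <= 2 m / 3 of a corner, and each corner is within m / 3 of
   x. *)
exists (m / 3) => [|y z yx zx]; first by rewrite divr_gt0.
have hyb k : `|hybrid y z k - x| < m / 3.
  apply: le_lt_trans (_ : Num.max `|y - x| `|z - x| < _).
    apply: norm_le_coord => [|i]; first by rewrite le_max normr_ge0.
    rewrite !mxE le_max; case: ifP => _; apply/orP; [left|right].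
      by have := coord_le_norm (y - x) i; rewrite !mxE.
    by have := coord_le_norm (z - x) i; rewrite !mxE.
  by rewrite gt_max yx zx.
have yz : `|y - z| <= m / 3 + m / 3.
  have -> : y - z = (y - x) + (x - z) by rewrite addrA subrK.
  by rewrite (le_trans (ler_normD _ _)) // lerD // ltW // distrC.
have step (k : 'I_n) : exists2 w, `|w - x| < m &
    f (hybrid y z k.+1) - f (hybrid y z k) = (y 0 k - z 0 k) * partial k f w.
  have -> : hybrid y z k.+1 =
      (y 0 k - z 0 k) *: delta_mx 0 k + hybrid y z k.
    apply/rowP => j; rewrite !mxE ltnS eqxx /= leq_eqVlt.
    have [->|jk] := eqVneq j k; first by rewrite eqxx ltnn mulr1 subrK.
    by rewrite (negbTE (_ : j != k :> nat)) // mulr0 add0r.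
  have near_k (s : R) : `|s| <= `|y 0 k - z 0 k| ->
      `|s *: delta_mx 0 k + hybrid y z k - x| < m.
    move=> sk; rewrite -addrA (le_lt_trans (ler_normD _ _)) //.
    have -> : m = m / 3 + m / 3 + m / 3 by lra.
    apply: ler_ltD (hyb k); rewrite normrZ; apply: le_trans yz.
    apply: le_trans (_ : `|s| * 1 <= _).
      by rewrite ler_wpM2l // norm_delta_le.
    rewrite mulr1 (le_trans sk) //.
    by have := coord_le_norm (y - z) k; rewrite !mxE.
  have [s sk ->] := mean_value_line (f := f) (x := hybrid y z k)
    (v := delta_mx 0 k) (h := y 0 k - z 0 k)
    (fun s sk => df _ _ (lt_le_trans (near_k s sk) mr)).
  by exists (s *: delta_mx 0 k + hybrid y z k) => //; exact: near_k.
have -> : f y - f z = \sum_(k < n) (f (hybrid y z k.+1) - f (hybrid y z k)).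
  rewrite -(big_mkord xpredT (fun k => f (hybrid y z k.+1) - f (hybrid y z k))).
  rewrite telescope_sumr //; congr (f _ - f _); apply/rowP => i.
    by rewrite mxE ltn_ord.
  by rewrite mxE.
rewrite /dot -sumrB (le_trans (ler_norm_sum _ _ _)) //.
apply: le_trans (_ : \sum_(k < n) e' * `|y - z| <= _).
  apply: ler_sum => k _; have [w wm ->] := step k.
  rewrite !mxE -mulrBr normrM mulrC ler_pM //.
    by rewrite ltW // dP // (lt_le_trans wm) // ge_min lexx.
  by have := coord_le_norm (y - z) k; rewrite !mxE.
rewrite sumr_const card_ord -mulrnAl ler_wpM2r // /e' -mulr_natr.
by rewrite -mulrA ler_piMr ?(ltW e0) // ler_pdivrMl ?ltr0Sn // mulr1 ler_nat.
Qed.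

Lemma strict_diff_lipschitz f x a : strict_diff f x a ->
  exists C : R, 0 <= C /\ exists2 d : R, 0 < d & forall y z,
    `|y - x| < d -> `|z - x| < d -> `|f y - f z| <= C * `|y - z|.
Proof.
move=> /(_ 1 ltr01)[d d0 dP]; exists (1 + n%:R * `|a|).
split; first by rewrite addr_ge0 ?mulr_ge0.
exists d => // y z yx zx; rewrite -[f y - f z](subrK (dot (y - z) a)).
rewrite (le_trans (ler_normD _ _)) // mulrDl lerD ?dP //.
by rewrite (le_trans (norm_dot_le _ _)) // mulrAC.
Qed.

End StrictDifferentiability.

(** * Chain rules and powers of the positive part *)

Section ChainRules.
Context {R : realType}.

Lemma is_derive_comp1 n (x v : 'rV[R]_n) (f : 'rV[R]_n -> R) (phi : R -> R) l l' :
  is_derive x v f l -> is_derive (f x) 1 phi l' ->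
  is_derive x v (fun y => phi (f y)) (l' * l).
Proof.
have line (g : 'rV[R]_n -> R) m :
    is_derive x v g m <-> is_derive (0 : R) 1 (fun h : R => g (h *: v + x)) m.
  have E : (fun h : R => h^-1 *: (g ((h *: 1 + 0) *: v + x) - g (0 *: v + x))) =
      (fun h : R => h^-1 *: (g (h *: v + x) - g x)).
    by apply/funext => h; rewrite [h *: 1]mulr1 addr0 scale0r add0r.
  by split=> -[d1 d2]; split; move: d1 d2; rewrite /derivable /derive E.
move=> /line df dphi; apply/line; apply: is_derive1_comp.
by rewrite scale0r add0r.
Qed.

(** The outer function needs a full linear approximation at [q x], since the image of the line under
    q is a curve; of the inner map only directional derivatives of the coordinates enter. *)
Lemma is_derive_chain m n (x v : 'rV[R]_m) (q : 'rV[R]_m -> 'rV[R]_n) (w : 'rV[R]_n)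
    (f : 'rV[R]_n -> R) a :
  strict_diff f (q x) a ->
  (forall j, is_derive x v (fun y => q y 0 j) (w 0 j)) ->
  is_derive x v (fun y => f (q y)) (dot w a).
Proof.
move=> fa dq; apply/is_derive_normE => e e0.
pose e' := e / (1 + `|w| + n%:R * `|a|).
have M0 : 0 < 1 + `|w| + n%:R * `|a| by rewrite ltr_pwDl ?mulr_ge0 // ltr_pwDl.
have e'0 : 0 < e' by rewrite divr_gt0.
have [d d0 dP] := fa e' e'0; pose e1 := Num.min e' 1.
have e10 : 0 < e1 by rewrite lt_min e'0 ltr01.
have [c c0 cP] : exists2 c : R, 0 < c & forall h : R, `|h| < c ->
    `|q (h *: v + x) - q x - h *: w| <= e1 * `|h|.
  have [|j|c c0 cP] := @fin_radius R 'I_n (fun j c => forall h : R, `|h| < c ->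
      `|q (h *: v + x) 0 j - q x 0 j - h * w 0 j| <= e1 * `|h|).
  - by move=> i c c' cc' H h hc; apply: H; exact: lt_le_trans cc'.
  - exact: (is_derive_normE _ _ _ _).1.
  exists c => // h hc; apply: norm_le_coord => [|j]; first by rewrite mulr_ge0 // ltW.
  by rewrite !mxE cP.
have C0 : 0 < 1 + `|w| by rewrite ltr_pwDl.
exists (Num.min c (d / (1 + `|w|))) => [|h]; first by rewrite lt_min c0 divr_gt0.
rewrite lt_min => /andP[/cP hc hd]; set u := q (h *: v + x) - q x.
have ub : `|u| <= (1 + `|w|) * `|h|.
  rewrite -[u](subrK (h *: w)) (le_trans (ler_normD _ _)) // mulrDl lerD //.
    by rewrite (le_trans hc) // ler_wpM2r // ge_min lexx orbT.
  by rewrite normrZ mulrC.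
have /= := dP (q (h *: v + x)) (q x); rewrite subrr normr0 => /(_ _ d0) H.
have {}H : `|f (q (h *: v + x)) - f (q x) - dot u a| <= e' * `|u|.
  by apply: H; rewrite (le_lt_trans ub) // mulrC -ltr_pdivlMr.
have -> : f (q (h *: v + x)) - f (q x) - h * dot w a =
    (f (q (h *: v + x)) - f (q x) - dot u a) + dot (u - h *: w) a.
  by rewrite dotDl -[- (h *: w)]scaleNr dotZl; ring.
rewrite (le_trans (ler_normD _ _)) //.
apply: le_trans (_ : e' * ((1 + `|w|) * `|h|) + n%:R * (e' * `|h|) * `|a| <= _).
  apply: lerD; first by apply: le_trans H _; rewrite ler_wpM2l // ltW.
  apply: le_trans (norm_dot_le _ _) _; rewrite ler_wpM2r // ler_wpM2l //.
  by rewrite (le_trans hc) // ler_wpM2r // ge_min lexx.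
rewrite [leLHS](_ : _ = e' * (1 + `|w| + n%:R * `|a|) * `|h|); last by ring.
by rewrite /e' divfK // gt_eqF.
Qed.

(** For the square the linearisation error is at most h^2, by cases on the signs; higher powers
    follow from the product rule, as max(s,0)^(k+3) = s max(s,0)^(k+2). *)
Lemma is_derive_maxX k (t : R) :
  is_derive t 1 (fun s : R => Num.max s 0 ^+ k.+2)
    (k.+2%:R * Num.max t 0 ^+ k.+1).
Proof.
elim: k => [|k IH].
  apply/is_derive_normE => e e0; exists e => // h he.
  rewrite [h *: 1]mulr1 expr1.
  have : `|Num.max (h + t) 0 ^+ 2 - Num.max t 0 ^+ 2 - h * (2 * Num.max t 0)|
      <= `|h| * `|h|.
    rewrite -normrM -expr2 [`|h ^+ 2|]ger0_norm ?sqr_ge0 // ler_norml.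
    have [t0|t0] := leP t 0; have [ht|ht] := leP (h + t) 0; apply/andP; nra.
  by move=> /le_trans; apply; rewrite ler_wpM2r // ltW.
have E : (fun s : R => Num.max s 0 ^+ k.+3) = id * (fun s => Num.max s 0 ^+ k.+2).
  apply/funext => s; rewrite fctE exprS; case: (leP s 0) => // s0.
  by rewrite exprS !mul0r mulr0.
have := is_deriveM (is_derive_id t 1) IH; rewrite -E => H. apply: is_derive_eq H _.
rewrite [_ *: 1]mulr1 [t *: _](_ : _ = t * (k.+2%:R * Num.max t 0 ^+ k.+1)) //.
have -> : t * (k.+2%:R * Num.max t 0 ^+ k.+1) = k.+2%:R * Num.max t 0 ^+ k.+2.
  rewrite mulrCA (exprS _ k.+1); congr (_ * _); case: (leP t 0) => // t0.
  by rewrite exprS !mul0r mulr0.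
by rewrite -[k.+3%:R]natr1 [RHS]mulrDl mul1r.
Qed.

End ChainRules.

(** * Hoelder classes *)

Section HolderClass.
Context {R : realType} {n : nat}.
Variable alpha : R.
Hypothesis alpha01 : 0 < alpha <= 1.
Implicit Types (f g : 'rV[R]_n -> R) (x y z a v : 'rV[R]_n) (U V : set 'rV[R]_n).

(** Recursive form of [holder_class], equivalent to it by [holder_classP]; closure properties then
    go by induction on the order. *)
Fixpoint holderC k U f : Prop :=
  match k with
  | 0 => (forall x, U x -> {for x, continuous f}) /\ locally_holder alpha U f
  | k'.+1 => [/\ forall x, U x -> {for x, continuous f},
                 forall x i, U x -> derivable f x (delta_mx 0 i) &
                 forall i, holderC k' U (partial i f)]
  end.

Lemma iter_partial_rcons s i f :
  iter_partial (rcons s i) f = iter_partial s (partial i f).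
Proof. by rewrite /iter_partial foldr_rcons. Qed.

(** [holderC] differentiates f first and descends afterwards, and the derivative applied first is
    the last entry of the list: lists are taken apart from the right. *)
Lemma holder_classP r U f : holder_class r alpha U f <-> holderC r U f.
Proof.
elim: r f => [|r IH] f; split.
- by case=> _ c h; split=> [x Ux|]; [exact: (c [::])|exact: (h [::])].
- by case=> c h; split=> [//|[|i s] // x _|[|i s] //]; exact: c.
- case=> d c h; split=> [x Ux|x i Ux|i].
  + exact: (c [::]).
  + exact: (d [::]).
  + apply/IH; split=> [s x j sr|s x sr|s sr]; rewrite -iter_partial_rcons.
    * by apply: d; rewrite size_rcons ltnS.
    * by apply: c; rewrite size_rcons ltnS.
    * by apply: h; rewrite size_rcons sr.
- case=> c d H; have {}H i := (IH _).2 (H i); split=> s.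
  + case/lastP: s => [|s j] x i sr Ux; first exact: d.
    rewrite iter_partial_rcons; have [D _ _] := H j.
    by apply: D => //; rewrite size_rcons ltnS in sr.
  + case/lastP: s => [|s j] x sr Ux; first exact: c.
    rewrite iter_partial_rcons; have [_ D _] := H j.
    by apply: D => //; rewrite size_rcons ltnS in sr.
  + case/lastP: s => [|s j] // sr.
    rewrite iter_partial_rcons; have [_ _ D] := H j.
    by apply: D => //; rewrite size_rcons in sr; case: sr.
Qed.

Lemma locally_holder_local U f :
  (forall x, U x -> exists2 V, V x & locally_holder alpha V f) ->
  locally_holder alpha U f.
Proof. by move=> H x /H[V Vx] /(_ x Vx). Qed.

Lemma holderC_local k U f :
  (forall x, U x -> exists2 V, V x & holderC k V f) -> holderC k U f.
Proof.
elim: k f => [|k IH] f H.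
  split=> [x /H[V Vx [c _]]|]; first exact: c.
  by apply: locally_holder_local => x /H[V Vx []]; exists V.
split=> [x /H[V Vx [c _ _]]|x i /H[V Vx [_ d _]]|i]; [exact: c|exact: d|].
by apply: IH => x /H[V Vx [_ _ h]]; exists V => //; exact: h.
Qed.

Lemma holderC_sub k U V f : V `<=` U -> holderC k U f -> holderC k V f.
Proof. by move=> VU H; apply: holderC_local => x /VU Ux; exists U. Qed.

Lemma near_open U f g x : open U -> {in U, f =1 g} -> U x ->
  \near x, f x = g x.
Proof.
move=> oU fg Ux; have : nbhs x U by exact: open_nbhs_nbhs.
move=> nU; apply: (@filterS _ (nbhs x) _ U _ _ nU) => y Uy.
by apply: fg; rewrite inE.
Qed.

Lemma eq_partial U f g i : open U -> {in U, f =1 g} ->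
  {in U, partial i f =1 partial i g}.
Proof.
by move=> oU fg x; rewrite inE => Ux; apply: near_eq_derive; exact: near_open fg Ux.
Qed.

Lemma near_continuous f g x : (\near x, f x = g x) ->
  {for x, continuous f} -> {for x, continuous g}.
Proof.
move=> fg /continuous_normE cf; apply/continuous_normE => e e0.
have [d d0 dP] := cf e e0; have [c c0 cP] := (nbhs_normE x _).1 fg.
exists (Num.min c d) => [|y]; first by rewrite lt_min c0.
by rewrite lt_min => /andP[/cP <- /dP]; rewrite -(cP x) // subrr normr0.
Qed.

Lemma eq_holderC k U f g : open U -> {in U, f =1 g} ->
  holderC k U f -> holderC k U g.
Proof.
move=> oU; elim: k f g => [|k IH] f g fg.
  move=> [c h]; split=> x Ux.
    exact: near_continuous (near_open oU fg Ux) (c _ Ux).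
  have [C [V Vx H]] := h x Ux; exists C; exists (V `&` U).
    by apply: filterI => //; exact: open_nbhs_nbhs.
  by move=> y z [Vy Uy] [Vz Uz]; rewrite -!fg ?inE //; exact: H.
move=> [c d h]; split=> [x Ux|x i Ux|i].
- exact: near_continuous (near_open oU fg Ux) (c _ Ux).
- exact: near_eq_derivable (near_open oU fg Ux) (d _ i Ux).
- exact: IH (eq_partial i oU fg) (h i).
Qed.

Lemma holderC_continuous k U f : holderC k U f ->
  forall x, U x -> {for x, continuous f}.
Proof. by case: k => [|k] []. Qed.

Definition lipschitz_at f x := exists C : R, 0 <= C /\ exists2 d : R, 0 < d &
  forall y z, `|y - x| < d -> `|z - x| < d -> `|f y - f z| <= C * `|y - z|.

Lemma lipschitz_continuous f x : lipschitz_at f x -> {for x, continuous f}.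
Proof.
move=> [C [C0 [d d0 dP]]]; apply/continuous_normE => e e0.
exists (Num.min d (e / (C + 1))) => [|y].
  by rewrite lt_min d0 divr_gt0 // ltr_pwDr.
rewrite lt_min => /andP[yd]; rewrite ltr_pdivlMr ?ltr_pwDr // => ye.
apply: le_lt_trans ye; apply: le_trans (dP y x yd _) _; rewrite ?subrr ?normr0 //.
by rewrite mulrC ler_wpM2l // lerDl.
Qed.

Lemma lipschitz_holder U f : (forall x, U x -> lipschitz_at f x) -> holderC 0 U f.
Proof.
move=> H; split=> [x /H|x /H]; first exact: lipschitz_continuous.
move=> [C [C0 [d d0 dP]]]; exists C.
(* The radius 1/2 keeps |y - z| <= 1, where |y - z| is at most its power with exponent alpha <=
   1. *)
exists [set y | `|y - x| < Num.min d (1 / 2)].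
  by apply/nbhs_normE; exists (Num.min d (1 / 2)); rewrite // lt_min d0 /=; lra.
move=> y z /=; rewrite !lt_min => /andP[yd y1] /andP[zd z1].
apply: le_trans (dP y z yd zd) _; rewrite ler_wpM2l //.
have [->|yz] := eqVneq y z; first by rewrite subrr normr0 powR_ge0.
case/andP: alpha01 => a0 a1; apply: ger1_powR => //.
rewrite normr_gt0 subr_eq0 yz /=.
have -> : y - z = (y - x) - (z - x) by rewrite opprB addrA subrK.
by apply: le_trans (ler_normB _ _) _; lra.
Qed.

Lemma C1_strict U f x : open U -> U x ->
  (forall y i, U y -> derivable f y (delta_mx 0 i)) ->
  (forall i, {for x, continuous (partial i f)}) -> strict_diff f x (grad f x).
Proof.
move=> oU Ux d c; apply: C1_strict_diff c.
have /nbhs_normE[r r0 rU] : nbhs x U by exact: open_nbhs_nbhs.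
by exists r => // y i /rU; exact: d.
Qed.

Lemma holderC_strict k U f x : open U -> U x -> holderC k.+1 U f ->
  strict_diff f x (grad f x).
Proof.
move=> oU Ux [c d h]; apply: (C1_strict oU Ux d) => i.
exact: holderC_continuous (h i) x Ux.
Qed.

Lemma holderC_lipschitz k U f x : open U -> U x -> holderC k.+1 U f ->
  lipschitz_at f x.
Proof.
by move=> oU Ux H; apply: strict_diff_lipschitz; exact: holderC_strict H.
Qed.

Lemma holderCW k U f : open U -> holderC k.+1 U f -> holderC k U f.
Proof.
move=> oU; elim: k f => [|k IH] f H.
  by apply: lipschitz_holder => x Ux; exact: holderC_lipschitz H.
by case: H => c d h; split=> // i; apply: IH; exact: h.
Qed.

Lemma holderC_le k m U f : open U -> (k <= m)%N -> holderC m U f -> holderC k U f.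
Proof.
move=> oU; elim: m => [|m IH]; first by rewrite leqn0 => /eqP ->.
by rewrite leq_eqVlt => /orP[/eqP->//|/IH H] /(holderCW oU) /H.
Qed.

(** The means of raising the order: only a formula for the partial derivatives is asked for, since
    their continuity already makes f locally Lipschitz. *)
Lemma holderCS k U f (F : 'I_n -> 'rV[R]_n -> R) : open U ->
  (forall x i, U x -> is_derive x (delta_mx 0 i) f (F i x)) ->
  (forall i, holderC k U (F i)) -> holderC k.+1 U f.
Proof.
move=> oU dF hF; have pF i : {in U, F i =1 partial i f}.
  by move=> x; rewrite inE => Ux; rewrite /partial; have [_ ->] := dF x i Ux.
have d x i : U x -> derivable f x (delta_mx 0 i) by case/(dF _ i).
have hp i : holderC k U (partial i f) by exact: eq_holderC (pF i) (hF i).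
split=> // x Ux; apply: lipschitz_continuous.
apply: strict_diff_lipschitz; apply: (C1_strict oU Ux d) => i.
exact: holderC_continuous (hp i) x Ux.
Qed.

Lemma holderC_cst k U (c : R) : open U -> holderC k U (fun=> c).
Proof.
move=> oU; elim: k c => [|k IH] c.
  apply: lipschitz_holder => x _; exists 0; split=> //.
  by exists 1 => // y z _ _; rewrite subrr normr0 mul0r.
apply: (@holderCS _ _ _ (fun _ _ => 0)) => // x i _; exact: is_derive_cst.
Qed.

Lemma is_derive_coord x v i : is_derive x v (fun y => y 0 i) (v 0 i).
Proof.
apply/is_derive_normE => e e0; exists 1 => // h _.
by rewrite !mxE addrK subrr normr0 mulr_ge0 // ltW.
Qed.

Lemma holderC_coord k U i : open U -> holderC k U (fun x => x 0 i).
Proof.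
move=> oU; case: k => [|k].
  apply: lipschitz_holder => x _; exists 1; split=> //.
  exists 1 => // y z _ _; rewrite mul1r.
  by have := coord_le_norm (y - z) i; rewrite !mxE.
apply: (@holderCS _ _ _ (fun j _ => (delta_mx 0 j : 'rV[R]_n) 0 i)) => //.
  by move=> x j _; exact: is_derive_coord.
by move=> j; exact: holderC_cst.
Qed.

Lemma holderCD k U f g : open U -> holderC k U f -> holderC k U g ->
  holderC k U (fun x => f x + g x).
Proof.
move=> oU; elim: k f g => [|k IH] f g.
  move=> [cf hf] [cg hg]; split=> x Ux; first by apply: (@continuousD _ _ _ f g x); [exact: cf|exact: cg].
  have [C [V Vx HV]] := hf x Ux; have [C' [V' Vx' HV']] := hg x Ux.
  exists (C + C'); exists (V `&` V'); first exact: filterI.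
  move=> y z [Vy Vy'] [Vz Vz']; rewrite mulrDl.
  have -> : f y + g y - (f z + g z) = (f y - f z) + (g y - g z) by ring.
  by apply: le_trans (ler_normD _ _) _; rewrite lerD ?HV ?HV'.
move=> [cf df hf] [cg dg hg].
apply: (@holderCS _ _ _ (fun i x => partial i f x + partial i g x)) => // [x i Ux|i].
  by apply: is_deriveD; apply/derivableP; [exact: df|exact: dg].
by apply: IH; [exact: hf|exact: hg].
Qed.

Lemma holderCM k U f g : open U -> holderC k U f -> holderC k U g ->
  holderC k U (fun x => f x * g x).
Proof.
move=> oU; elim: k f g => [|k IH] f g.
  move=> [cf hf] [cg hg]; split=> x Ux; first by apply: (@continuousM _ _ f g x); [exact: cf|exact: cg].
  have [C [V Vx HV]] := hf x Ux; have [C' [V' Vx' HV']] := hg x Ux.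
  have [d d0 dP] := (continuous_normE _ _).1 (cf x Ux) 1 ltr01.
  have [d' d'0 dP'] := (continuous_normE _ _).1 (cg x Ux) 1 ltr01.
  exists ((`|f x| + 1) * `|C'| + (`|g x| + 1) * `|C|).
  exists (V `&` V' `&` [set y | `|y - x| < Num.min d d']).
    apply: filterI; first exact: filterI.
    by apply/nbhs_normE; exists (Num.min d d'); rewrite // lt_min d0.
  move=> y z [[Vy Vy'] /=]; rewrite lt_min => /andP[yd yd'] [[Vz Vz'] /=].
  rewrite lt_min => /andP[zd zd']; rewrite mulrDl.
  have -> : f y * g y - f z * g z = f y * (g y - g z) + g z * (f y - f z) by ring.
  have ub (h : 'rV[R]_n -> R) w : `|h w - h x| < 1 -> `|h w| <= `|h x| + 1.
    move=> H; rewrite -[h w](subrK (h x)) (le_trans (ler_normD _ _)) //.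
    by rewrite addrC lerD // ltW.
  apply: le_trans (ler_normD _ _) _; rewrite !normrM -!mulrA.
  apply: lerD; apply: ler_pM => //.
  - by apply: ub; exact: dP.
  - by apply: le_trans (HV' _ _ Vy' Vz') _; rewrite ler_wpM2r ?powR_ge0 ?ler_norm.
  - by apply: ub; exact: dP'.
  - by apply: le_trans (HV _ _ Vy Vz) _; rewrite ler_wpM2r ?powR_ge0 ?ler_norm.
move=> hf hg; have [cf df pf] := hf; have [cg dg pg] := hg.
apply: (@holderCS _ _ _ (fun i x => f x * partial i g x + g x * partial i f x)) => //.
  move=> x i Ux.
  by have := is_deriveM (derivableP (df x i Ux)) (derivableP (dg x i Ux)).
have wf := holderCW oU hf; have wg := holderCW oU hg.
by move=> i; have pfi := pf i; have pgi := pg i; apply: holderCD => //; apply: IH.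
Qed.

Lemma holderCZ k U c f : open U -> holderC k U f -> holderC k U (fun x => c * f x).
Proof. by move=> oU; apply: holderCM => //; exact: holderC_cst. Qed.

Lemma holderCB k U f g : open U -> holderC k U f -> holderC k U g ->
  holderC k U (fun x => f x - g x).
Proof.
move=> oU hf hg.
apply: (@eq_holderC _ _ (fun x => f x + -1 * g x)) => // [x _|].
  by rewrite mulN1r.
by apply: holderCD => //; exact: holderCZ.
Qed.

Lemma holderC_sum k U (I : Type) (s : seq I) (F : I -> 'rV[R]_n -> R) : open U ->
  (forall i, holderC k U (F i)) -> holderC k U (fun x => \sum_(i <- s) F i x).
Proof.
move=> oU hF; elim: s => [|i s IH].
  apply: (@eq_holderC _ _ (fun=> 0)) => // [x _|]; last exact: holderC_cst.
  by rewrite big_nil.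
apply: (@eq_holderC _ _ (fun x => F i x + \sum_(j <- s) F j x)) => // [x _|].
  by rewrite big_cons.
exact: holderCD.
Qed.

Lemma holderC_prod k U (I : Type) (s : seq I) (F : I -> 'rV[R]_n -> R) : open U ->
  (forall i, holderC k U (F i)) -> holderC k U (fun x => \prod_(i <- s) F i x).
Proof.
move=> oU hF; elim: s => [|i s IH].
  apply: (@eq_holderC _ _ (fun=> 1)) => // [x _|]; last exact: holderC_cst.
  by rewrite big_nil.
apply: (@eq_holderC _ _ (fun x => F i x * \prod_(j <- s) F j x)) => // [x _|].
  by rewrite big_cons.
exact: holderCM.
Qed.

Lemma holderC_det k U m (F : 'rV[R]_n -> 'M[R]_m) : open U ->
  (forall i j, holderC k U (fun x => F x i j)) ->
  holderC k U (fun x => \det (F x)).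
Proof.
move=> oU hF; rewrite /determinant; apply: holderC_sum => // s.
by apply: holderCZ => //; apply: holderC_prod.
Qed.

Definition locally_lipschitz1 (phi : R -> R) t :=
  exists C : R, exists2 d : R, 0 < d & forall b c : R,
    `|b - t| < d -> `|c - t| < d -> `|phi b - phi c| <= C * `|b - c|.

(** A Lipschitz outer function keeps the exponent alpha. *)
Lemma holderC0_comp1 U f (phi : R -> R) :
  (forall x, U x -> locally_lipschitz1 phi (f x)) ->
  holderC 0 U f -> holderC 0 U (fun x => phi (f x)).
Proof.
move=> hphi [cf hf]; split=> x Ux.
  have [C [d d0 dP]] := hphi x Ux.
  apply/continuous_normE => e e0.
  have e'0 : 0 < Num.min d (e / (`|C| + 1)).
    by rewrite lt_min d0 divr_gt0 // ltr_pwDr.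
  have [c c0 cP] := (continuous_normE _ _).1 (cf x Ux) _ e'0.
  exists c => // y /cP; rewrite lt_min => /andP[yd].
  rewrite ltr_pdivlMr ?ltr_pwDr // => ye.
  apply: le_lt_trans ye; apply: le_trans (dP _ _ yd _) _; rewrite ?subrr ?normr0 //.
  by rewrite mulrC ler_wpM2l // (le_trans (ler_norm C)) // lerDl.
have [C [d d0 dP]] := hphi x Ux; have [C' [V Vx HV]] := hf x Ux.
have [c c0 cP] := (continuous_normE _ _).1 (cf x Ux) _ d0.
exists (`|C| * C'); exists (V `&` [set y | `|y - x| < c]).
  by apply: filterI => //; apply/nbhs_normE; exists c.
move=> y z [Vy /= /cP yc] [Vz /= /cP zc].
apply: le_trans (dP _ _ yc zc) _; rewrite -mulrA.
by rewrite (le_trans (ler_wpM2r _ (ler_norm C))) // ler_wpM2l // HV.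
Qed.

Lemma holderCV k U f : open U -> (forall x, U x -> f x != 0) ->
  holderC k U f -> holderC k U (fun x => (f x)^-1).
Proof.
move=> oU f0; elim: k => [|k IH].
  apply: (@holderC0_comp1 U f (fun t => t^-1)) => x /f0 {f0}; move: (f x) => t t0.
  have t0' : 0 < `|t| by rewrite normr_gt0.
  exists (2 / `|t| * (2 / `|t|)); exists (`|t| / 2); first by rewrite divr_gt0.
  have lb b : `|b - t| < `|t| / 2 -> `|t| / 2 < `|b|.
    by move=> bt; have := ler_normD b (t - b); rewrite subrKC (distrC t b); lra.
  have lbn b : `|b - t| < `|t| / 2 -> b != 0.
    by move=> /lb bt; rewrite -normr_gt0 (lt_trans _ bt) // divr_gt0.
  have lbV b : `|b - t| < `|t| / 2 -> `|b|^-1 <= 2 / `|t|.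
    by move=> /lb bt; rewrite -[2 / _]invf_div lef_pV2 ?posrE ?(ltW bt) ?divr_gt0 //;
       rewrite (lt_trans _ bt) // divr_gt0.
  move=> b c bt ct; have b0 := lbn b bt; have c0 := lbn c ct.
  have -> : b^-1 - c^-1 = b^-1 * c^-1 * (c - b) by field; rewrite b0 c0.
  rewrite !normrM !normfV (distrC c b) ler_wpM2r // ler_pM ?invr_ge0 //; exact: lbV.
move=> hf; have [cf df pf] := hf.
apply: (@holderCS _ _ _ (fun i x => - 1 * ((f x)^-1 * (f x)^-1 * partial i f x))) => //.
  move=> x i Ux; split; first by apply: derivableV; [exact: f0|exact: df].
  rewrite (deriveV (f0 _ Ux) (df x i Ux)) /partial mulN1r.
  by rewrite /GRing.scale /= mulNr expr2 invfM.
have wf := IH (holderCW oU hf); have wff := holderCM oU wf wf.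
by move=> i; apply: holderCZ => //; exact: holderCM oU wff (pf i).
Qed.

Lemma holderC_sqrt k U f : open U -> (forall x, U x -> 0 < f x) ->
  holderC k U f -> holderC k U (fun x => Num.sqrt (f x)).
Proof.
move=> oU f0; elim: k => [|k IH].
  apply: (@holderC0_comp1 U f Num.sqrt) => x /f0 {f0}; move: (f x) => t t0.
  exists (Num.sqrt t)^-1; exists (t / 2) => [|b c bt ct]; first by rewrite divr_gt0.
  have st : 0 < Num.sqrt t by rewrite sqrtr_gt0.
  have lb u : `|u - t| < t / 2 -> 0 <= u /\ Num.sqrt t / 2 <= Num.sqrt u.
    rewrite ltr_norml => ut; split; first by lra.
    have -> : Num.sqrt t / 2 = Num.sqrt (t / 4).
      rewrite sqrtrM ?(ltW t0) //; congr (_ * _).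
      have -> : 4^-1 = (2^-1 : R) ^+ 2 by field.
      by rewrite sqrtr_sqr ger0_norm.
    by rewrite ler_wsqrtr //; lra.
  have [b0 sb] := lb b bt; have [c0 sc] := lb c ct.
  have -> : b - c = (Num.sqrt b - Num.sqrt c) * (Num.sqrt b + Num.sqrt c).
    by rewrite -subr_sqr !sqr_sqrtr.
  rewrite normrM mulrCA ler_peMr // ler_pdivlMl // mulr1.
  by rewrite (le_trans _ (ler_norm _)) //; lra.
move=> hf; have [cf df pf] := hf.
apply: (@holderCS _ _ _ (fun i x => (2 * Num.sqrt (f x))^-1 * partial i f x)) => //.
  move=> x i Ux; apply: (@is_derive_comp1 _ _ _ _ f Num.sqrt).
    exact: derivableP (df x i Ux).
  exact: is_derive1_sqrt (f0 x Ux).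
move=> i; apply: (holderCM oU _ (pf i)); apply: holderCV => //.
  by move=> x Ux; rewrite mulf_neq0 ?gt_eqF ?sqrtr_gt0 ?f0.
by apply: holderCZ => //; exact: IH (holderCW oU hf).
Qed.

(** Each derivative lowers the exponent and the order by one, so k < m leaves at least one factor
    max(f,0) at order 0, and this factor is a Lipschitz function of f. *)
Lemma holderC_maxX k m U f : open U -> (k < m)%N -> holderC k U f ->
  holderC k U (fun x => Num.max (f x) 0 ^+ m).
Proof.
move=> oU; elim: k m f => [|k IH] m f km hf.
  have h1 : holderC 0 U (fun x => Num.max (f x) 0).
    apply: (@holderC0_comp1 U f (fun t => Num.max t 0)) => // x _.
    exists 1; exists 1 => // b c _ _; rewrite mul1r.
    by have [b0|b0] := leP b 0; have [c0|c0] := leP c 0;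
      rewrite ler_norml; have := ler_norm (b - c); have := ler_norm (c - b);
      rewrite (distrC c b); move=> *; apply/andP; lra.
  apply: (@eq_holderC _ _ (fun x => \prod_(i < m) Num.max (f x) 0)) => // [x _|].
    by rewrite prodr_const card_ord.
  exact: holderC_prod.
case: m km => // -[//|m] km; have [cf df pf] := hf.
apply: (@holderCS _ _ _
  (fun i x => m.+2%:R * Num.max (f x) 0 ^+ m.+1 * partial i f x)) => //.
  move=> x i Ux.
  apply: (@is_derive_comp1 _ _ _ _ f (fun t => Num.max t 0 ^+ m.+2)).
    exact: derivableP (df x i Ux).
  exact: is_derive_maxX.
have w := IH m.+1 f km (holderCW oU hf).
by move=> i; apply: (holderCM oU _ (pf i)); exact: holderCZ.
Qed.

End HolderClass.

(** * Composition, matrix inverses and symmetry of second derivatives *)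

Section Composition.
Context {R : realType} {n : nat}.
Variable alpha : R.
Hypothesis alpha01 : 0 < alpha <= 1.
Implicit Types (f g : 'rV[R]_n -> R) (x y z a v : 'rV[R]_n) (U V : set 'rV[R]_n).
Local Notation holderC := (@holderC R n alpha).

Lemma lipschitz_row (q : 'rV[R]_n -> 'rV[R]_n) x :
  (forall j, lipschitz_at (fun y => q y 0 j) x) ->
  exists2 C : R, 0 < C & exists2 d : R, 0 < d & forall y z,
    `|y - x| < d -> `|z - x| < d -> `|q y - q z| <= C * `|y - z|.
Proof.
move=> H; pose C j := sval (cid (H j)).
have C0 j : 0 <= C j by rewrite /C; case: cid => c [].
exists (1 + \sum_j C j); first by rewrite ltr_pwDl // sumr_ge0.
have [|j|d d0 dP] := @fin_radius R 'I_n (fun j d => forall y z,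
  `|y - x| < d -> `|z - x| < d -> `|q y 0 j - q z 0 j| <= C j * `|y - z|).
- by move=> i d d' dd' P y z yx zx; apply: P; exact: lt_le_trans dd'.
- by rewrite /C; case: cid => c [].
exists d => // y z yx zx; apply: norm_le_coord => [|j].
  by rewrite mulr_ge0 // addr_ge0 // sumr_ge0.
rewrite !mxE (le_trans (dP j y z yx zx)) // ler_wpM2r // (bigD1 j) //=.
by rewrite addrCA lerDl addr_ge0 // sumr_ge0.
Qed.

(* The inner map has to be Lipschitz: composing two alpha-Hoelder maps only
   gives the exponent alpha ^ 2. *)
Lemma holderC0_comp U V f (q : 'rV[R]_n -> 'rV[R]_n) :
  (forall x, U x -> V (q x)) ->
  (forall x j, U x -> lipschitz_at (fun y => q y 0 j) x) ->
  holderC 0 V f -> holderC 0 U (fun x => f (q x)).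
Proof.
move=> UV lq [cf hf].
have lip x : U x -> exists2 C : R, 0 < C & exists2 d : R, 0 < d & forall y z,
    `|y - x| < d -> `|z - x| < d -> `|q y - q z| <= C * `|y - z|.
  by move=> Ux; apply: lipschitz_row => j; exact: lq.
split=> x Ux.
  have [C C0 [d d0 dP]] := lip x Ux.
  apply/continuous_normE => e e0.
  have [c c0 cP] := (continuous_normE _ _).1 (cf _ (UV _ Ux)) e e0.
  exists (Num.min d (c / C)) => [|y]; first by rewrite lt_min d0 divr_gt0.
  rewrite lt_min ltr_pdivlMr // => /andP[yd yc]; apply: cP.
  apply: le_lt_trans (dP y x yd _) _; first by rewrite subrr normr0.
  by rewrite mulrC.
have [C C0 [d d0 dP]] := lip x Ux.
have [B [W Wx HW]] := hf _ (UV _ Ux).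
have [c c0 cP] := (nbhs_normE _ _).1 Wx.
exists (`|B| * C `^ alpha).
exists [set y | `|y - x| < Num.min d (c / C)].
  apply/nbhs_normE; exists (Num.min d (c / C)) => //.
  by rewrite lt_min d0 divr_gt0.
have inW y : `|y - x| < Num.min d (c / C) -> W (q y).
  rewrite lt_min ltr_pdivlMr // => /andP[yd yc]; apply: cP.
  apply: le_lt_trans (dP y x yd _) _; first by rewrite subrr normr0.
  by rewrite mulrC.
move=> y z /= yd zd; apply: le_trans (HW _ _ (inW _ yd) (inW _ zd)) _.
apply: le_trans (_ : `|B| * `|q y - q z| `^ alpha <= _).
  by rewrite ler_wpM2r ?powR_ge0 ?ler_norm.
rewrite -mulrA ler_wpM2l // -powRM ?(ltW C0) //.
case/andP: alpha01 => a0 _; apply: ge0_ler_powR; rewrite ?nnegrE ?(ltW a0) //.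
  by rewrite mulr_ge0 // ltW.
by move: yd zd; rewrite !lt_min => /andP[yd _] /andP[zd _]; exact: dP.
Qed.

(** The Lipschitz condition on q is carried separately: the induction brings k down to 0, where
    Hoelder continuity of q does not imply it. *)
Lemma holderC_comp k U V f (q : 'rV[R]_n -> 'rV[R]_n) : open U -> open V ->
  (forall x, U x -> V (q x)) ->
  (forall x j, U x -> lipschitz_at (fun y => q y 0 j) x) ->
  (forall j, holderC k U (fun x => q x 0 j)) ->
  holderC k V f -> holderC k U (fun x => f (q x)).
Proof.
move=> oU oV UV lq; elim: k f => [|k IH] f hq hf; first exact: holderC0_comp hf.
apply: (@holderCS _ _ _ _ _ _
  (fun i x => \sum_j partial i (fun y => q y 0 j) x * partial j f (q x))) => //.
  move=> x i Ux; apply: is_derive_eq.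
    apply: (is_derive_chain (w := \row_j partial i (fun y => q y 0 j) x)).
      exact: holderC_strict oV (UV x Ux) hf.
    by move=> j; rewrite mxE; apply: derivableP; have [_ d _] := hq j; exact: d.
  by apply: eq_bigr => j _; rewrite !mxE.
move=> i; apply: holderC_sum => // j; apply: holderCM => //.
  by have [_ _ ] := hq j; exact.
apply: IH => [j'|]; first by apply: holderCW (hq j').
by have [_ _] := hf; exact.
Qed.

Lemma holderC_invmx k U m (F : 'rV[R]_n -> 'M[R]_m) i j : open U ->
  (forall x, U x -> F x \in unitmx) ->
  (forall i j, holderC k U (fun x => F x i j)) ->
  holderC k U (fun x => invmx (F x) i j).
Proof.
move=> oU Fu hF.
apply: (@eq_holderC _ _ _ _ _ (fun x => (\det (F x))^-1 * cofactor (F x) j i)) => //.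
  by move=> x; rewrite inE => /Fu Fx; rewrite /invmx Fx !mxE.
apply: holderCM => //.
  apply: holderCV => // [x /Fu|]; last exact: holderC_det.
  by rewrite unitmxE unitfE.
rewrite /cofactor; apply: holderCZ => //; apply: holderC_det => // a b.
apply: (@eq_holderC _ _ _ _ _ (fun x => F x (lift j a) (lift i b))) => //.
by move=> x _; rewrite !mxE.
Qed.

Lemma derive_shift_arg f y v (c : 'rV[R]_n) : derivable f (y + c) v ->
  is_derive y v (fun z => f (z + c)) ('D_v f (y + c)).
Proof.
move=> df; have E : (fun h : R => h^-1 *: (f (h *: v + y + c) - f (y + c))) =
    (fun h : R => h^-1 *: (f (h *: v + (y + c)) - f (y + c))).
  by apply/funext => h; rewrite addrA.
by split; rewrite /derivable /derive E.
Qed.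

(** The mixed difference is the increment in direction i of u(y) = f(y + h e_j) - f(y). The mean
    value theorem makes it h times a difference of [partial i f], which strict differentiability of
    [partial i f] at x evaluates. *)
Lemma second_difference U f x i j : open U -> U x -> holderC 2 U f ->
  forall e : R, 0 < e -> exists2 d : R, 0 < d & forall h : R, `|h| < d ->
   `|f (h *: delta_mx 0 i + x + h *: delta_mx 0 j) - f (h *: delta_mx 0 i + x)
     - f (x + h *: delta_mx 0 j) + f x - h * (h * partial j (partial i f) x)|
   <= e * `|h| * `|h|.
Proof.
move=> oU Ux [cf df hf] e e0.
have sd := @holderC_strict _ _ alpha 0 U _ x oU Ux (hf i).
have [d d0 dP] := sd e e0.
have /nbhs_normE[r r0 rU] : nbhs x U by exact: open_nbhs_nbhs.
exists (Num.min d r / 2) => [|h hd]; first by rewrite divr_gt0 // lt_min d0.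
have h0 : 0 <= `|h| by [].
pose ei : 'rV[R]_n := delta_mx 0 i; pose ej : 'rV[R]_n := delta_mx 0 j.
have le1 (s : R) k : `|s *: (delta_mx 0 k : 'rV[R]_n)| <= `|s|.
  by rewrite normrZ -[leRHS]mulr1 ler_wpM2l // norm_delta_le.
have near1 (s : R) : `|s| <= `|h| -> `|s *: ei + x - x| < Num.min d r.
  by move=> sh; rewrite addrK (le_lt_trans (le1 _ _)) //; lra.
have near2 (s : R) : `|s| <= `|h| -> `|s *: ei + x + h *: ej - x| < Num.min d r.
  move=> sh; rewrite addrAC addrK (le_lt_trans (ler_normD _ _)) //.
  by have := le1 s i; have := le1 h j; rewrite -/ei -/ej; lra.
have inU y : `|y - x| < Num.min d r -> U y.
  by move=> yd; apply: rU; rewrite (lt_le_trans yd) // ge_min lexx orbT.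
pose u y := f (y + h *: ej) - f y.
have du (s : R) : `|s| <= `|h| -> is_derive (s *: ei + x) ei u
    (partial i f (s *: ei + x + h *: ej) - partial i f (s *: ei + x)).
  move=> sh; apply: is_deriveB.
    by apply: derive_shift_arg; apply: df; apply: inU; exact: near2.
  by apply: derivableP; apply: df; apply: inU; exact: near1.
have [|s sh] := @mean_value_line _ _ x ei u h.
  by move=> s /du[].
have [_ ->] := du s sh => E.
have -> : f (h *: ei + x + h *: ej) - f (h *: ei + x) - f (x + h *: ej) + f x
    = u (h *: ei + x) - u x by rewrite /u; ring.
rewrite E -mulrBr normrM mulrC ler_wpM2r //.
have := dP (s *: ei + x + h *: ej) (s *: ei + x).
have -> : s *: ei + x + h *: ej - (s *: ei + x) = h *: ej.
  by rewrite [LHS]addrC addKr.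
rewrite dotZl.
have -> : dot ej (grad (partial i f) x) = partial j (partial i f) x.
  rewrite /dot (bigD1 j) //= !mxE !eqxx mul1r big1 ?addr0 // => k kj.
  by rewrite !mxE (negbTE kj) andbF mul0r.
move=> H; apply: le_trans (_ : e * `|h *: ej| <= _); last first.
  by rewrite ler_wpM2l ?le1 // ltW.
by apply: H; [apply: lt_le_trans (near2 _ sh) _|apply: lt_le_trans (near1 _ sh) _];
  rewrite ge_min lexx.
Qed.

(** The second difference is symmetric in i and j and approximates h^2 times either mixed
    derivative. *)
Lemma partialC U f x i j : open U -> U x -> holderC 2 U f ->
  partial i (partial j f) x = partial j (partial i f) x.
Proof.
move=> oU Ux hf; apply/eqP; rewrite -subr_eq0 -normr_le0; apply/ler_addgt0Pr => e e0.
rewrite add0r; have e2 : 0 < e / 2 by rewrite divr_gt0.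
have [d d0 dP] := second_difference i j oU Ux hf e2.
have [c c0 cP] := second_difference j i oU Ux hf e2.
pose m := Num.min d c; have m0 : 0 < m by rewrite lt_min d0.
pose h := m / 2; have h0 : 0 < h by rewrite divr_gt0.
have hm : `|h| < m by rewrite gtr0_norm // /h; lra.
have := dP h (lt_le_trans hm _); rewrite ge_min lexx => /(_ isT).
have := cP h (lt_le_trans hm _); rewrite ge_min lexx orbT => /(_ isT).
have -> : h *: delta_mx 0 j + x + h *: delta_mx 0 i =
   h *: delta_mx 0 i + x + h *: delta_mx 0 j :> 'rV[R]_n by rewrite addrAC [RHS]addrAC; congr (_ + _); rewrite addrC.
rewrite ![h *: delta_mx 0 _ + x]addrC.
rewrite (gtr0_norm h0) => H1 H2.
have close (A B C F p q : R) :
    `|A - C - B + F - h * (h * q)| <= e / 2 * h * h ->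
    `|A - B - C + F - h * (h * p)| <= e / 2 * h * h -> `|p - q| <= e.
  move=> K1 K2; have hh : 0 < h * h by rewrite mulr_gt0.
  rewrite -(ler_pM2l hh) -[in leLHS](gtr0_norm hh) -normrM.
  have -> : h * h * (p - q) =
      (A - C - B + F - h * (h * q)) - (A - B - C + F - h * (h * p)) by ring.
  apply: le_trans (ler_normB _ _) _.
  have -> : h * h * e = e / 2 * h * h + e / 2 * h * h by field.
  exact: lerD.
exact: close H2 H1.
Qed.

End Composition.

(** * Euclidean geometry and the signed distance *)

Section EuclideanNorm.
Context {R : realType} {n : nat}.
Implicit Types (u v w x y z : 'rV[R]_n) (S : set 'rV[R]_n).

Lemma dotDr u v w : dot u (v + w) = dot u v + dot u w.
Proof. by rewrite dotC dotDl !(dotC _ u). Qed.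

Lemma dotZr c u v : dot u (c *: v) = c * dot u v.
Proof. by rewrite dotC dotZl dotC. Qed.

Lemma dotNl u v : dot (- u) v = - dot u v.
Proof. by rewrite -scaleN1r dotZl mulN1r. Qed.

Lemma dotNr u v : dot u (- v) = - dot u v.
Proof. by rewrite dotC dotNl dotC. Qed.

Lemma dot0l v : dot 0 v = 0.
Proof. by rewrite /dot big1 // => i _; rewrite mxE mul0r. Qed.

Lemma dot_ge0 u : 0 <= dot u u.
Proof. by have [->|/dot_gt0/ltW//] := eqVneq u 0; rewrite dot0l. Qed.

Lemma dot_eq0 u : (dot u u == 0) = (u == 0).
Proof.
by have [->|/dot_gt0/gt_eqF->//] := eqVneq u 0; rewrite dot0l eqxx.
Qed.

Lemma enorm_ge0 u : 0 <= enorm u. Proof. exact: sqrtr_ge0. Qed.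

Lemma sqr_enorm u : enorm u ^+ 2 = dot u u.
Proof. by rewrite sqr_sqrtr ?dot_ge0. Qed.

Lemma enorm0 : enorm (0 : 'rV[R]_n) = 0.
Proof. by rewrite /enorm dot0l sqrtr0. Qed.

Lemma enorm_gt0 u : (0 < enorm u) = (u != 0).
Proof.
rewrite /enorm sqrtr_gt0 lt_neqAle dot_ge0 andbT eq_sym dot_eq0 //.
Qed.

Lemma enorm_eq0 u : (enorm u == 0) = (u == 0).
Proof. by rewrite -[LHS]negbK -[RHS]negbK -enorm_gt0 lt_neqAle enorm_ge0 andbT eq_sym. Qed.

Lemma enormZ c u : enorm (c *: u) = `|c| * enorm u.
Proof.
by rewrite /enorm dotZl dotZr mulrA -expr2 sqrtrM ?sqr_ge0 // sqrtr_sqr.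
Qed.

Lemma enormN u : enorm (- u) = enorm u.
Proof. by rewrite -scaleN1r enormZ normrN1 mul1r. Qed.

Lemma enormB u v : enorm (u - v) = enorm (v - u).
Proof. by rewrite -enormN opprB. Qed.

Lemma cauchy_schwarz u v : dot u v <= enorm u * enorm v.
Proof.
have [->|v0] := eqVneq v 0; first by rewrite dotC dot0l mulr_ge0 ?enorm_ge0.
have [uv|uv] := leP (dot u v) 0.
  by rewrite (le_trans uv) // mulr_ge0 ?enorm_ge0.
rewrite -ler_sqr ?nnegrE ?mulr_ge0 ?enorm_ge0 ?(ltW uv) // exprMn !sqr_enorm.
have vv := dot_gt0 v0; have := dot_ge0 (dot v v *: u - dot u v *: v).
rewrite !dotDl !dotNl !dotDr !dotNr !dotZl !dotZr (dotC v u).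
have -> : dot v v * (dot v v * dot u u) - dot v v * (dot u v * dot u v) -
   (dot u v * (dot v v * dot u v) - dot u v * (dot u v * dot v v)) =
   dot v v * (dot u u * dot v v - dot u v ^+ 2) by ring.
by rewrite pmulr_rge0 // subr_ge0.
Qed.

Lemma enormD u v : enorm (u + v) <= enorm u + enorm v.
Proof.
rewrite -ler_sqr ?nnegrE ?addr_ge0 ?enorm_ge0 // sqr_enorm sqrrD !sqr_enorm.
rewrite !dotDl !dotDr (dotC v u) mulr2n; have := cauchy_schwarz u v; lra.
Qed.

Lemma enorm_dist u v w : enorm (u - w) <= enorm (u - v) + enorm (v - w).
Proof. by rewrite (le_trans _ (enormD _ _)) // addrA subrK. Qed.

Lemma norm_le_enorm u : `|u| <= enorm u.
Proof.
apply: norm_le_coord => [|i]; first exact: enorm_ge0.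
rewrite -sqrtr_sqr /enorm ler_wsqrtr // /dot (bigD1 i) //= -expr2 lerDl.
by apply: sumr_ge0 => j _; rewrite -expr2 sqr_ge0.
Qed.

Lemma enorm_le_norm u : enorm u <= n%:R * `|u|.
Proof.
rewrite -ler_sqr ?nnegrE ?mulr_ge0 ?enorm_ge0 // sqr_enorm.
apply: le_trans (_ : \sum_(i < n) `|u| ^+ 2 <= _).
  apply: ler_sum => i _; rewrite -expr2 -real_normK ?num_real //.
  by rewrite ler_sqr ?nnegrE ?normr_ge0 // coord_le_norm.
rewrite sumr_const card_ord exprMn -[leLHS]mulr_natl ler_wpM2r ?sqr_ge0 //.
by rewrite -natrX ler_nat; case: (n) => // m; rewrite leq_pmulr.
Qed.

Lemma enorm_continuous x : continuous (fun y => enorm (x - y)).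
Proof.
move=> y; apply/continuous_normE => e e0; have n0 : 0 < n%:R + 1 :> R by rewrite ltr_pwDr.
exists (e / (n%:R + 1)) => [|z]; first by rewrite divr_gt0.
rewrite ltr_pdivlMr // => H; apply: le_lt_trans H.
apply: le_trans (_ : enorm (z - y) <= _); last first.
  by rewrite (le_trans (enorm_le_norm _)) // mulrC ler_wpM2l // lerDl.
rewrite ler_norml; have := enorm_dist x y z; have := enorm_dist x z y.
by rewrite (enormB y z) => *; apply/andP; lra.
Qed.

Lemma edist_le S x y : S y -> edist_to S x <= enorm (x - y).
Proof.
move=> Sy; apply: ge_inf; last by exists y.
by exists 0 => _ [z _ <-]; exact: enorm_ge0.
Qed.

Lemma le_edist S x e : S !=set0 -> (forall y, S y -> e <= enorm (x - y)) ->
  e <= edist_to S x.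
Proof.
move=> [y Sy] H; apply: lb_le_inf; first by exists (enorm (x - y)), y.
by move=> _ [z Sz <-]; exact: H.
Qed.

Lemma edist_ge0 S x : 0 <= edist_to S x.
Proof.
have [->|/set0P S0] := eqVneq S set0.
  by rewrite /edist_to image_set0 inf0.
by apply: le_edist => // y _; exact: enorm_ge0.
Qed.

Lemma edist_in S x : S x -> edist_to S x = 0.
Proof.
move=> Sx; apply/eqP; rewrite eq_le edist_ge0 andbT.
by rewrite (le_trans (edist_le x Sx)) // subrr enorm0.
Qed.

Lemma edist_lipschitz S x y : S !=set0 ->
  edist_to S x <= edist_to S y + enorm (x - y).
Proof.
move=> S0; rewrite -lerBlDr; apply: le_edist => // z Sz; rewrite lerBlDr addrC.
exact: le_trans (edist_le x Sz) (enorm_dist x y z).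
Qed.

Lemma closure_enorm S x :
  closure S x <-> forall e : R, 0 < e -> exists2 y, S y & enorm (x - y) < e.
Proof.
split=> [cx e e0|H].
  have n0 : 0 < n%:R + 1 :> R by rewrite ltr_pwDr.
  have [|y [Sy]] := cx [set y | `|y - x| < e / (n%:R + 1)].
    by apply/nbhs_normE; exists (e / (n%:R + 1)); rewrite ?divr_gt0.
  rewrite /= ltr_pdivlMr // => H; exists y => //; apply: le_lt_trans H.
  rewrite enormB (le_trans (enorm_le_norm _)) // mulrC ler_wpM2l // lerDl //.
move=> A /nbhs_normE[e e0 eA]; have [y Sy xy] := H e e0.
by exists y; split=> //; apply: eA; rewrite distrC (le_lt_trans (norm_le_enorm _)).
Qed.

(** Closure points no farther from x than some fixed point of S form a compact set, on which the
    distance to x has a minimum. *)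
Lemma edist_attained S x : S !=set0 -> exists2 y, closure S y & edist_to S x = enorm (x - y).
Proof.
move=> S0; have [y0 Sy0] := S0.
pose K := closure S `&` [set y | enorm (x - y) <= enorm (x - y0)].
have cK : compact K.
  apply: bounded_closed_compact.
    exists (`|x| + enorm (x - y0)); split; first exact: num_real.
    move=> M HM y [_ /= yx]; apply: le_trans (ltW HM).
    have -> : y = x - (x - y) by rewrite subKr.
    rewrite (le_trans (ler_normB _ _)) // lerD //.
    exact: le_trans (norm_le_enorm _) yx.
  apply: closedI; first exact: closed_closure.
  have -> : [set y | enorm (x - y) <= enorm (x - y0)] =
      (fun y => enorm (x - y)) @^-1` [set t | t <= enorm (x - y0)] by [].
  apply: preimage_closed; first by move=> y _; exact: enorm_continuous.
  exact: closed_le.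
have [||y yK yP] := EVT_min_rV (f := fun y => enorm (x - y)) _ cK.
- by exists y0; split=> /=; [exact: subset_closure|].
- by apply: continuous_subspaceT => y; exact: enorm_continuous.
move: yK; rewrite inE => -[yS yy0]; exists y => //; apply/eqP; rewrite eq_le.
apply/andP; split.
  apply/ler_addgt0Pr => e e0.
  have [z Sz yz] := (closure_enorm S y).1 yS e e0.
  rewrite (le_trans (edist_le x Sz)) // (le_trans (enorm_dist x y z)) // lerD2l ltW //.
apply: le_edist => // z Sz; have [zy0|zy0] := leP (enorm (x - z)) (enorm (x - y0)).
  by apply: yP; rewrite inE; split=> //; exact: subset_closure.
exact: le_trans yy0 (ltW zy0).
Qed.

(** If Cauchy-Schwarz were strict for u and v, then w = |v| u - |u| v would have a positive product
    with u and a negative one with v. Equality makes the vectors positively parallel. *)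
Lemma parallel_of_halfspaces u v : v != 0 ->
  (forall w, 0 < dot w u -> 0 <= dot w v) -> u = (enorm u / enorm v) *: v.
Proof.
move=> v0 H; have [->|u0] := eqVneq u 0; first by rewrite enorm0 mul0r scale0r.
have nu : 0 < enorm u by rewrite enorm_gt0.
have nv : 0 < enorm v by rewrite enorm_gt0.
pose c := dot u v.
have cs : c <= enorm u * enorm v by exact: cauchy_schwarz.
have csE : c = enorm u * enorm v.
  apply/eqP; rewrite eq_le cs /=; rewrite leNgt; apply/negP => lt.
  have := H (enorm v *: u - enorm u *: v).
  rewrite !dotDl !dotNl !dotZl -!sqr_enorm (dotC v u) -/c.
  have -> : enorm v * enorm u ^+ 2 - enorm u * c = enorm u * (enorm u * enorm v - c) by ring.
  have -> : enorm v * c - enorm u * enorm v ^+ 2 = - (enorm v * (enorm u * enorm v - c)) by ring.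
  rewrite oppr_ge0 pmulr_rgt0 // subr_gt0 pmulr_rle0 // subr_le0 => /(_ lt).
  by rewrite leNgt lt.
apply/eqP; rewrite -subr_eq0 -dot_eq0 !dotDl !dotDr !dotNl !dotNr !dotZl !dotZr.
rewrite (dotC v u) -/c csE -!sqr_enorm; apply/eqP; field.
by rewrite gt_eqF.
Qed.

End EuclideanNorm.

(** * Signed distance and nearest boundary points *)

Section SignedDistance.
Context {R : realType} {n : nat}.
Variable D : set 'rV[R]_n.
Hypotheses (n_gt0 : (0 < n)%N) (openD : open D) (bndD : bounded_set D).
Hypothesis D_neq0 : D !=set0.
Implicit Types (u v w x y z : 'rV[R]_n).
Local Notation delta := (signed_dist D).

Lemma setC_neq0 : ~` D !=set0.
Proof.
have [M [_ HM]] := bndD; pose K := `|M| + 1.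
exists (const_mx (K + 1)) => /HM /= H.
have /H : M < K by rewrite /K (le_lt_trans (ler_norm M)) // ltrDl.
apply/negP; rewrite -ltNge; have K0 : 0 < K by rewrite ltr_pwDr.
have := coord_le_norm (const_mx (K + 1) : 'rV[R]_n) (Ordinal n_gt0).
have K1 : 0 < K + 1 by rewrite addr_gt0.
by rewrite mxE (gtr0_norm K1) => H1; apply: lt_le_trans H1; lra.
Qed.

Lemma boundaryE x : boundary D x <-> closure D x /\ ~ D x.
Proof. by rewrite /boundary (interior_id D).1. Qed.

Lemma signed_dist_out x : ~ D x -> delta x = edist_to D x.
Proof. by move=> Dx; rewrite /signed_dist (@edist_in _ _ (~` D)) // subr0. Qed.

Lemma signed_dist_in x : D x -> delta x = - edist_to (~` D) x.
Proof. by move=> Dx; rewrite /signed_dist edist_in // sub0r. Qed.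

(** The crude constant 2 is the sum of the Lipschitz constants of the two distances. *)
Lemma signed_dist_lipschitz x y : `|delta x - delta y| <= 2 * enorm (x - y).
Proof.
have := edist_lipschitz x y D_neq0; have := edist_lipschitz y x D_neq0.
have := edist_lipschitz x y setC_neq0; have := edist_lipschitz y x setC_neq0.
by rewrite (enormB y x) /signed_dist ler_norml => *; apply/andP; lra.
Qed.

Lemma openD_enorm x : D x -> exists2 e : R, 0 < e & forall y, enorm (x - y) < e -> D y.
Proof.
move=> Dx; have /nbhs_normE[e e0 eD] : nbhs x D by exact: open_nbhs_nbhs.
exists e => // y xy; apply: eD; rewrite -normrN opprB.
exact: le_lt_trans (norm_le_enorm _) xy.
Qed.

Lemma edist_setC_gt0 x : D x -> 0 < edist_to (~` D) x.
Proof.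
move=> /openD_enorm[e e0 eD]; apply: lt_le_trans e0 _.
apply: le_edist => [|y Dy]; first exact: setC_neq0.
by rewrite leNgt; apply/negP => /eD.
Qed.

Lemma signed_dist_lt0 x : (delta x < 0) <-> D x.
Proof.
split=> [|Dx]; last by rewrite signed_dist_in // oppr_lt0 edist_setC_gt0.
by move=> dx; apply: contrapT => /signed_dist_out E; move: dx; rewrite E ltNge edist_ge0.
Qed.

Lemma in_ball_in x y : D x -> enorm (x - y) < edist_to (~` D) x -> D y.
Proof.
move=> Dx xy; apply: contrapT => Dy.
by have := @edist_le _ _ (~` D) x y Dy; rewrite leNgt xy.
Qed.

Lemma notin_ball_out x y : enorm (x - y) < edist_to D x -> ~ D y.
Proof. by move=> xy Dy; have := edist_le x Dy; rewrite leNgt xy. Qed.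

Lemma segment_dist x y (s : R) : 0 <= s <= 1 ->
  enorm (x - (y + s *: (x - y))) = (1 - s) * enorm (x - y).
Proof.
move=> s01; rewrite opprD addrA -[X in enorm (X - _)]scale1r -scalerBl enormZ.
by rewrite ger0_norm // subr_ge0; case/andP: s01.
Qed.

(** For x in D take a nearest point of the complement: the segment towards x lies in D, so the point
    is in the closure of D. For x outside take a nearest point of the closure: if it belonged to D,
    the segment would meet D closer to x. The last two clauses record the ball that touches bD at
    y. *)
Lemma nearest_boundary x : exists y, [/\ boundary D y, enorm (x - y) = `|delta x|,
  (D x -> forall z, enorm (x - z) < enorm (x - y) -> D z) &
  (~ D x -> forall z, enorm (x - z) < enorm (x - y) -> ~ D z)].
Proof.
have seg y e : 0 < e -> exists2 s : R, 0 < s <= 1 & s * enorm (x - y) < e.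
  move=> e0; have nn : 0 < enorm (x - y) + 1 by rewrite ltr_wpDl ?enorm_ge0.
  exists (Num.min 1 (e / (enorm (x - y) + 1))).
    by rewrite lt_min ltr01 divr_gt0 // ge_min lexx.
  apply: le_lt_trans (_ : e / (enorm (x - y) + 1) * enorm (x - y) < _).
    by rewrite ler_wpM2r ?enorm_ge0 // ge_min lexx orbT.
  by rewrite mulrAC ltr_pdivrMr // mulrDr mulr1 ltrDl.
have [Dx|Dx] := pselect (D x).
  have [y yC xy] := edist_attained x setC_neq0.
  have Dy : ~ D y.
    suff : closed (~` D) by move/closure_id => E; rewrite -E in yC.
    exact: open_closedC.
  exists y; split=> //.
  - apply/boundaryE; split=> //; apply/closure_enorm => e /(seg y)[s /andP[s0 s1] se].
    exists (y + s *: (x - y)).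
      apply: (in_ball_in Dx); rewrite segment_dist ?(ltW s0) // xy.
      rewrite gtr_pMl ?gtrBl // -?xy ?edist_setC_gt0 //.
    by rewrite opprD addNKr enormN enormZ gtr0_norm.
  - by rewrite signed_dist_in // normrN -xy ger0_norm // edist_ge0.
  - by move=> _ z; rewrite -xy; exact: in_ball_in.
have [y yC xy] := edist_attained x D_neq0.
have xy' z : enorm (x - z) < enorm (x - y) -> ~ D z by rewrite -xy; exact: notin_ball_out.
exists y; split=> //; last by rewrite signed_dist_out // -xy ger0_norm // edist_ge0.
apply/boundaryE; split=> // Dy; have [e e0 eD] := openD_enorm Dy.
have [s /andP[s0 s1] se] := seg y e e0.
have nxy : 0 < enorm (x - y).
  rewrite enorm_gt0 subr_eq0; apply: contra_notN Dx => /eqP -> //.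
apply: (xy' (y + s *: (x - y))).
  by rewrite segment_dist ?(ltW s0) // gtr_pMl // gtrBl.
by apply: eD; rewrite opprD addNKr enormN enormZ gtr0_norm.
Qed.

Lemma signed_dist_eq0 x : delta x = 0 <-> boundary D x.
Proof.
split=> [dx|/boundaryE[cx Dx]].
  have [y [By + _ _]] := nearest_boundary x.
  by rewrite dx normr0 => /eqP; rewrite enorm_eq0 subr_eq0 => /eqP ->.
rewrite signed_dist_out //; apply/eqP; rewrite eq_le edist_ge0 andbT.
apply/ler_addgt0Pr => e e0; rewrite add0r.
have [z Dz xz] := (closure_enorm D x).1 cx e e0.
by rewrite (le_trans (edist_le x Dz)) // ltW.
Qed.

(** The outward normal of {phi < 0}, extended off the hypersurface by the level sets of phi; where
    the gradient vanishes the value is 0. *)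
Definition unit_normal (phi : 'rV[R]_n -> R) y := (enorm (grad phi y))^-1 *: grad phi y.

Lemma enorm_unit_normal phi y : grad phi y != 0 -> enorm (unit_normal phi y) = 1.
Proof.
by move=> g0; rewrite enormZ ger0_norm ?invr_ge0 ?enorm_ge0 // mulVf // enorm_eq0.
Qed.

(* At a nearest boundary point y, phi cannot decrease (for x outside D), nor
   increase (for x inside D), in any direction that enters the ball of centre x
   through y. *)
Lemma nearest_normal phi U x y : open U -> U y -> D `&` U = [set z | phi z < 0] `&` U ->
  phi y = 0 -> strict_diff phi y (grad phi y) -> grad phi y != 0 ->
  enorm (x - y) = `|delta x| ->
  (D x -> forall z, enorm (x - z) < enorm (x - y) -> D z) ->
  (~ D x -> forall z, enorm (x - z) < enorm (x - y) -> ~ D z) ->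
  x = y + delta x *: unit_normal phi y.
Proof.
move=> oU Uy DU py sd g0 xy inD outD; set b := grad phi y in sd g0 *.
have nb : 0 < enorm b by rewrite enorm_gt0.
have enter w : 0 < dot w (x - y) -> dot w b != 0 -> exists z,
    [/\ enorm (x - z) < enorm (x - y), U z & 0 < phi z * dot w b].
  move=> wa wb.
  have /nbhs_normE[r r0 rU] : nbhs y U by exact: open_nbhs_nbhs.
  have W0 : 0 < `|w| + 1 by rewrite ltr_pwDr.
  have e0 : 0 < `|dot w b| / 2 / (`|w| + 1) by rewrite !divr_gt0 ?normr_gt0.
  have [d d0 dP] := sd _ e0.
  have ww : 0 < dot w w + 1 by rewrite ltr_wpDl ?dot_ge0.
  (* Small enough for the linear approximation of phi, for staying in U and for entering the ball: s
     |w|^2 < w . (x - y) gives |x - y - s w| < |x - y|. *)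
  pose s := Num.min (Num.min (d / (`|w| + 1)) (r / (`|w| + 1))) (dot w (x - y) / (dot w w + 1)).
  have s0 : 0 < s by rewrite !lt_min !divr_gt0.
  have sw c : s <= c / (`|w| + 1) -> `|y + s *: w - y| < c.
    rewrite ler_pdivlMr // => sc; rewrite addrC addKr normrZ gtr0_norm //.
    by rewrite (lt_le_trans _ sc) // ltr_pM2l // ltrDl.
  have swd : `|y + s *: w - y| < d by apply: sw; rewrite !ge_min lexx.
  have swr : `|y + s *: w - y| < r by apply: sw; rewrite !ge_min lexx orbT.
  exists (y + s *: w); split.
  - have sww : s * dot w w < dot w (x - y).
      apply: lt_le_trans (_ : s * (dot w w + 1) <= _); first by rewrite ltr_pM2l // ltrDl.
      by rewrite -ler_pdivlMr // /s ge_min lexx orbT.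
    have step a : s * dot w w < dot w a -> enorm (a - s *: w) < enorm a.
      move=> sww'; rewrite -ltr_sqr ?nnegrE ?enorm_ge0 // !sqr_enorm.
      rewrite dotDl !dotDr !dotNl !dotNr !dotZl !dotZr (dotC a w).
      have -> : dot a a - s * dot w a + (- (s * dot w a) - - (s * (s * dot w w))) =
        dot a a - s * (dot w a + (dot w a - s * dot w w)) by ring.
      by rewrite gtrBl mulr_gt0 // addr_gt0 ?subr_gt0 // (le_lt_trans _ sww') //
        mulr_ge0 ?dot_ge0 // ltW.
    by rewrite opprD addrA step.
  - exact: rU.
  - have := dP (y + s *: w) y swd; rewrite subrr normr0 => /(_ d0).
    rewrite py subr0 [y + _]addrC addrK dotZl normrZ gtr0_norm // => H.
    have {}H : `|phi (s *: w + y) - s * dot w b| < s * `|dot w b|.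
      apply: le_lt_trans H _; rewrite mulrCA ltr_pM2l //.
      rewrite mulrAC ltr_pdivrMr //; have : 0 < `|dot w b| by rewrite normr_gt0.
      by have : 0 <= `|w| by []; nra.
    move: H wb; move: (phi _) (dot w b) => p q.
    rewrite ltr_norml => /andP[H1 H2] q0; have [q1|q1] := ltP 0 q.
      rewrite gtr0_norm // in H1 H2; rewrite mulr_gt0 //; lra.
    have {}q1 : q < 0 by rewrite lt_neqAle q0.
    by rewrite ltr0_norm // in H1 H2; rewrite nmulr_lgt0 //; lra.
have DUE z : U z -> (phi z < 0) <-> D z.
  move=> Uz; split=> H; last by have : (D `&` U) z by []; rewrite DU => -[].
  by have : ([set t | phi t < 0] `&` U) z by []; rewrite -DU => -[].
have [Dx|Dx] := pselect (D x).
  have dx : delta x < 0 by apply/signed_dist_lt0.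
  have := @parallel_of_halfspaces _ _ (x - y) (- b).
  rewrite oppr_eq0 g0 enormN => /(_ isT) H.
  rewrite /unit_normal -/b scalerA -[x in LHS](subrKC y); congr (_ + _).
  rewrite H; first by rewrite xy ltr0_norm // scalerN -scaleNr mulNr opprK.
  move=> w wa; rewrite dotNr oppr_ge0 leNgt; apply/negP => wb.
  have [z [z1 z2 z3]] := enter w wa (lt0r_neq0 wb).
  have /DUE := inD Dx z z1; move=> /(_ z2).
  by rewrite ltNge => /negP; apply; rewrite ltW // -(pmulr_lgt0 _ wb).
have dx : 0 <= delta x by rewrite signed_dist_out // edist_ge0.
rewrite /unit_normal -/b scalerA -[x in LHS](subrKC y); congr (_ + _).
rewrite [LHS](@parallel_of_halfspaces _ _ (x - y) b) //; first by rewrite xy ger0_norm.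
move=> w wa; rewrite leNgt; apply/negP => wb.
have [z [z1 z2 z3]] := enter w wa (ltr0_neq0 wb).
by apply: (outD Dx z z1); apply/DUE => //; rewrite -(nmulr_lgt0 _ wb).
Qed.

End SignedDistance.

(** * Regularity of the signed distance *)

Section Collar.
Context {R : realType} {n : nat}.
Variables (alpha a b L K : R) (r : nat) (x0 : 'rV[R]_n).
(* d plays the role of the signed distance to the hypersurface phi = 0 and q that
   of the nearest-point projection onto it. *)
Variables (d phi : 'rV[R]_n -> R) (q : 'rV[R]_n -> 'rV[R]_n).
Implicit Types (v w x y z : 'rV[R]_n).

Definition sup_ball e := [set y : 'rV[R]_n | `|y - x0| < e].

Lemma open_sup_ball e : open (sup_ball e).
Proof.
rewrite openE => x /= xe; apply/nbhs_normE; exists (e - `|x - x0|).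
  by rewrite subr_gt0.
move=> y yx; rewrite /= /sup_ball /= -[y](subrK x) -addrA.
by rewrite (le_lt_trans (ler_normD _ _)) // -ltrBrDr.
Qed.

Local Notation N := (unit_normal phi).
Local Notation Ba := (sup_ball a).
Local Notation Bb := (sup_ball b).

Hypotheses (alpha01 : 0 < alpha <= 1) (L0 : 0 < L) (K0 : 0 <= K).
Hypothesis (phi_grad : forall y, Ba y -> grad phi y != 0).
Hypothesis (phi_diff : forall y, Ba y -> strict_diff phi y (grad phi y)).
Hypothesis (N_holder : forall j, holderC alpha r.+1 Ba (fun y => N y 0 j)).
Hypothesis (N_lip : forall y z, Ba y -> Ba z -> `|N y - N z| <= L * `|y - z|).
Hypothesis (qBa : forall x, Bb x -> Ba (q x)).
Hypothesis (phi_q : forall x, Bb x -> phi (q x) = 0).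
Hypothesis (qE : forall x, Bb x -> x = q x + d x *: N (q x)).
Hypothesis (d_lip : forall x y, Bb x -> Bb y -> `|d x - d y| <= K * `|x - y|).
(** The bound |d| L <= 1/4 makes the fixed point equation for g contractive; the factor n turns the
    entrywise bound L on the Jacobian of N into the invertibility of 1 + d DN. *)
Hypothesis (d_small : forall x, Bb x -> `|d x| * L * n%:R <= 1 / 4).
Hypothesis (d_small1 : forall x, Bb x -> `|d x| <= 1).
Hypothesis (n_gt0 : (0 < n)%N).

Let g x := N (q x).

Lemma collar_normal_unit x : Bb x -> dot (g x) (g x) = 1.
Proof.
by move=> Bx; rewrite -sqr_enorm enorm_unit_normal ?expr1n //; exact/phi_grad/qBa.
Qed.

Lemma collar_normal_norm x : Bb x -> `|g x| <= 1.
Proof.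
move=> Bx; rewrite (le_trans (norm_le_enorm _)) // /g enorm_unit_normal //.
exact/phi_grad/qBa.
Qed.

Let q_sub x y : Bb x -> Bb y ->
  q x - q y = (x - y) - (d x - d y) *: g x - d y *: (g x - g y).
Proof.
move=> Bx By; have -> : x - y = q x + d x *: g x - (q y + d y *: g y).
  by rewrite /g -!qE.
move: (g x) (g y) (q x) (q y) (d x) (d y) => u v p p' s t.
by apply/rowP => i; rewrite !mxE; ring.
Qed.

Let q_sub_norm x y : Bb x -> Bb y ->
  `|q x - q y| <= (1 + K) * `|x - y| + `|d y| * `|g x - g y|.
Proof.
move=> Bx By; rewrite q_sub // (le_trans (ler_normB _ _)) // normrZ lerD //.
rewrite (le_trans (ler_normB _ _)) // mulrDl mul1r lerD // normrZ.
rewrite -[leRHS]mulr1 ler_pM // ?d_lip //; exact: collar_normal_norm.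
Qed.

(** The difference q x - q y contains d y (g x - g y), so |g x - g y| reappears on the right with
    factor |d y| L <= 1/4 and is absorbed; the constant 2 leaves room for 4/3. *)
Lemma collar_normal_lip x y : Bb x -> Bb y ->
  `|g x - g y| <= 2 * L * (1 + K) * `|x - y|.
Proof.
move=> Bx By.
have H1 : `|g x - g y| <= L * `|q x - q y| by apply: N_lip; exact: qBa.
have H2 := q_sub_norm Bx By; have H3 := d_small By.
have H4 : `|d y| * L <= 1 / 4.
  by apply: le_trans H3; rewrite ler_peMr ?ler1n // mulr_ge0 // ltW.
have H5 : L * `|q x - q y| <= L * (1 + K) * `|x - y| + 1 / 4 * `|g x - g y|.
  apply: le_trans (_ : L * ((1 + K) * `|x - y| + `|d y| * `|g x - g y|) <= _).
    by rewrite ler_wpM2l // ltW.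
  rewrite mulrDr mulrA lerD2l mulrA [L * _]mulrC ler_wpM2r //.
have : 0 <= `|g x - g y| by [].
have -> : 2 * L * (1 + K) * `|x - y| = 2 * (L * (1 + K) * `|x - y|) by ring.
by lra.
Qed.

Let Cq := 1 + K + 2 * L * (1 + K).
Let Cq0 : 0 < Cq.
Proof. by rewrite /Cq ltr_wpDr ?ltr_pwDl // !mulr_ge0 ?addr_ge0 // ltW. Qed.

Lemma collar_proj_lip x y : Bb x -> Bb y -> `|q x - q y| <= Cq * `|x - y|.
Proof.
move=> Bx By; apply: le_trans (q_sub_norm Bx By) _.
rewrite /Cq [leRHS]mulrDl lerD2l; apply: le_trans (collar_normal_lip Bx By).
by rewrite ler_piMl ?d_small1.
Qed.

Let near_Bb x : Bb x -> exists2 e : R, 0 < e & forall y, `|y - x| < e -> Bb y.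
Proof.
by move=> Bx; apply/nbhs_normE; apply: open_nbhs_nbhs; split=> //; exact: open_sup_ball.
Qed.

(** For unit normals the error equals d y |g y - g x|^2 / 2 - (q y - q x) . g x. The first term is
    quadratic because g is Lipschitz; the second is small because phi vanishes at both q x and q y,
    so that q y - q x is nearly tangent. *)
Lemma collar_dist_diff x : Bb x -> forall e : R, 0 < e ->
  exists2 c : R, 0 < c & forall y, `|y - x| < c ->
    `|d y - d x - dot (y - x) (g x)| <= e * `|y - x|.
Proof.
move=> Bx e e0; have [c1 c10 c1P] := near_Bb Bx.
have G0 : 0 < enorm (grad phi (q x)) by rewrite enorm_gt0; exact/phi_grad/qBa.
set G := enorm (grad phi (q x)) in G0.
pose Cg := 2 * L * (1 + K).
have Cg0 : 0 < Cg by rewrite /Cg !mulr_gt0 // ltr_pwDl.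
(* Divided by G in the unit normal and multiplied by the Lipschitz constant [Cq] of q, this leaves e
   / 2. *)
have e'0 : 0 < e * G / (2 * Cq) by rewrite !divr_gt0 ?mulr_gt0 ?Cq0.
have [c2 c20 c2P] := phi_diff (qBa Bx) e'0.
have nC0 : 0 < n%:R * Cg * Cg by rewrite mulr_gt0 // mulr_gt0 // ltr0n.
exists (Num.min c1 (Num.min (c2 / Cq) (e / (n%:R * Cg * Cg)))).
  by rewrite !lt_min c10 !divr_gt0 ?Cq0.
move=> y; rewrite !lt_min => /and3P[/c1P By]; rewrite ltr_pdivlMr // => yc2.
rewrite ltr_pdivlMr // => yc3.
have qq : `|q y - q x| < c2.
  by apply: le_lt_trans (collar_proj_lip By Bx) _; rewrite mulrC.
have H1 : `|dot (q y - q x) (g x)| <= e / 2 * `|y - x|.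
  rewrite /g /unit_normal dotZr -/G normrM normfV (gtr0_norm G0) (ler_pdivrMl _ _ G0).
  have := c2P (q y) (q x) qq; rewrite subrr normr0 => /(_ c20).
  rewrite !phi_q // subrr sub0r normrN => /le_trans; apply.
  apply: le_trans (_ : e * G / (2 * Cq) * (Cq * `|y - x|) <= _).
    by rewrite ler_wpM2l ?(ltW e'0) // collar_proj_lip.
  by rewrite le_eqVlt; apply/orP; left; apply/eqP; field; rewrite gt_eqF.
have H2 : `|d y * dot (g y - g x) (g y - g x) / 2| <= e / 2 * `|y - x|.
  rewrite normrM (ger0_norm (_ : 0 <= 2^-1)) // [e / 2 * _]mulrAC ler_wpM2r //.
  rewrite normrM (ger0_norm (dot_ge0 _)).
  apply: le_trans (_ : dot (g y - g x) (g y - g x) <= _).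
    by rewrite ler_piMl ?d_small1 // dot_ge0.
  apply: le_trans (ler_norm _) _; apply: le_trans (norm_dot_le _ _) _.
  have gg := collar_normal_lip By Bx; rewrite -/Cg in gg.
  apply: le_trans (_ : n%:R * (Cg * `|y - x|) * (Cg * `|y - x|) <= _).
    by apply: ler_pM => //; rewrite ler_wpM2l.
  rewrite [leLHS](_ : _ = `|y - x| * (n%:R * Cg * Cg) * `|y - x|); last by ring.
  by rewrite ler_wpM2r // ltW.
have alg (u v p p' : 'rV[R]_n) (s t : R) : dot u u = 1 -> dot v v = 1 ->
    t - s - dot (p' + t *: v - (p + s *: u)) u =
    t * dot (v - u) (v - u) / 2 - dot (p' - p) u.
  move=> u1 v1; rewrite !opprD !dotDl !dotDr !dotNl !dotNr !dotZl u1 v1 (dotC u v).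
  by field.
have -> : d y - d x - dot (y - x) (g x) =
    d y * dot (g y - g x) (g y - g x) / 2 - dot (q y - q x) (g x).
  rewrite -(alg _ _ _ _ (d x)) ?collar_normal_unit //; congr (_ - dot _ _).
  by rewrite /g -!qE.
by apply: le_trans (ler_normB _ _) _; lra.
Qed.

Lemma collar_dist_derive x v : Bb x -> is_derive x v d (dot v (g x)).
Proof.
move=> Bx; apply/is_derive_normE => e e0; have v0 : 0 < `|v| + 1 by rewrite ltr_pwDr.
have [|c c0 cP] := collar_dist_diff Bx (e := e / (`|v| + 1)); first by rewrite divr_gt0.
exists (c / (`|v| + 1)) => [|h]; first by rewrite divr_gt0.
rewrite ltr_pdivlMr // => hc; have := cP (h *: v + x); rewrite addrK dotZl normrZ.
have hv : `|h| * `|v| <= `|h| * (`|v| + 1) by rewrite ler_wpM2l // lerDl.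
move=> /(_ (le_lt_trans hv hc)) /le_trans; apply.
rewrite mulrAC ler_pdivrMr // -mulrA ler_wpM2l //; exact: ltW.
Qed.

(** Row-vector convention: [v *m normal_jacobian y] is the derivative of N at y in direction v. *)
Definition normal_jacobian y : 'M[R]_n := \matrix_(k, j) partial k (fun z => N z 0 j) y.

Let M x := normal_jacobian (q x).
Let A x := 1%:M + d x *: M x.

Let Mle x k j : Bb x -> `|M x k j| <= L.
Proof.
move=> Bx; rewrite /M mxE; apply/ler_addgt0Pr => e e0.
have [_ dN _] := N_holder j.
have /is_derive_normE/(_ e e0)[c c0 cP] := derivableP (dN _ k (qBa Bx)).
have [c' c'0 c'P] : exists2 c' : R, 0 < c' & forall z, `|z - q x| < c' -> Ba z.
  by apply/nbhs_normE; apply: open_nbhs_nbhs; split; [exact: open_sup_ball|exact: qBa].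
pose h := Num.min c c' / 2; have m0 : 0 < Num.min c c' by rewrite lt_min c0.
have h0 : 0 < h by rewrite divr_gt0.
have hm : h < Num.min c c' by rewrite /h ltr_pdivrMr // ltr_pMr // ltr1n.
have hc : `|h| < c by rewrite gtr0_norm // (lt_le_trans hm) // ge_min lexx.
have dl : `|h *: (delta_mx 0 k : 'rV[R]_n)| <= h.
  by rewrite normrZ gtr0_norm // ler_piMr ?norm_delta_le // ltW.
have Bh : Ba (h *: delta_mx 0 k + q x).
  by apply: c'P; rewrite addrK (le_lt_trans dl) // (lt_le_trans hm) // ge_min lexx orbT.
have H1 := N_lip Bh (qBa Bx); have H2 := cP h hc; rewrite addrK in H1.
have H3 := coord_sub_le (N (h *: delta_mx 0 k + q x)) (N (q x)) j.
rewrite -(ler_pM2l h0) -[X in X * _ <= _](gtr0_norm h0) -normrM.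
rewrite -[X in `|X|](subKr (N (h *: delta_mx 0 k + q x) 0 j - N (q x) 0 j)).
rewrite (le_trans (ler_normB _ _)) // mulrDr lerD //.
  apply: le_trans (_ : L * `|h *: (delta_mx 0 k : 'rV[R]_n)| <= _).
    by apply: le_trans H1; exact: le_trans H3.
  by rewrite [h * L]mulrC ler_wpM2l // ltW.
by rewrite [h * e]mulrC -[X in _ <= _ * X](gtr0_norm h0).
Qed.

(** A vector in the kernel satisfies v = - d v M, hence |v| <= |d| n L |v| <= |v| / 4. *)
Let unitA x : Bb x -> A x \in unitmx.
Proof.
move=> Bx; rewrite -row_free_unit -kermx_eq0; apply/rowV0P => v /sub_kermxP.
rewrite /A mulmxDr mulmx1 -scalemxAr => /eqP; rewrite addr_eq0 => /eqP E.
have vM : `|v *m M x| <= n%:R * L * `|v|.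
  apply: norm_le_coord => [|j]; first by rewrite !mulr_ge0 // ltW.
  rewrite mxE (le_trans (ler_norm_sum _ _ _)) //.
  apply: le_trans (_ : \sum_(k < n) `|v| * L <= _).
    by apply: ler_sum => k _; rewrite normrM ler_pM // ?coord_le_norm // Mle.
  by rewrite sumr_const card_ord -mulrA mulr_natl [L * _]mulrC.
have : `|v| <= 1 / 4 * `|v|.
  rewrite [in leLHS]E normrN normrZ.
  apply: le_trans (_ : `|d x| * (n%:R * L * `|v|) <= _); first by rewrite ler_wpM2l.
  by rewrite !mulrA ler_wpM2r // mulrAC d_small.
move=> H; apply/eqP; rewrite -normr_le0; lra.
Qed.

Lemma norm_mulmx_le v (B : 'M[R]_n) : `|v *m B| <= `|v| * \sum_i \sum_j `|B i j|.
Proof.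
have S0 i : 0 <= \sum_j `|B i j| by apply: sumr_ge0.
apply: norm_le_coord => [|j]; first by rewrite mulr_ge0 // sumr_ge0.
rewrite mxE (le_trans (ler_norm_sum _ _ _)) // mulr_sumr ler_sum // => i _.
rewrite normrM ler_pM ?coord_le_norm // (bigD1 j) //= lerDl.
by apply: sumr_ge0.
Qed.

(* Differentiating g = N (x - d g) in direction e_i gives
   Jac x i *m (1 + d M) = (e_i - g_i g) *m M. *)
Let Jac x i : 'rV[R]_n :=
  (delta_mx 0 i - g x 0 i *: g x) *m M x *m invmx (A x).

(** The remainder of g, multiplied by [A x], equals T M + E, where E is the linearisation error of N
    at q x and T that of q apart from its dependence on g. Both are o(h), and [A x] is
    invertible. *)
Lemma collar_normal_derive x i j : Bb x ->
  is_derive x (delta_mx 0 i) (fun y => g y 0 j) (Jac x i 0 j).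
Proof.
move=> Bx; apply/is_derive_normE => e e0.
pose ei : 'rV[R]_n := delta_mx 0 i.
pose S := \sum_i \sum_j `|invmx (A x) i j|.
pose SM := \sum_i \sum_j `|M x i j|.
have S0 : 0 <= S by apply: sumr_ge0 => ? _; apply: sumr_ge0.
have SM0 : 0 <= SM by apply: sumr_ge0 => ? _; apply: sumr_ge0.
pose Cg := 2 * L * (1 + K).
have Cg0 : 0 < Cg by rewrite /Cg !mulr_gt0 // ltr_pwDl.
pose e1 := e / (1 + S) / (1 + Cq + SM * (1 + Cg)).
have den0 : 0 < 1 + Cq + SM * (1 + Cg).
  by rewrite ltr_wpDr ?mulr_ge0 ?addr_ge0 ?(ltW Cg0) // addr_gt0.
have e10 : 0 < e1 by rewrite !divr_gt0 // ltr_pwDl.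
have [c1 c10 c1P] := near_Bb Bx.
have [c2 c20 c2P] : exists2 c : R, 0 < c & forall j y, Ba y -> `|y - q x| < c ->
    `|N y 0 j - N (q x) 0 j - ((y - q x) *m M x) 0 j| <= e1 * `|y - q x|.
  apply: fin_radius => [k u u' uu' H y By yu|k]; first by apply: H => //; exact: lt_le_trans uu'.
  have [c c0 cP] := holderC_strict (@open_sup_ball a) (qBa Bx) (N_holder k) e10.
  exists c => // y By yc; have := cP y (q x) yc; rewrite subrr normr0 => /(_ c0).
  by congr (`|_ - _| <= _); rewrite /dot mxE; apply: eq_bigr => l _; rewrite !mxE.
have /is_derive_normE/(_ e1 e10)[c3 c30 c3P] := collar_dist_derive ei Bx.
exists (Num.min c1 (Num.min (c2 / Cq) (Num.min c3 e1))) => [|h].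
  by rewrite !lt_min c10 c30 e10 divr_gt0 ?Cq0.
rewrite !lt_min => /and4P[hc1 hc2 hc3 hc4]; set y := h *: delta_mx 0 i + x.
have yx : `|y - x| <= `|h|.
  by rewrite /y addrK normrZ ler_piMr ?norm_delta_le.
have By : Bb y by apply: c1P; exact: le_lt_trans hc1.
have qyx : `|q y - q x| <= Cq * `|h|.
  by apply: le_trans (collar_proj_lip By Bx) _; rewrite ler_wpM2l // ltW.
have gyx : `|g y - g x| <= Cg * `|h|.
  by apply: le_trans (collar_normal_lip By Bx) _; rewrite ler_wpM2l // ltW.
have qc2 : `|q y - q x| < c2.
  by apply: le_lt_trans qyx _; rewrite mulrC -ltr_pdivlMr.
pose E := g y - g x - (q y - q x) *m M x.
have EE : `|E| <= e1 * (Cq * `|h|).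
  apply: norm_le_coord => [|k].
    by apply: mulr_ge0; [exact: ltW|apply: mulr_ge0 => //; exact: ltW].
  apply: le_trans (ler_wpM2l (ltW e10) qyx).
  apply: le_trans (c2P k _ (qBa By) qc2).
  by rewrite /E mxE [X in `|X + _|]mxE [X in `|_ + X + _|]mxE [X in `|_ + X|]mxE.
(* Defined by q y - q x = h (e_i - g_i g) - d x (g y - g x) + T; its two summands are small by the
   Lipschitz bound for g and the differentiability of d. *)
pose T := (h * g x 0 i) *: (g x - g y) - (d y - d x - h * g x 0 i) *: g y.
have TT : `|T| <= e1 * (1 + Cg) * `|h|.
  rewrite (le_trans (ler_normB _ _)) // mulrDr mulr1 mulrDl addrC lerD //.
    rewrite normrZ -[leRHS]mulr1 ler_pM ?collar_normal_norm //.
    have := c3P h hc3; rewrite -/y.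
    suff -> : dot ei (g x) = g x 0 i by [].
    rewrite /dot (bigD1 i) //= !mxE !eqxx mul1r big1 ?addr0 // => k ki.
    by rewrite !mxE (negbTE ki) andbF mul0r.
  rewrite normrZ distrC -mulrA ler_pM // normrM.
  rewrite (le_trans _ (ltW hc4)) // ler_piMr //.
  by rewrite (le_trans (coord_le_norm _ _)) // collar_normal_norm.
have TE : T = d x *: (g y - g x) - h *: (ei - g x 0 i *: g x) + (q y - q x).
  have alg (u v w : 'rV[R]_n) (s t c : R) : (h * c) *: (u - v) - (t - s - h * c) *: v =
      s *: (v - u) - h *: (w - c *: u) + (h *: w - (t - s) *: v - s *: (v - u)).
    by apply/rowP => k; rewrite !mxE; ring.
  by rewrite q_sub // [y - x]addrK -/ei -alg.
have key : g y - g x - h *: Jac x i = (T *m M x + E) *m invmx (A x).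
  rewrite -[LHS](mulmxK (unitA Bx)); congr (_ *m _).
  rewrite mulmxBl -scalemxAl /Jac (mulmxKV (unitA Bx)) TE /E /A -/ei.
  move: (g y - g x) (q y - q x) (ei - _) => u p w.
  rewrite mulmxDr mulmx1 -scalemxAr !mulmxDl mulNmx -!scalemxAl.
  by apply/rowP => k; rewrite !mxE; ring.
have -> : g y 0 j - g x 0 j - h * Jac x i 0 j = (g y - g x - h *: Jac x i) 0 j.
  by rewrite !mxE.
rewrite (le_trans (coord_le_norm _ _)) // key (le_trans (norm_mulmx_le _ _)) // -/S.
have TE' : `|T *m M x + E| <= e1 * (1 + Cq + SM * (1 + Cg)) * `|h|.
  rewrite (le_trans (ler_normD _ _)) //.
  apply: le_trans (lerD (norm_mulmx_le _ _) EE) _; rewrite -/SM.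
  apply: le_trans (lerD (ler_wpM2r SM0 TT) (lexx _)) _.
  rewrite [leRHS](_ : _ = e1 * (1 + Cg) * `|h| * SM + e1 * (Cq * `|h|) + e1 * `|h|); last by ring.
  by rewrite lerDl mulr_ge0 // ltW.
apply: le_trans (ler_wpM2r S0 TE') _; rewrite /e1 divfK ?gt_eqF //.
rewrite mulrAC ler_wpM2r // mulrAC ler_pdivrMr ?ltr_pwDl // ler_wpM2l ?(ltW e0) //.
by rewrite lerDr.
Qed.

Lemma collar_proj_lipschitz x j : Bb x -> lipschitz_at (fun y => q y 0 j) x.
Proof.
move=> Bx; have [c c0 cP] := near_Bb Bx; exists Cq; split; first exact: ltW.
exists c => // y z /cP By /cP Bz; apply: le_trans (coord_sub_le _ _ _) _.
exact: collar_proj_lip.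
Qed.

Lemma collar_partial_dist x i : Bb x -> partial i d x = g x 0 i.
Proof.
move=> Bx; rewrite /partial; have [_ ->] := collar_dist_derive (delta_mx 0 i) Bx.
rewrite /dot (bigD1 i) //= !mxE !eqxx mul1r big1 ?addr0 // => k ki.
by rewrite !mxE (negbTE ki) andbF mul0r.
Qed.

Let d_holder_step k : (forall j, holderC alpha k Bb (fun x => g x 0 j)) ->
  holderC alpha k.+1 Bb d.
Proof.
move=> hg; apply: (@holderCS _ _ _ _ _ _ (fun i x => g x 0 i)) => //.
  exact: open_sup_ball.
move=> x i Bx; rewrite -collar_partial_dist //; apply: derivableP.
by have [] := collar_dist_derive (delta_mx 0 i) Bx.
Qed.

(** If g has order k, then so do d and q = x - d g, hence also the matrix [Jac] of first derivatives
    of g, which gives order k + 1. The induction ends at r + 1 because DN has only order r. *)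
Lemma collar_normal_holder k j : (k <= r.+1)%N -> holderC alpha k Bb (fun x => g x 0 j).
Proof.
have oBa := @open_sup_ball a; have oBb := @open_sup_ball b.
elim: k j => [|k IH] j kr.
  apply: lipschitz_holder => // x Bx; have [c c0 cP] := near_Bb Bx.
  exists (2 * L * (1 + K)); split; first by rewrite !mulr_ge0 ?addr_ge0 // ltW.
  exists c => // y z /cP By /cP Bz; apply: le_trans (coord_sub_le _ _ _) _.
  exact: collar_normal_lip.
have {}IH i : holderC alpha k Bb (fun x => g x 0 i) by apply: IH; exact: ltnW.
have hd : holderC alpha k Bb d by apply: holderCW => //; exact: d_holder_step.
have hq i : holderC alpha k Bb (fun x => q x 0 i).
  apply: (@eq_holderC _ _ _ _ _ (fun x => x 0 i - d x * g x 0 i)) => //.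
    move=> x; rewrite inE => Bx; have -> : x 0 i = q x 0 i + d x * g x 0 i.
      by rewrite [in LHS](qE Bx) mxE [X in _ + X]mxE.
    by rewrite addrK.
  by apply: holderCB => //; [exact: holderC_coord|exact: holderCM].
have hM i l : holderC alpha k Bb (fun x => M x i l).
  apply: (@eq_holderC _ _ _ _ _ (fun x => partial i (fun z => N z 0 l) (q x))) => //.
    by move=> x _; rewrite /M mxE.
  apply: (holderC_comp _ oBb oBa) => //; first exact: collar_proj_lipschitz.
  have [_ _ H] := N_holder l; exact: holderC_le (H i).
have hA i l : holderC alpha k Bb (fun x => invmx (A x) i l).
  apply: holderC_invmx => // i' l'.
  apply: (@eq_holderC _ _ _ _ _ (fun x => (1%:M : 'M[R]_n) i' l' + d x * M x i' l')) => //.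
    by move=> x _; rewrite /A [RHS]mxE [X in _ = _ + X]mxE.
  by apply: holderCD => //; [exact: holderC_cst|exact: holderCM].
apply: (@holderCS _ _ _ _ _ _ (fun i x => Jac x i 0 j)) => //.
  by move=> x i Bx; exact: collar_normal_derive.
move=> i; apply: (@eq_holderC _ _ _ _ _ (fun x => \sum_l (\sum_m
    ((delta_mx 0 i : 'rV[R]_n) 0 m - g x 0 i * g x 0 m) * M x m l) * invmx (A x) l j)) => //.
  move=> x _; rewrite /Jac [RHS]mxE; apply: eq_bigr => l _; rewrite [in RHS]mxE.
  congr (_ * _); apply: eq_bigr => m _; congr (_ * _).
  by rewrite [RHS]mxE; congr (_ + _); rewrite [RHS]mxE; congr (- _); rewrite [RHS]mxE.
apply: holderC_sum => // l; apply: holderCM => //; apply: holderC_sum => // m.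
apply: holderCM => //; apply: holderCB => //; first exact: holderC_cst.
exact: holderCM.
Qed.

(** The gradient of d is g, as regular as N itself, so d regains the derivative that N has lost
    against phi. *)
Lemma collar_dist_holder : holderC alpha r.+2 Bb d.
Proof. by apply: d_holder_step => j; exact: collar_normal_holder. Qed.

Lemma collar_grad x : Bb x -> grad d x = g x.
Proof. by move=> Bx; apply/rowP => i; rewrite mxE collar_partial_dist. Qed.

Let HessE x i j : Bb x -> Hess d x i j = Jac x i 0 j.
Proof.
move=> Bx; rewrite mxE.
have [_ <-] := collar_normal_derive i j Bx.
rewrite {1}/partial; apply: near_eq_derive.
have := near_open (@open_sup_ball b) _ Bx; apply => y; rewrite inE => By.
exact: collar_partial_dist.
Qed.

(** Differentiate dot g g = 1. *)
Lemma collar_Hess_normal x : Bb x -> Hess d x *m (grad d x)^T = 0.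
Proof.
move=> Bx; rewrite collar_grad //; apply/matrixP => i k; rewrite ord1 mxE [RHS]mxE.
have D1 : is_derive x (delta_mx 0 i) (fun y => \sum_j g y 0 j * g y 0 j)
    (\sum_j (g x 0 j * Jac x i 0 j + g x 0 j * Jac x i 0 j)).
  have := @is_derive_sum _ _ _ n (fun j y => g y 0 j * g y 0 j) x (delta_mx 0 i) _
    (fun j => is_deriveM (collar_normal_derive i j Bx) (collar_normal_derive i j Bx)).
  by congr (is_derive _ _ _ _); apply/funext => y; rewrite fct_sumE.
have D2 : is_derive x (delta_mx 0 i) (fun y => \sum_j g y 0 j * g y 0 j) 0.
  apply: (near_eq_is_derive _ (is_derive_cst (1 : R) x _)).
  have := near_open (@open_sup_ball b) _ Bx; apply => y; rewrite inE => By.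
  by rewrite -[LHS](collar_normal_unit By).
have [_ E1] := D1; have [_ E2] := D2; move: E1; rewrite E2 => /esym.
under eq_bigr do rewrite -mulr2n.
rewrite sumrMnl => /eqP; rewrite mulrn_eq0 /= => /eqP E0; rewrite -[RHS]E0.
apply: eq_bigr => j _; by rewrite HessE // mulrC; congr (_ * _); rewrite mxE.
Qed.

(** At q x the distance is 0, so A = 1 there and Hess d (q x) = (1 - g^T g) M = Hess d x *m A x. In
    the product with Hess d x, which annihilates g^T, M may be replaced by (1 - g^T g) M. *)
Lemma collar_Hess_proj x : Bb x -> Bb (q x) -> d (q x) = 0 -> q (q x) = q x ->
  Hess d x + d x *: (Hess d x *m Hess d (q x)) = Hess d (q x).
Proof.
move=> Bx Bq dq qq.
have HE y : Bb y -> Hess d y = (1%:M - (g y)^T *m g y) *m M y *m invmx (A y).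
  move=> By; apply/row_matrixP => i; have -> : row i (Hess d y) = Jac y i.
    by apply/rowP => j; rewrite mxE HessE.
  rewrite /Jac !row_mul; congr (_ *m _ *m _); rewrite linearB /= row1 row_mul; congr (_ - _).
  by apply/rowP => j; rewrite !mxE big_ord1 !mxE.
have gq : g (q x) = g x by rewrite /g qq.
have Mq : M (q x) = M x by rewrite /M qq.
have Hq : Hess d (q x) = (1%:M - (g x)^T *m g x) *m M x.
  by rewrite (HE _ Bq) gq Mq /A dq scale0r addr0 invmx1 mulmx1.
have HA : Hess d x *m A x = Hess d (q x) by rewrite Hq (HE _ Bx) (mulmxKV (unitA Bx)).
rewrite -[RHS]HA /A mulmxDr mulmx1 -scalemxAr; congr (_ + _ *: _).
rewrite Hq mulmxA mulmxBr mulmx1 mulmxA -(collar_grad Bx) (collar_Hess_normal Bx).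
by rewrite mul0mx subr0.
Qed.

End Collar.

(** * Local charts: the signed distance near a boundary point *)

Section LocalCollar.
Context {R : realType} {n : nat}.
Variables (alpha : R) (r : nat) (D : set 'rV[R]_n).
Hypotheses (alpha01 : 0 < alpha <= 1) (n_gt0 : (0 < n)%N) (openD : open D).
Hypotheses (bndD : bounded_set D) (D_neq0 : D !=set0).
Implicit Types (v w x y z : 'rV[R]_n).
Local Notation delta := (signed_dist D).

(* The point y is the boundary point nearest to x. *)
Definition collar_at W := [/\ open W, holderC alpha r.+2 W delta & forall x, W x ->
  [/\ dot (grad delta x) (grad delta x) = 1, Hess delta x *m (grad delta x)^T = 0 &
      exists y, [/\ boundary D y, grad delta y = grad delta x &
        Hess delta x + delta x *: (Hess delta x *m Hess delta y) = Hess delta y]]].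

Lemma unit_normal_holder phi U x0 : open U -> U x0 -> holderC alpha r.+2 U phi ->
  grad phi x0 != 0 -> exists a : R, [/\ 0 < a, sup_ball x0 a `<=` U,
    forall y, sup_ball x0 a y -> grad phi y != 0 &
    forall j, holderC alpha r.+1 (sup_ball x0 a) (fun y => unit_normal phi y 0 j)].
Proof.
move=> oU Ux0 hphi g0.
have hp j : holderC alpha r.+1 U (partial j phi) by have [_ _] := hphi; exact.
have hs : holderC alpha r.+1 U (fun y => dot (grad phi y) (grad phi y)).
  apply: (@eq_holderC _ _ _ _ _ (fun y => \sum_i partial i phi y * partial i phi y)) => //.
    by move=> y _; apply: eq_bigr => i _; rewrite !mxE.
  by apply: holderC_sum => // i; exact: holderCM.
have s0 := dot_gt0 g0.
have [c c0 cP] := (continuous_normE _ _).1 (holderC_continuous hs Ux0) _ s0.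
have /nbhs_normE[e e0 eU] : nbhs x0 U by exact: open_nbhs_nbhs.
have gn0 y : sup_ball x0 (Num.min c e) y -> 0 < dot (grad phi y) (grad phi y).
  rewrite /sup_ball /= lt_min => /andP[/cP + _]; rewrite ltr_norml => /andP[+ _].
  by rewrite ltrBrDr addNr.
have BU : sup_ball x0 (Num.min c e) `<=` U.
  by move=> y; rewrite /sup_ball /= lt_min => /andP[_ /eU].
have oB := @open_sup_ball R n x0 (Num.min c e).
exists (Num.min c e); split; [by rewrite lt_min c0|exact: BU| |].
  by move=> y /gn0 H; apply: contraTneq H => ->; rewrite dot0l ltxx.
move=> j; apply: (@eq_holderC _ _ _ _ _ (fun y =>
    (Num.sqrt (dot (grad phi y) (grad phi y)))^-1 * partial j phi y)) => //.
  by move=> y _; rewrite [RHS]mxE [X in _ = _ * X]mxE.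
apply: holderCM => //; last exact: holderC_sub BU (hp j).
apply: holderCV => // [y /gn0 H|]; first by rewrite gt_eqF // sqrtr_gt0.
by apply: holderC_sqrt => //; exact: holderC_sub BU hs.
Qed.

Lemma exists_collar phi U x0 : open U -> U x0 -> holderC alpha r.+2 U phi ->
  D `&` U = [set y | phi y < 0] `&` U ->
  boundary D `&` U = [set y | phi y = 0] `&` U ->
  (forall y, boundary D y -> U y -> grad phi y != 0) ->
  boundary D x0 -> exists2 W, W x0 & collar_at W.
Proof.
move=> oU Ux0 hphi DU bDU gphi bx0.
have [a [a0 aU ga ha]] := unit_normal_holder oU Ux0 hphi (gphi _ bx0 Ux0).
have [L L0 [a' a'0 lipN]] : exists2 L : R, 0 < L & exists2 a' : R, 0 < a' & forall y z,
    `|y - x0| < a' -> `|z - x0| < a' ->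
    `|unit_normal phi y - unit_normal phi z| <= L * `|y - z|.
  apply: lipschitz_row => j; apply: (holderC_lipschitz _ _ (ha j)).
    exact: open_sup_ball.
  by rewrite /sup_ball /= subrr normr0.
pose A := Num.min a a'; have A0 : 0 < A by rewrite lt_min a0.
have BA : sup_ball x0 A `<=` sup_ball x0 a.
  by move=> y; rewrite /sup_ball /= lt_min => /andP[].
have nR : 1 <= n%:R :> R by rewrite ler1n.
have nR0 : 0 < n%:R :> R by rewrite ltr0n.
(* The signed distance has Lipschitz constant 2 in the Euclidean norm, which is at most n times the
   sup norm. *)
pose K : R := 2 * n%:R; have K0 : 0 < K by rewrite mulr_gt0.
(* Any choice of nearest points will do: the collar estimates show that it is Lipschitz. *)
pose q x := sval (cid (nearest_boundary n_gt0 openD bndD D_neq0 x)).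
have qP x : [/\ boundary D (q x), enorm (x - q x) = `|delta x|,
    (D x -> forall z, enorm (x - z) < enorm (x - q x) -> D z) &
    (~ D x -> forall z, enorm (x - z) < enorm (x - q x) -> ~ D z)].
  by rewrite /q; case: cid.
have dlip x y : `|delta x - delta y| <= K * `|x - y|.
  rewrite (le_trans (signed_dist_lipschitz n_gt0 bndD D_neq0 x y)) // -mulrA.
  by rewrite ler_pM2l // enorm_le_norm.
have dx0 : delta x0 = 0 by apply/(signed_dist_eq0 n_gt0 openD bndD D_neq0).
have dle x : `|delta x| <= K * `|x - x0|.
  by have := dlip x x0; rewrite dx0 subr0.
have qnear x e : `|x - x0| < e / (K + 1) -> `|q x - x0| < e.
  move=> xe; have [_ E _ _] := qP x.
  have -> : q x - x0 = (x - x0) - (x - q x) by rewrite opprB [RHS]addrC addrA subrK.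
  rewrite (le_lt_trans (ler_normB _ _)) //.
  rewrite (le_lt_trans (lerD (lexx _) (norm_le_enorm _))) // E.
  rewrite (le_lt_trans (lerD (lexx _) (dle x))) //.
  by move: xe; rewrite ltr_pdivlMr ?addr_gt0 // mulrDr mulr1 mulrC addrC.
(* The three bounds put q x into the ball of radius A, make |delta| L n <= 1/4, and make |delta| <=
   1. *)
pose b := Num.min (A / (K + 1)) (Num.min (1 / (4 * L * n%:R * K)) (1 / K)).
have b0 : 0 < b.
  by rewrite !lt_min !divr_gt0 ?addr_gt0 //; rewrite !mulr_gt0.
have Bb x : sup_ball x0 b x -> [/\ `|x - x0| < A / (K + 1),
    `|delta x| * L * n%:R <= 1 / 4 & `|delta x| <= 1].
  rewrite /sup_ball /= !lt_min => /and3P[H1 H2 H3]; split=> //.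
    move: H2; rewrite ltr_pdivlMr ?mulr_gt0 // => H2.
    have := dle x; move: (`|delta x|) H2 => t H2 tK.
    have : t * L * n%:R <= K * `|x - x0| * L * n%:R.
      by rewrite ler_wpM2r ?ler_wpM2r // ltW.
    move: H2; have -> : `|x - x0| * (4 * L * n%:R * K) = 4 * (K * `|x - x0| * L * n%:R) by ring.
    by lra.
  apply: le_trans (dle x) _; rewrite mulrC ltW //.
  by move: H3; rewrite ltr_pdivlMr.
have qA x : sup_ball x0 b x -> sup_ball x0 A (q x).
  by move=> /Bb[H _ _]; exact: qnear.
have strict y : sup_ball x0 A y -> strict_diff phi y (grad phi y).
  by move=> /BA /aU Uy; exact: holderC_strict oU Uy hphi.
have phiq x : sup_ball x0 b x -> phi (q x) = 0.
  move=> /qA /BA /aU Uq; have [bq _ _ _] := qP x.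
  have : (boundary D `&` U) (q x) by [].
  by rewrite bDU => -[].
have qE x : sup_ball x0 b x -> x = q x + delta x *: unit_normal phi (q x).
  move=> Bx; have BAq := qA x Bx; have Uq := aU _ (BA _ BAq).
  have [bq E1 E2 E3] := qP x.
  apply: (nearest_normal n_gt0 openD bndD oU Uq DU) => //.
  - exact: phiq.
  - exact: strict.
  - exact: gphi.
have hA j : holderC alpha r.+1 (sup_ball x0 A) (fun y => unit_normal phi y 0 j).
  exact: holderC_sub BA (ha j).
have gA y : sup_ball x0 A y -> grad phi y != 0 by move=> /BA; exact: ga.
have lipA y z : sup_ball x0 A y -> sup_ball x0 A z ->
    `|unit_normal phi y - unit_normal phi z| <= L * `|y - z|.
  by rewrite /sup_ball /= !lt_min => /andP[_ H1] /andP[_ H2]; exact: lipN.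
have dlipB x y : sup_ball x0 b x -> sup_ball x0 b y ->
  `|delta x - delta y| <= K * `|x - y| by [].
have dsm x : sup_ball x0 b x -> `|delta x| * L * n%:R <= 1 / 4 by case/Bb.
have dsm1 x : sup_ball x0 b x -> `|delta x| <= 1 by case/Bb.
have grE := collar_grad L0 (ltW K0) gA strict lipA qA phiq qE dlipB dsm dsm1 n_gt0.
have hol := collar_dist_holder alpha01 L0 (ltW K0) gA strict hA lipA qA phiq qE dlipB dsm dsm1 n_gt0.
have Hn := collar_Hess_normal L0 (ltW K0) gA strict hA lipA qA phiq qE dlipB dsm dsm1 n_gt0.
have Hp := collar_Hess_proj L0 (ltW K0) gA strict hA lipA qA phiq qE dlipB dsm dsm1 n_gt0.
have un := collar_normal_unit gA qA.
have b'b : b / (K + 1) <= b by rewrite ler_pdivrMr ?addr_gt0 // ler_peMr ?(ltW b0) // lerDr ltW.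
have sB x : sup_ball x0 (b / (K + 1)) x -> sup_ball x0 b x.
  by move=> /lt_le_trans; apply.
(* Since |q x - x0| <= (K + 1) |x - x0|, this smaller ball is mapped by q into the ball of radius b,
   so the formulas hold at q x too. *)
exists (sup_ball x0 (b / (K + 1))).
  by rewrite /sup_ball /= subrr normr0 divr_gt0 // addr_gt0.
split; [exact: open_sup_ball|exact: holderC_sub hol|move=> x Bx].
have Bx' := sB _ Bx; have Bq : sup_ball x0 b (q x) by exact: qnear.
have [bq _ _ _] := qP x.
have dq : delta (q x) = 0 by apply/(signed_dist_eq0 n_gt0 openD bndD D_neq0).
have qq : q (q x) = q x.
  have [_ + _ _] := qP (q x); rewrite dq normr0 => /eqP.
  by rewrite enorm_eq0 subr_eq0 => /eqP.
split; first by rewrite (grE _ Bx') (un _ Bx').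
  exact: (Hn _ Bx').
exists (q x); split; [exact: bq| |exact: (Hp _ Bx' Bq dq qq)].
by rewrite (grE _ Bq) (grE _ Bx') qq.
Qed.

End LocalCollar.

(** * Traces over p-planes *)

Section Spectral.
Context {R : realType}.

Lemma char_poly_orthogonal m (U A : 'M[R]_m) : U *m U^T = 1%:M ->
  char_poly (U *m A *m U^T) = char_poly A.
Proof.
move=> UU; rewrite /char_poly.
pose V := map_mx (@polyC R) U.
have VV : V *m V^T = 1%:M by rewrite /V map_trmx -map_mxM UU map_mx1.
have -> : char_poly_mx (U *m A *m U^T) = V *m char_poly_mx A *m V^T.
  rewrite /char_poly_mx mulmxBr mulmxBl mul_mx_scalar -scalemxAl VV.
  by rewrite scalemx1 !map_mxM /V map_trmx.
rewrite det_mulmx [X in X * _]det_mulmx mulrAC -det_mulmx.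
by rewrite VV det1 mul1r.
Qed.

Lemma dim_normal_hyperplane n (v : 'rV[R]_n) :
  (n.-1 <= \dim (lker (linfun (mulmxr v^T : 'rV[R]_n -> 'rV[R]_1))))%N.
Proof.
set f := linfun _; have := limg_ker_dim f fullv; rewrite capfv dimvf /dim /= mul1n => E.
have l1 : (\dim (limg f) <= 1)%N.
  by apply: leq_trans (dimvS (subvf _)) _; rewrite dimvf.
by rewrite -subn1 leq_subLR -[X in (X <= _)%N]E addnC leq_add2r.
Qed.

Lemma orthogonal_completion m (v : 'rV[R]_m.+1) : dot v v = 1 ->
  exists E : 'M[R]_(m, m.+1), E *m E^T = 1%:M /\ v *m E^T = 0.
Proof.
move=> v1; have := dim_normal_hyperplane v; set T := lker _ => mT.
have [e [eT eo]] := orthonormal_ext mT.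
exists (\matrix_i tnth e i); split.
  apply/matrixP => i j; rewrite mxE [RHS]mxE -eo.
  by apply: eq_bigr => k _; rewrite !mxE.
apply/rowP => j; rewrite !mxE; have := eT j.
rewrite memv_ker lfunE /= => /eqP/rowP/(_ 0); rewrite !mxE => E.
by rewrite -[RHS]E; apply: eq_bigr => k _; rewrite !mxE mulrC.
Qed.

(** Deflation: the first root has a unit eigenvector, whose orthogonal complement is invariant by
    symmetry and carries the remaining roots. The splitting supplies a real eigenvalue at each step,
    and the order of s becomes the order on the diagonal. *)
Lemma spectral_of_split m (S : 'M[R]_m) (s : seq R) : S^T = S ->
  char_poly S = \prod_(a <- s) ('X - a%:P) ->
  exists2 U : 'M[R]_m, U *m U^T = 1%:M & U *m S *m U^T = diag_mx (\row_i s`_i).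
Proof.
elim: m S s => [|m IH] S s Ssym Ss.
  by exists 1%:M; apply/matrixP => -[].
case: s Ss => [|a s] Ss.
  by have := size_char_poly S; rewrite Ss big_nil size_poly1.
rewrite big_cons in Ss.
have /eigenvalueP[v0 v0S v00] : eigenvalue S a.
  by rewrite eigenvalue_root_char Ss rootM root_XsubC eqxx.
have nv : enorm v0 != 0 by rewrite enorm_eq0.
have [v v1 vS] : exists2 v : 'rV[R]_m.+1, dot v v = 1 & v *m S = a *: v.
  exists ((enorm v0)^-1 *: v0); first by rewrite dotZl dotZr -sqr_enorm; field.
  by rewrite -scalemxAl v0S !scalerA mulrC.
have [E [EE vE]] := orthogonal_completion v1.
have vv : v *m v^T = 1%:M.
  by apply/matrixP => i j; rewrite !ord1 -dotE v1 mxE.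
have Ev : E *m v^T = 0 by rewrite -[LHS]trmxK trmx_mul trmxK vE trmx0.
pose Q : 'M[R]_(1 + m) := col_mx v E.
have QQ : Q *m Q^T = 1%:M.
  by rewrite /Q tr_col_mx mul_col_row vv vE Ev EE -scalar_mx_block.
pose S' := E *m S *m E^T.
have QS : Q *m S *m Q^T = block_mx a%:M 0 0 S'.
  rewrite /Q tr_col_mx mul_col_mx mul_col_row vS -!scalemxAl vv vE scaler0.
  rewrite scalemx1; congr block_mx.
  by apply: trmx_inj; rewrite !trmx_mul trmxK Ssym mulmxA vS -scalemxAl vE scaler0 trmx0.
have S's : char_poly S' = \prod_(b <- s) ('X - b%:P).
  apply: (mulfI (_ : 'X - a%:P != 0)); first by rewrite polyXsubC_eq0.
  have <- : char_poly (block_mx (a%:M : 'M[R]_1) 0 0 S') = ('X - a%:P) * char_poly S'.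
    rewrite [LHS]/char_poly char_block_diag_mx det_ublock; congr (_ * _).
    by rewrite /char_poly_mx det_mx11 !mxE mulr1n.
  by rewrite -Ss -(char_poly_orthogonal S QQ) QS.
have [|U' UU' US'] := IH S' s _ S's.
  by rewrite /S' !trmx_mul trmxK Ssym mulmxA.
pose B : 'M[R]_(1 + m) := block_mx 1%:M 0 0 U'.
have BB : B *m B^T = 1%:M.
  rewrite /B tr_block_mx mulmx_block !trmx0 !mulmx0 !mul0mx trmx1 mulmx1 UU'.
  by rewrite !addr0 add0r -scalar_mx_block.
have BQ : B *m Q *m (B *m Q)^T = 1%:M.
  by rewrite trmx_mul mulmxA -(mulmxA B) QQ mulmx1.
have BQS : B *m Q *m S *m (B *m Q)^T = block_mx a%:M 0 0 (diag_mx (\row_i s`_i)).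
  have -> : B *m Q *m S *m (B *m Q)^T = B *m (Q *m S *m Q^T) *m B^T.
    by rewrite trmx_mul !mulmxA.
  rewrite QS /B tr_block_mx !mulmx_block !trmx0 !mulmx0 !mul0mx !trmx1 !mulmx1 !mul1mx.
  by rewrite !addr0 !add0r US' mul0mx.
exists (B *m Q); first exact: BQ.
apply: (etrans BQS).
suff : block_mx a%:M 0 0 (diag_mx (\row_(i < m) s`_i)) =
  diag_mx (\row_(i < 1 + m) (a :: s)`_i) by [].
apply/matrixP => i j; case: (split_ordP i) => i' ->; case: (split_ordP j) => j' ->.
- by rewrite block_mxEul !mxE !ord1 !eqxx.
- by rewrite block_mxEur !mxE eq_lrshift.
- by rewrite block_mxEdl !mxE eq_rlshift.
- by rewrite block_mxEdr !mxE eq_rshift.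
Qed.

End Spectral.

(** * Principal directions and Ky Fan's inequality *)

Section KyFan.
Context {R : realType} {n : nat}.
Implicit Types (u v g : 'rV[R]_n) (H : 'M[R]_n).

Definition orthonormal k (e : 'I_k -> 'rV[R]_n) :=
  forall i j, dot (e i) (e j) = (i == j)%:R.

Lemma bessel k (e : 'I_k -> 'rV[R]_n) v : orthonormal e ->
  \sum_i dot (e i) v ^+ 2 <= dot v v.
Proof.
move=> eo; pose w := \sum_i dot (e i) v *: e i.
have wv : dot w v = \sum_i dot (e i) v ^+ 2.
  by rewrite dot_suml; apply: eq_bigr => i _; rewrite dotZl expr2.
have ww : dot w w = \sum_i dot (e i) v ^+ 2.
  rewrite {1}/w dot_suml; apply: eq_bigr => i _; rewrite dotZl expr2 [dot _ w]dotC /w dot_suml; congr (_ * _).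
  rewrite (bigD1 i) //= big1 ?addr0 => [|j ji]; first by rewrite dotZl eo eqxx mulr1.
  by rewrite dotZl eo (negbTE ji) mulr0.
have := dot_ge0 (v - w); rewrite dotDl !dotDr !dotNl !dotNr (dotC v w) wv ww.
by lra.
Qed.

(** For matrices that are square only up to a proved equation, such as a frame with 1 + \dim T rows
    in dimension n. *)
Lemma mulmx1C_eq m k (A : 'M[R]_(m, k)) (B : 'M[R]_(k, m)) : m = k ->
  A *m B = 1%:M -> B *m A = 1%:M.
Proof. by move=> mk; case: k / mk A B => A B; exact: mulmx1C. Qed.

(** The vectors f are the principal directions; together with g they form an orthonormal basis, and
    since H annihilates the normal the quadratic form has no term in g. *)
Lemma principal_frame H g (nu : seq R) : H^T = H -> H *m g^T = 0 -> dot g g = 1 ->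
  char_poly_on (lker (linfun (mulmxr g^T : 'rV[R]_n -> 'rV[R]_1))) H
    = \prod_(a <- nu) ('X - a%:P) -> size nu = n.-1 ->
  exists f : 'I_n.-1 -> 'rV[R]_n, [/\ forall j, dot (f j) (f j) = 1,
    forall j : 'I_n.-1, f j *m H = nu`_j *: f j,
    forall v, dot v v = dot v g ^+ 2 + \sum_j dot v (f j) ^+ 2 &
    forall v, dot (v *m H) v = \sum_(j < n.-1) nu`_j * dot v (f j) ^+ 2].
Proof.
set T := lker _ => Hsym Hg g1 Hc snu.
(* The dimension is the degree of the characteristic polynomial, hence the number of listed
   curvatures. *)
have dT : \dim T = n.-1.
  have := size_char_poly (form_mx H (onb_of T)).
  by rewrite -/(char_poly_on T H) Hc size_prod_XsubC snu => -[].
rewrite -dT; move: Hc; rewrite /char_poly_on; set e := onb_of T => Hc.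
have /orthonormal_basisP[eT eo] := onb_of_spec T; rewrite -/e in eT eo.
pose E : 'M[R]_(\dim T, n) := \matrix_i tnth e i.
have EE : E *m E^T = 1%:M.
  apply/matrixP => i j; rewrite mxE [RHS]mxE -eo.
  by apply: eq_bigr => k _; rewrite !mxE.
have FH : form_mx H e = E *m H *m E^T by exact: form_mxE.
have [|U UU US] := spectral_of_split _ Hc.
  by rewrite FH !trmx_mul trmxK Hsym mulmxA.
have [F FE] : exists F, F = U *m E by exists (U *m E).
have FF : F *m F^T = 1%:M.
  by rewrite FE trmx_mul mulmxA -(mulmxA U) EE mulmx1.
have FHF : F *m H *m F^T = diag_mx (\row_i nu`_i).
  by rewrite -US FH FE trmx_mul !mulmxA.
have Eg : E *m g^T = 0.
  apply/matrixP => i j; rewrite ord1 mxE [RHS]mxE.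
  have : tnth e i \in T by rewrite (basis_mem eT) // mem_tnth.
  rewrite memv_ker lfunE /= => /eqP/rowP/(_ 0); rewrite !mxE => E0.
  by rewrite -[RHS]E0; apply: eq_bigr => k _; rewrite !mxE.
have Fg : F *m g^T = 0 by rewrite FE -mulmxA Eg mulmx0.
have gF : g *m F^T = 0 by rewrite -[LHS]trmxK trmx_mul trmxK Fg trmx0.
have gg : g *m g^T = 1%:M by apply/matrixP => i j; rewrite !ord1 -dotE g1 mxE.
pose G := col_mx g F.
have GG : G *m G^T = 1%:M.
  by rewrite /G tr_col_mx mul_col_row gg gF Fg FF -scalar_mx_block.
have n_gt0 : (0 < n)%N.
  rewrite lt0n; apply: contra_eq_neq g1 => n0; rewrite /dot big1 ?[0 == 1]eq_sym ?oner_neq0 //.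
  by move=> [i lti] _; exfalso; move: lti; rewrite n0.
have GG' : G^T *m G = 1%:M.
  by apply: mulmx1C_eq GG; rewrite dT add1n prednK.
have gH : g *m H = 0 by rewrite -[LHS]trmxK trmx_mul Hsym Hg trmx0.
have GHG : G *m H *m G^T = block_mx 0 0 0 (diag_mx (\row_i nu`_i)).
  rewrite /G tr_col_mx mul_col_mx mul_col_row gH FHF !mul0mx.
  by rewrite -(mulmxA F H) Hg mulmx0.
have vG v : v *m G^T = row_mx (v *m g^T) (v *m F^T).
  by rewrite /G tr_col_mx mul_mx_row.
have vF v j : (v *m F^T) 0 j = dot v (row j F).
  by rewrite mxE; apply: eq_bigr => k _; rewrite !mxE.
exists (fun j => row j F); split.
- move=> j; have <- : (F *m F^T) j j = 1 by rewrite FF mxE eqxx.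
  by rewrite mxE; apply: eq_bigr => k _; rewrite !mxE.
- move=> j; have -> : row j F *m H = row j (F *m H) by rewrite row_mul.
  suff -> : F *m H = diag_mx (\row_i nu`_i) *m F.
    by rewrite mul_diag_mx; apply/rowP => k; rewrite !mxE.
  rewrite -FHF -mulmxA.
  have -> : F^T *m F = 1%:M - g^T *m g.
    by rewrite -GG' /G tr_col_mx mul_row_col addrAC subrr add0r.
  by rewrite mulmxBr mulmx1 mulmxA -(mulmxA F H) Hg mulmx0 mul0mx subr0.
- move=> v; rewrite dotE -[X in X *m _]mulmx1 -GG' mulmxA -mulmxA.
  have -> : G *m v^T = (v *m G^T)^T by rewrite trmx_mul trmxK.
  rewrite vG tr_row_mx mul_row_col mxE; congr (_ + _).
    by rewrite -dotE /dot big_ord1 -expr2 -dotE.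
  rewrite -dotE; apply: eq_bigr => j _; by rewrite vF expr2.
- move=> v; rewrite dotE.
  have -> : v *m H *m v^T = v *m G^T *m (G *m H *m G^T) *m (v *m G^T)^T.
    rewrite trmx_mul trmxK !mulmxA -(mulmxA v G^T G) GG' mulmx1.
    by rewrite -(mulmxA (v *m H) G^T G) GG' mulmx1.
  rewrite GHG vG mul_row_block !mulmx0 !addr0 add0r tr_row_mx mul_row_col.
  rewrite mul0mx add0r -dotE; apply: eq_bigr => j _.
  by rewrite !vF mul_mx_diag mxE vF mxE expr2 mulrA [X in X * _]mulrC.
Qed.

Variables (g : 'rV[R]_n) (m p : nat) (f : 'I_m -> 'rV[R]_n) (nu : seq R).
Variable e : 'I_p -> 'rV[R]_n.
Hypotheses (nu_sorted : sorted <=%R nu) (size_nu : size nu = m).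
Hypotheses (p_gt0 : (0 < p)%N) (pm : (p <= m)%N).
Hypothesis f1 : forall j, dot (f j) (f j) = 1.
Hypothesis parseval : forall v, dot v v = dot v g ^+ 2 + \sum_j dot v (f j) ^+ 2.
Hypothesis e_on : orthonormal e.

(** Squared lengths of the projections of f j (below, of g) to the plane spanned by e. Each w j lies
    in [0, 1], and all weights add up to p ([w_sum]). *)
Let w j := \sum_i dot (e i) (f j) ^+ 2.
Let wg := \sum_i dot (e i) g ^+ 2.

Let w_ge0 j : 0 <= w j. Proof. by apply: sumr_ge0 => i _; exact: sqr_ge0. Qed.
Let w_le1 j : w j <= 1. Proof. by rewrite -(f1 j); exact: bessel. Qed.
Let wg_ge0 : 0 <= wg. Proof. by apply: sumr_ge0 => i _; exact: sqr_ge0. Qed.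

Let w_sum : wg + \sum_j w j = p%:R.
Proof.
rewrite exchange_big -big_split /= -[RHS]mulr1 mulr_natl -[in RHS](card_ord p) -sumr_const.
by apply: eq_bigr => i _; rewrite -parseval e_on eqxx.
Qed.

Let nu_mono i j : (i <= j < m)%N -> nu`_i <= nu`_j.
Proof.
case/andP=> ij jm; apply: (sorted_leq_nth le_trans le_refl 0 nu_sorted) => //;
  by rewrite inE size_nu // (leq_ltn_trans ij).
Qed.

(** With c the p-th smallest value (index p - 1), every product (nu_j - c) (w_j - [j < p]) is
    nonnegative by sortedness and 0 <= w_j <= 1. Summing, with total weight p, gives the claim for
    kappa = c, and a larger kappa only helps. *)
Lemma ky_fan kappa : nu`_p.-1 <= kappa ->
  \sum_(i < p) nu`_i <= \sum_(j < m) nu`_j * w j + kappa * wg.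
Proof.
move=> hk; set c := nu`_p.-1 in hk.
have H : 0 <= \sum_(j < m) (nu`_j - c) * (w j - (j < p)%N%:R).
  apply: sumr_ge0 => j _; have [jp|pj] := ltnP j p.
    rewrite mulr_le0 // subr_le0 ?w_le1 // nu_mono //.
    by rewrite -ltnS prednK // jp (leq_trans _ pm) // prednK.
  rewrite subr0 mulr_ge0 // subr_ge0 nu_mono // ltn_ord andbT.
  by rewrite (leq_trans (leq_pred _)).
have E : \sum_(j < m) (nu`_j - c) * (w j - (j < p)%N%:R) =
   \sum_(j < m) nu`_j * w j - c * (\sum_j w j) - \sum_(i < p) nu`_i + c * p%:R.
  have -> : \sum_(i < p) nu`_i = \sum_(j < m) nu`_j * (j < p)%N%:R.
    rewrite (big_ord_widen _ (fun i => nu`_i) pm) big_mkcond.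
    by apply: eq_bigr => j _; case: ltnP; rewrite ?mulr1 ?mulr0.
  have -> : p%:R = \sum_(j < m) (j < p)%N%:R :> R.
    rewrite -[in LHS](card_ord p) -sum1_card natr_sum.
    rewrite (big_ord_widen _ (fun i => 1%:R) pm) big_mkcond.
    by apply: eq_bigr => j _; case: ltnP.
  rewrite !mulr_sumr -!sumrB -big_split /=; apply: eq_bigr => j _; ring.
have := mulr_ge0 (_ : 0 <= kappa - c) wg_ge0; rewrite subr_ge0 => /(_ hk).
by rewrite E in H; move: H; rewrite -w_sum; nra.
Qed.

(** The total weight p lies on the indices with nu_j = 0, each carrying at most 1, so there are at
    least p of them. If one has index >= p, the first p values are <= 0 with nonnegative sum;
    otherwise these indices are exactly the first p. *)
Lemma flat_of_kernel : (forall i, dot (e i) g = 0) ->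
  (forall i (j : 'I_m), nu`_j != 0 -> dot (e i) (f j) = 0) ->
  0 <= \sum_(i < p) nu`_i -> forall i, (i < p)%N -> nu`_i = 0.
Proof.
move=> eg ef s0; pose Z : {set 'I_m} := [set j : 'I_m | nu`_j == 0]%SET.
have pZ : (p <= #|Z|)%N.
  rewrite -(ler_nat R) -w_sum /wg big1 ?add0r => [|i _]; last by rewrite eg expr0n.
  rewrite -sum1_card natr_sum [leRHS]big_mkcond /=; apply: ler_sum => j _.
  rewrite inE; case: eqVneq => [_|jn]; first exact: w_le1.
  by rewrite /w big1 // => i _; rewrite ef // expr0n.
have [[j]|] := pselect (exists2 j : 'I_m, (p <= j)%N & nu`_j = 0).
  move=> pj nj.
  have le0 i : (i < p)%N -> nu`_i <= 0.
    move=> ip; have := @nu_mono i j; rewrite nj ltn_ord andbT; apply.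
    exact: leq_trans (ltnW ip) pj.
  have H : \sum_(i < p) - nu`_i == 0.
    rewrite eq_le sumr_ge0 ?andbT; last by move=> i _; rewrite oppr_ge0 le0.
    by rewrite sumrN oppr_le0.
  move=> i ip; apply/eqP; rewrite -oppr_eq0.
  move: H; rewrite psumr_eq0 => [/allP/(_ (Ordinal ip))|k _].
    by rewrite mem_index_enum => /(_ isT).
  by rewrite oppr_ge0 le0.
move=> noj i ip; have im : (i < m)%N by exact: leq_trans pm.
pose W : {set 'I_m} := [set j : 'I_m | (j < p)%N]%SET.
have ZW : Z \subset W.
  apply/fintype.subsetP => j; rewrite !inE ltnNge => /eqP nj; apply/negP => pj; apply: noj.
  by exists j.
have cW : #|W| = p.
  rewrite -sum1_card; rewrite -[RHS](card_ord p) -sum1_card.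
  rewrite (big_ord_widen _ (fun i => 1%N) pm).
  by apply: eq_bigl => j; rewrite inE.
have /eqP ZE : Z == W by rewrite eqEcard ZW cW.
have : Ordinal im \in Z by rewrite ZE inE.
by rewrite inE => /eqP.
Qed.

End KyFan.

(** * Hessians *)

Section HessianCalculus.
Context {R : realType} {n : nat}.
Variable alpha : R.
Hypothesis alpha01 : 0 < alpha <= 1.
Implicit Types (f g : 'rV[R]_n -> R) (x y z v w : 'rV[R]_n) (U V : set 'rV[R]_n).
Implicit Types A B : 'M[R]_n.
Local Notation holderC := (@holderC R n alpha).

Definition qform A v := dot (v *m A) v.

Lemma qformD A B v : qform (A + B) v = qform A v + qform B v.
Proof. by rewrite /qform mulmxDr dotDl. Qed.

Lemma qformZ c A v : qform (c *: A) v = c * qform A v.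
Proof. by rewrite /qform -scalemxAr dotZl. Qed.

Lemma qform_rank1 w v : qform (w^T *m w) v = dot v w ^+ 2.
Proof.
by rewrite /qform mulmxA dotE -mulmxA mxE big_ord1 -!dotE (dotC w) expr2.
Qed.

Lemma derive_first U f x i : holderC 2 U f -> U x -> derivable f x (delta_mx 0 i).
Proof. by case=> _ d _ Ux; exact: d. Qed.

Lemma derive_second U f x i j : holderC 2 U f -> U x ->
  derivable (partial j f) x (delta_mx 0 i).
Proof. by case=> _ _ h Ux; have [_ d _] := h j; exact: d. Qed.

(** A formula for the first derivatives on an open set may be differentiated once more. *)
Lemma Hess_of_partial U f (F : 'I_n -> 'rV[R]_n -> R) x : open U -> U x ->
  (forall i y, U y -> partial i f y = F i y) ->
  forall i j, Hess f x i j = partial i (F j) x.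
Proof.
move=> oU Ux fF i j; have fFj : {in U, partial j f =1 F j}.
  by move=> y; rewrite inE => /fF.
by rewrite mxE; exact: (eq_partial i oU fFj (mem_set Ux)).
Qed.

Lemma eq_Hess U f g x : open U -> U x -> {in U, f =1 g} -> Hess f x = Hess g x.
Proof.
move=> oU Ux fg; apply/matrixP => i j; rewrite [RHS]mxE.
apply: (Hess_of_partial (F := fun k => partial k g) oU Ux) => k y Uy.
exact: (eq_partial _ oU fg (mem_set Uy)).
Qed.

Lemma partialD f g x i : derivable f x (delta_mx 0 i) -> derivable g x (delta_mx 0 i) ->
  partial i (fun y => f y + g y) x = partial i f x + partial i g x.
Proof. by move=> df dg; have [_] := is_deriveD (derivableP df) (derivableP dg). Qed.

Lemma partialZ c f x i : derivable f x (delta_mx 0 i) ->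
  partial i (fun y => c * f y) x = c * partial i f x.
Proof. by move=> df; have [_] := is_deriveZ c (derivableP df). Qed.

Lemma partial_maxX k f x i : derivable f x (delta_mx 0 i) ->
  partial i (fun y => Num.max (f y) 0 ^+ k.+2) x =
  k.+2%:R * Num.max (f x) 0 ^+ k.+1 * partial i f x.
Proof.
by move=> df; have [_] := is_derive_comp1 (derivableP df) (is_derive_maxX k (f x)).
Qed.

Lemma gradD f g x : (forall i, derivable f x (delta_mx 0 i)) ->
  (forall i, derivable g x (delta_mx 0 i)) ->
  grad (fun y => f y + g y) x = grad f x + grad g x.
Proof. by move=> df dg; apply/rowP => i; rewrite !mxE partialD. Qed.

Lemma gradZ c f x : (forall i, derivable f x (delta_mx 0 i)) ->
  grad (fun y => c * f y) x = c *: grad f x.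
Proof. by move=> df; apply/rowP => i; rewrite !mxE partialZ. Qed.

Lemma grad_maxX k f x : (forall i, derivable f x (delta_mx 0 i)) ->
  grad (fun y => Num.max (f y) 0 ^+ k.+2) x =
  (k.+2%:R * Num.max (f x) 0 ^+ k.+1) *: grad f x.
Proof. by move=> df; apply/rowP => i; rewrite !mxE partial_maxX. Qed.

Lemma HessD U f g x : open U -> U x -> holderC 2 U f -> holderC 2 U g ->
  Hess (fun y => f y + g y) x = Hess f x + Hess g x.
Proof.
move=> oU Ux hf hg; apply/matrixP => i j.
rewrite (Hess_of_partial (F := fun j y => partial j f y + partial j g y) oU Ux).
  rewrite [RHS]mxE [X in _ = X + _]mxE [X in _ = _ + X]mxE.
  have d1 : derivable (partial j f) x (delta_mx 0 i) by exact: derive_second hf Ux.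
  have d2 : derivable (partial j g) x (delta_mx 0 i) by exact: derive_second hg Ux.
  exact: partialD d1 d2.
by move=> k y Uy; exact: partialD (derive_first hf Uy) (derive_first hg Uy).
Qed.

Lemma HessZ c U f x : open U -> U x -> holderC 2 U f ->
  Hess (fun y => c * f y) x = c *: Hess f x.
Proof.
move=> oU Ux hf; apply/matrixP => i j.
rewrite (Hess_of_partial (F := fun j y => c * partial j f y) oU Ux).
  by rewrite !mxE; exact: partialZ (derive_second hf Ux).
by move=> k y Uy; exact: partialZ (derive_first hf Uy).
Qed.

Lemma grad_cst c x : grad (fun=> c) x = 0.
Proof. by apply/rowP => i; rewrite !mxE; exact: derive_cst. Qed.

Lemma Hess_cst c x : Hess (fun=> c) x = 0.
Proof.
apply/matrixP => i j; rewrite [RHS]mxE.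
rewrite (Hess_of_partial (U := setT) (F := fun _ _ => 0) openT) //.
  exact: derive_cst.
by move=> k y _; exact: derive_cst.
Qed.

Lemma Hess_maxX k U f x : open U -> U x -> holderC 2 U f ->
  Hess (fun y => Num.max (f y) 0 ^+ k.+3) x =
  (k.+3%:R * Num.max (f x) 0 ^+ k.+2) *: Hess f x +
  (k.+3%:R * k.+2%:R * Num.max (f x) 0 ^+ k.+1) *: ((grad f x)^T *m grad f x).
Proof.
move=> oU Ux hf; apply/matrixP => i j.
rewrite (Hess_of_partial (F := fun j y =>
  k.+3%:R * (Num.max (f y) 0 ^+ k.+2 * partial j f y)) oU Ux); last first.
  by move=> l y Uy; rewrite partial_maxX ?mulrA //; exact: derive_first hf Uy.
have df : derivable f x (delta_mx 0 i) by exact: derive_first hf Ux.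
have dg : derivable (partial j f) x (delta_mx 0 i) by exact: derive_second hf Ux.
have dm : is_derive x (delta_mx 0 i) (fun y => Num.max (f y) 0 ^+ k.+2)
    (k.+2%:R * Num.max (f x) 0 ^+ k.+1 * partial i f x).
  by have := is_derive_comp1 (derivableP df) (is_derive_maxX k (f x)).
have [_] := is_deriveZ k.+3%:R (is_deriveM dm (derivableP dg)).
rewrite [X in X = _](_ : _ = partial i (fun y => k.+3%:R *
  (Num.max (f y) 0 ^+ k.+2 * partial j f y)) x) // => ->.
rewrite ![in RHS]mxE big_ord1 !mxE /GRing.scale /= -/(partial i (partial j f) x).
move: (k.+3%:R : R) (k.+2%:R : R) (Num.max (f x) 0 ^+ k.+2) (Num.max (f x) 0 ^+ k.+1).
by move: (partial i f x) (partial j f x) (partial i _ x) => *; ring.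
Qed.


Lemma sqnorm_holder k U : open U -> holderC k U (fun x => dot x x).
Proof.
move=> oU; apply: holderC_sum => // i.
by apply: holderCM => //; exact: holderC_coord.
Qed.

Lemma Hess_sqnorm x : Hess (fun y => dot y y) x = 2%:M.
Proof.
have d1 y i : is_derive y (delta_mx 0 i) (fun z => dot z z) (2 * y 0 i).
  have := @is_derive_sum _ _ _ n (fun j z => z 0 j * z 0 j) y (delta_mx 0 i) _
    (fun j => is_deriveM (is_derive_coord y (delta_mx 0 i) j)
                         (is_derive_coord y (delta_mx 0 i) j)).
  have -> : \sum_(j < n) (fun z : 'rV[R]_n => z 0 j * z 0 j) = fun z => dot z z.
    by apply/funext => z; rewrite fct_sumE.
  move/is_derive_eq; apply; rewrite (bigD1 i) //= big1 ?addr0 => [|j ji].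
    by rewrite !mxE !eqxx /GRing.scale /=; ring.
  by rewrite !mxE (negbTE ji) andbF /GRing.scale /= mulr0 addr0.
apply/matrixP => i j.
rewrite (Hess_of_partial (U := setT) (F := fun j y => 2 * y 0 j) openT) //; last first.
  by move=> k y _; rewrite /partial; have [_ ->] := d1 y k.
rewrite partialZ; last by have [] := is_derive_coord x (delta_mx 0 i) j.
rewrite /partial; have [_ ->] := is_derive_coord x (delta_mx 0 i) j.
by rewrite !mxE eqxx /= eq_sym mulr_natr.
Qed.

End HessianCalculus.

(** * The collar of the boundary *)

Section Tube.
Context {R : realType} {n : nat}.
Variables (alpha : R) (r : nat) (D : set 'rV[R]_n).
Hypotheses (alpha01 : 0 < alpha <= 1) (n_gt0 : (0 < n)%N) (openD : open D).
Hypotheses (bndD : bounded_set D) (D_neq0 : D !=set0).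
Implicit Types (v w x y z : 'rV[R]_n).
Local Notation delta := (signed_dist D).

(** The largest admissible set: all conditions in [collar_at] are local, so the union is admissible
    again. *)
Definition collar := [set x | exists2 W, W x & collar_at alpha r D W].

Lemma collar_atU : collar_at alpha r D collar.
Proof.
split.
- rewrite openE => x [W Wx cW]; have [oW _ _] := cW.
  have nW : nbhs x W by exact: open_nbhs_nbhs.
  by apply: (@filterS _ (nbhs x) _ W _ _ nW) => y Wy; exists W.
- by apply: holderC_local => x [W Wx [_ hW _]]; exists W.
- by move=> x [W Wx [_ _ H]]; exact: H.
Qed.

Lemma open_sublevel (f : 'rV[R]_n -> R) c : (forall x, {for x, continuous f}) ->
  open [set x | f x < c].
Proof.
move=> cf; rewrite openE => x /= fx; have e0 : 0 < c - f x by rewrite subr_gt0.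
have [d d0 dP] := (continuous_normE x f).1 (cf x) _ e0.
apply/nbhs_normE; exists d => // y /dP; rewrite ltr_norml => /andP[_].
by rewrite ltrBrDr subrK.
Qed.

Lemma signed_dist_continuous x : {for x, continuous delta}.
Proof.
apply: lipschitz_continuous; exists (2 * n%:R); split; first by rewrite mulr_ge0.
exists 1 => // y z _ _.
rewrite (le_trans (signed_dist_lipschitz n_gt0 bndD D_neq0 y z)) //.
by rewrite -mulrA ler_wpM2l // enorm_le_norm.
Qed.

Lemma closure_norm_le : exists2 M : R, 0 < M & forall x, closure D x -> `|x| <= M.
Proof.
have [M [_ HM]] := bndD; exists (`|M| + 1 + 1).
  by rewrite ltr_wpDl // addr_ge0.
move=> x /closure_enorm/(_ 1 ltr01)[y Dy xy].
rewrite -[x](subrK y) addrC (le_trans (ler_normD _ _)) // lerD //.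
  by apply: HM Dy; rewrite (le_lt_trans (ler_norm M)) // ltrDl.
exact: le_trans (norm_le_enorm _) (ltW xy).
Qed.

Lemma compact_boundary : compact (boundary D).
Proof.
apply: bounded_closed_compact.
  have [M M0 HM] := closure_norm_le; exists M; split; first exact: num_real.
  by move=> K MK x [cx _]; exact: le_trans (HM x cx) (ltW MK).
rewrite /boundary (interior_id D).1 // setDE; apply: closedI; first exact: closed_closure.
exact: open_closedC.
Qed.

Lemma boundary_neq0 : boundary D !=set0.
Proof.
by have [y [By _ _ _]] := nearest_boundary n_gt0 openD bndD D_neq0 0; exists y.
Qed.

(** Points outside the collar with |delta| <= 1 form a compact set disjoint from bD, so |delta| has
    a positive minimum on it unless it is empty. *)
Lemma tube_radius : boundary D `<=` collar ->
  exists2 c : R, 0 < c & forall x, `|delta x| < c -> collar x.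
Proof.
move=> bG; pose K := ~` collar `&` ~` [set x | 1 < `|delta x|].
have nc x : {for x, continuous (fun y => `|delta y|)}.
  apply/continuous_normE => e e0.
  have [d d0 dP] := (continuous_normE x _).1 (@signed_dist_continuous x) e e0.
  exists d => // y /dP; apply: le_lt_trans; exact: ler_dist_dist.
have cK : compact K.
  have [oG _ _] := collar_atU.
  apply: bounded_closed_compact.
    have [M M0 HM] := closure_norm_le; exists (M + 1); split; first exact: num_real.
    move=> B MB x [_ /= /negP]; rewrite -leNgt => dx.
    have [y [[cy _] xy _ _]] := nearest_boundary n_gt0 openD bndD D_neq0 x.
    rewrite (le_trans _ (ltW MB)) // -[x](subrK y) addrC (le_trans (ler_normD _ _)) //.
    by rewrite lerD ?HM // (le_trans (norm_le_enorm _)) // xy.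
  apply: closedI; apply: open_closedC => //.
  have -> : [set x | 1 < `|delta x|] = [set x | - `|delta x| < -1].
    by apply/seteqP; split=> x /=; rewrite ltrN2.
  apply: open_sublevel => x; exact: (continuousN (@nc x)).
have [K0|/set0P K0] := eqVneq K set0.
  exists 1 => // x dx; apply: contrapT => Gx.
  suff : K x by rewrite K0.
  by split=> //=; apply/negP; rewrite -leNgt ltW.
have [|y yK yP] := EVT_min_rV (f := fun y => `|delta y|) K0 cK.
  by apply: continuous_in_subspaceT => x _; exact: nc.
move: yK; rewrite inE => -[Gy dy].
have dy0 : 0 < `|delta y|.
  rewrite normr_gt0; apply: contra_notN Gy => /eqP/(signed_dist_eq0 n_gt0 openD bndD D_neq0).
  exact: bG.
exists (Num.min 1 `|delta y|) => [|x]; first by rewrite lt_min ltr01.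
rewrite lt_min => /andP[x1 xy]; apply: contrapT => Gx.
have := yP x; rewrite leNgt xy => H; suff : false by []; apply: H.
by rewrite inE; split=> //=; apply/negP; rewrite -leNgt ltW.
Qed.

Lemma qform_le (A : 'M[R]_n) v : `|qform A v| <= (\sum_i \sum_j `|A i j|) * dot v v.
Proof.
rewrite /qform /dot; apply: le_trans (ler_norm_sum _ _ _) _.
apply: le_trans (_ : \sum_j \sum_i `|A i j| * dot v v <= _); last first.
  by rewrite exchange_big /= mulr_suml; apply: ler_sum => i _; rewrite mulr_suml.
apply: ler_sum => j _; rewrite mxE normrM.
apply: le_trans (ler_wpM2r (normr_ge0 _) (ler_norm_sum _ _ _)) _.
rewrite mulr_suml; apply: ler_sum => i _; rewrite normrM mulrAC mulrC ler_wpM2l //.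
rewrite -sqr_enorm expr2 ler_pM // (le_trans (coord_le_norm _ _)) //; exact: norm_le_enorm.
Qed.

Lemma Hess_boundary_bound : boundary D `<=` collar ->
  exists2 M : R, 0 < M & forall y v, boundary D y ->
    `|qform (Hess delta y) v| <= M * dot v v.
Proof.
move=> bG; have [oG hG _] := collar_atU.
pose F x := \sum_i \sum_j `|partial i (partial j delta) x|.
have [|y yb yP] := EVT_max_rV (f := F) boundary_neq0 compact_boundary.
  apply: continuous_in_subspaceT => x; rewrite inE => /bG Gx.
  have h2 : holderC alpha 2 collar delta by exact: (holderC_le alpha01 oG _ hG).
  have cH i j : {for x, continuous (fun z => `|partial i (partial j delta) z|)}.
    have [_ _ h] := h2; have [_ _ h'] := h j; have [c _] := h' i.
    apply/continuous_normE => e e0.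
    have [d d0 dP] := (continuous_normE x _).1 (c x Gx) e e0.
    exists d; first exact: d0.
    by move=> z /dP; apply: le_lt_trans; exact: ler_dist_dist.
  rewrite /F.
  have cS (m : nat) (f : 'I_m -> 'rV[R]_n -> R) :
      (forall i, {for x, continuous (f i)}) ->
      {for x, continuous (fun z => \sum_i f i z)}.
    elim: m f => [|m IH] f cf.
      by apply/continuous_normE => e e0; exists 1 => // z _; rewrite !big_ord0 subrr normr0.
    have -> : (fun z => \sum_(i < m.+1) f i z) =
        (fun z => f ord0 z) + (fun z => \sum_(i < m) f (lift ord0 i) z).
      by apply/funext => z; rewrite big_ord_recl.
    apply: (@continuousD _ _ _ (f ord0) (fun z => \sum_(i < m) f (lift ord0 i) z)).
      exact: cf.
    by apply: IH => i; exact: cf.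
  by apply: (cS _ (fun i z => \sum_j `|partial i (partial j delta) z|)) => i; exact: cS.
(* The maximum [F y] may be 0; the added 1 makes the bound positive. *)
exists (F y + 1) => [|z v bz].
  by rewrite ltr_wpDl // sumr_ge0 // => i _; rewrite sumr_ge0.
apply: le_trans (qform_le _ _) _; rewrite ler_wpM2r ?dot_ge0 //.
have -> : \sum_i \sum_j `|Hess delta z i j| = F z.
  by apply: eq_bigr => i _; apply: eq_bigr => j _; rewrite mxE.
by rewrite (le_trans (yP z _)) ?lerDl // inE.
Qed.

End Tube.

(** * The defining function *)

Section CurvatureEstimate.
Context {R : realType} {n : nat}.
Implicit Types (v w : 'rV[R]_n) (A B : 'M[R]_n).

Lemma dot_mul_trmx A v w : dot (w *m A) v = dot w (v *m A^T).
Proof. by rewrite !dotE trmx_mul trmxK mulmxA. Qed.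

(* With v B = w - t w B for w = v A, symmetry of B gives
   qform A v - qform B v = t (|w|^2 - t qform B w). *)
Lemma qform_comparison A B (t M : R) v : B^T = B -> A - t *: (A *m B) = B ->
  0 <= t -> (forall w, `|qform B w| <= M * dot w w) -> t * M <= 1 / 2 ->
  qform B v + t / 2 * dot (v *m A) (v *m A) <= qform A v.
Proof.
move=> Bsym AB t0 BM tM; set w := v *m A.
have vB : v *m B = w - t *: (w *m B).
  by rewrite -[in LHS]AB mulmxBr -scalemxAr mulmxA.
have E1 : qform B v = dot w v - t * dot (w *m B) v.
  by rewrite /qform vB dotDl dotNl dotZl.
have E2 : dot (w *m B) v = dot w w - t * qform B w.
  by rewrite dot_mul_trmx Bsym vB dotDr dotNr dotZr [dot w (w *m B)]dotC.
have -> : qform A v = dot w v by [].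
have q0 : t * qform B w <= 1 / 2 * dot w w.
  apply: le_trans (ler_wpM2l t0 (le_trans (ler_norm _) (BM w))) _.
  by rewrite mulrA ler_wpM2r ?dot_ge0.
rewrite E1 E2; move: q0; move: (t * qform B w) (dot w w) (dot w v) => a b c ab.
have -> : t / 2 * b = t * (1 / 2 * b) by field.
have : t * a <= t * (1 / 2 * b) by rewrite ler_wpM2l.
have -> : t * (b - a) = t * b - t * a by ring.
have -> : t * b = t * (1 / 2 * b) + t * (1 / 2 * b) by field.
by lra.
Qed.

Variables (alpha : R) (r p : nat) (D : set 'rV[R]_n) (nu : 'rV[R]_n -> n.-1.-tuple R).
Variable M : R.
Hypotheses (alpha01 : 0 < alpha <= 1) (p_gt0 : (0 < p)%N) (pn : (p <= n.-1)%N).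
Local Notation delta := (signed_dist D).
Local Notation G := (collar alpha r D).
Hypothesis bG : boundary D `<=` G.
Hypothesis nuP : forall x, boundary D x -> principal_curvatures D x (nu x).
Hypothesis nu_ge0 : forall x, boundary D x -> 0 <= \sum_(i < p) (nu x)`_i.
Hypothesis HM : forall y v, boundary D y -> `|qform (Hess delta y) v| <= M * dot v v.
Variables (x : 'rV[R]_n) (kappa : R) (e : 'I_p -> 'rV[R]_n).
Hypotheses (Gx : G x) (dx0 : delta x <= 0) (dxM : - delta x * M <= 1 / 2).
Hypotheses (kM : M < kappa) (e_on : orthonormal e).

Let T := \sum_i qform (Hess delta x) (e i) + kappa * \sum_i dot (e i) (grad delta x) ^+ 2.

(** With t = - delta x, [T] is at least the sum of nu_1 + ... + nu_p, t/2 times the sum of |e_i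
    H_x|^2, and (kappa - M) times the sum of (e_i . g)^2, all nonnegative. If T = 0 and t > 0, the
    e_i are tangent and annihilated by H_x, hence by H_y = H_x + delta(x) H_x H_y, and
    [flat_of_kernel] applies. *)
Lemma curvature_trace :
  0 <= T /\ (delta x < 0 -> ~ (exists y, boundary D y /\
    forall i, (i < p)%N -> (nu y)`_i = 0) -> 0 < T).
Proof.
have [oG hG GP] := @collar_atU R n alpha r D.
have [_ _ [y [by_ gy Hxy]]] := GP x Gx.
have Gy := bG by_; have [gy1 Hg _] := GP y Gy.
have h2 : holderC alpha 2 G delta by exact: (holderC_le alpha01 oG _ hG).
have Hsym : (Hess delta y)^T = Hess delta y.
  by apply/matrixP => i j; rewrite !mxE; exact: partialC oG Gy h2.
have [nu_s nu_c] := nuP by_.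
have [f [f1 fH pars Hdiag]] := principal_frame Hsym Hg gy1 nu_c (size_tuple _).
have tM := dxM; set t := - delta x in tM; have t0 : 0 <= t by rewrite oppr_ge0.
have cmp v := @qform_comparison _ _ t M v Hsym
  (_ : Hess delta x - t *: (Hess delta x *m Hess delta y) = Hess delta y)
  t0 (fun w => HM w by_) tM.
have {}cmp v : qform (Hess delta y) v + t / 2 * dot (v *m Hess delta x) (v *m Hess delta x)
    <= qform (Hess delta x) v by apply: cmp; rewrite -[RHS]Hxy /t scaleNr opprK.
pose S := \sum_i dot (e i *m Hess delta x) (e i *m Hess delta x).
pose W := \sum_i dot (e i) (grad delta y) ^+ 2.
have S0 : 0 <= S by apply: sumr_ge0 => i _; exact: dot_ge0.
have W0 : 0 <= W by apply: sumr_ge0 => i _; exact: sqr_ge0.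
(* The p-th curvature is the value of the form at the p-th principal direction, whose index is p -
   1. *)
have nuM : (nu y)`_p.-1 <= M.
  have pi : (p.-1 < n.-1)%N by rewrite prednK.
  have := HM (f (Ordinal pi)) by_; rewrite f1 mulr1 /qform fH dotZl f1 mulr1.
  exact: le_trans (ler_norm _).
have KF := ky_fan nu_s (size_tuple (nu y)) p_gt0 pn f1 pars e_on nuM.
have TY : \sum_i qform (Hess delta y) (e i) =
    \sum_(j < n.-1) (nu y)`_j * \sum_i dot (e i) (f j) ^+ 2.
  rewrite (eq_bigr _ (fun i _ => Hdiag (e i))) exchange_big.
  by apply: eq_bigr => j _; rewrite mulr_sumr.
have low : \sum_(i < p) (nu y)`_i + t / 2 * S + (kappa - M) * W <= T.
  have arith (a b c u k l w : R) : a <= b + k * w -> b + c <= u ->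
    a + c + (l - k) * w <= u + l * w by lra.
  rewrite /T -gy -/W; apply: (arith _ (\sum_i qform (Hess delta y) (e i)) (t / 2 * S)).
    by rewrite TY; exact: KF.
  by rewrite mulr_sumr -big_split; apply: ler_sum => i _; exact: cmp.
have nu0 := nu_ge0 by_.
have tS : 0 <= t / 2 * S := mulr_ge0 (divr_ge0 t0 (ler0n _ _)) S0.
have kM0 : 0 < kappa - M by rewrite subr_gt0.
have kW : 0 <= (kappa - M) * W := mulr_ge0 (ltW kM0) W0.
have T0 : 0 <= T by apply: le_trans low; rewrite !addr_ge0.
split; first exact: T0.
move=> dx nflat; rewrite lt_neqAle; apply/andP; split; last exact: T0.
apply: contra_notN nflat => /eqP TE; rewrite -TE in low.
have sum0 (a b c : R) : 0 <= a -> 0 <= b -> 0 <= c -> a + b + c <= 0 -> b = 0 /\ c = 0.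
  by move=> a0 b0 c0 abc; split; lra.
have [S0E W0E] := sum0 _ _ _ nu0 tS kW low.
have tt : 0 < t by rewrite oppr_gt0.
have SE : S = 0.
  exact: mulfI (lt0r_neq0 (divr_gt0 tt (ltr0n _ 2))) _ _ (etrans S0E (esym (mulr0 _))).
have WE : W = 0 := mulfI (lt0r_neq0 kM0) (etrans W0E (esym (mulr0 _))).
have eHx i : e i *m Hess delta x = 0.
  apply/eqP; rewrite -dot_eq0; move/eqP: SE; rewrite psumr_eq0 => [|j _]; last exact: dot_ge0.
  by move/allP/(_ i); rewrite mem_index_enum => /(_ isT).
have eHy i : e i *m Hess delta y = 0.
  by rewrite -Hxy mulmxDr -scalemxAr mulmxA eHx mul0mx scaler0 addr0.
have eg i : dot (e i) (grad delta y) = 0.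
  apply/eqP; rewrite -sqrf_eq0; move/eqP: WE; rewrite psumr_eq0 => [|j _]; last exact: sqr_ge0.
  by move/allP/(_ i); rewrite mem_index_enum => /(_ isT).
exists y; split; first exact: by_.
apply: (flat_of_kernel nu_s (size_tuple (nu y)) pn f1 pars e_on eg _ nu0).
move=> i j nuj; apply: (mulfI nuj).
by rewrite mulr0 -dotZr -fH dotC dot_mul_trmx Hsym eHy dotC dot0l.
Qed.

End CurvatureEstimate.

(** * Gluing the collar function to a strictly convex quadratic *)

Section DefiningFunction.
Context {R : realType} {n : nat}.
Variables (alpha : R) (r p : nat) (D : set 'rV[R]_n) (nu : 'rV[R]_n -> n.-1.-tuple R).
Hypotheses (alpha01 : 0 < alpha <= 1) (p_gt0 : (0 < p)%N) (pn : (p <= n.-1)%N).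
Hypotheses (n_gt0 : (0 < n)%N) (openD : open D).
Hypotheses (bndD : bounded_set D) (D_neq0 : D !=set0).
Local Notation delta := (signed_dist D).
Local Notation G := (collar alpha r D).
Hypothesis bG : boundary D `<=` G.
Hypothesis nuP : forall x, boundary D x -> principal_curvatures D x (nu x).
Hypothesis nu_ge0 : forall x, boundary D x -> 0 <= \sum_(i < p) (nu x)`_i.
Implicit Types (x y z v w : 'rV[R]_n).

Variables (M c0 c B : R).
Hypothesis M0 : 0 < M.
Hypothesis HM : forall y v, boundary D y -> `|qform (Hess delta y) v| <= M * dot v v.
Hypothesis tube : forall x, `|delta x| < c0 -> G x.
Hypotheses (c_gt0 : 0 < c) (cc0 : c < c0) (cM : c * M <= 1 / 2).
Hypotheses (B0 : 0 < B) (HB : forall x, closure D x -> dot x x < B).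

(** Equals 1 on bD and 0 at depth c, and is negative deeper inside. *)
Let sigma x := c^-1 * delta x + 1.
(** The boundary has order r + 2 in this section, so r + 3 is the least exponent allowed by
    [holderC_maxX]. *)
Let s x := Num.max (sigma x) 0 ^+ r.+3 + -1.
(** Makes eps |x|^2 < 1/4 where |x|^2 < B, which keeps t in [-3/4, -1/2). *)
Let eps := (4 * B)^-1.
Let t x := eps * dot x x + - (3 / 4).
Let u x := t x + -1 * s x.
Let rho x := s x + r.+3%:R^-1 * Num.max (u x) 0 ^+ r.+3.
Let U := [set x | delta x < c] `&` [set x | dot x x < B].

Let delta_continuous x : {for x, continuous delta}.
Proof. exact: signed_dist_continuous. Qed.

Let sqnorm_continuous x : {for x, continuous (fun y : 'rV[R]_n => dot y y)}.
Proof.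
have := @sqnorm_holder R n alpha alpha01 0 setT openT.
by move/holderC_continuous => /(_ x I).
Qed.

Let openU : open U.
Proof. by apply: openI; apply: open_sublevel. Qed.

Let closureU : closure D `<=` U.
Proof.
move=> x cx; split; last exact: HB.
have [Dx|Dx] := pselect (D x).
  by rewrite /= (lt_trans _ c_gt0) //; apply/(signed_dist_lt0 n_gt0 openD bndD).
have /(signed_dist_eq0 n_gt0 openD bndD D_neq0) : boundary D x by apply/(boundaryE openD).
by rewrite /= => ->.
Qed.

Let sigma_ge1 x : ~ D x -> 1 <= sigma x.
Proof.
move=> Dx; rewrite /sigma lerDr mulr_ge0 ?invr_ge0 ?(ltW c_gt0) //.
by rewrite leNgt; apply/negP => /(signed_dist_lt0 n_gt0 openD bndD).
Qed.

Let sigma_lt1 x : D x -> sigma x < 1.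
Proof.
move=> /(signed_dist_lt0 n_gt0 openD bndD) dx.
by rewrite /sigma gtrDr pmulr_rlt0 // invr_gt0.
Qed.

Let sigma_gt0 x : (0 < sigma x) = (- c < delta x).
Proof.
by rewrite /sigma -ltrBlDr sub0r mulrC ltr_pdivlMr // mulN1r.
Qed.

Let sigma_lt0 x : (sigma x < 0) = (delta x < - c).
Proof.
by rewrite /sigma -ltrBrDr sub0r mulrC ltr_pdivrMr // mulN1r.
Qed.

Let s_geN1 x : -1 <= s x.
Proof. by rewrite /s lerDr exprn_ge0 // le_max lexx orbT. Qed.

Let s_ge0 x : ~ D x -> 0 <= s x.
Proof.
move=> /sigma_ge1 sx; rewrite /s subr_ge0 exprn_ege1 // le_max sx //.
Qed.

Let s_lt0 x : D x -> s x < 0.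
Proof.
move=> /sigma_lt1 sx; rewrite /s subr_lt0 exprn_ilt1 // ?le_max ?lexx ?orbT //.
by rewrite gt_max sx ltr01.
Qed.

Let t_bound x : dot x x < B -> - (3 / 4) <= t x < - (1 / 2).
Proof.
move=> xB; have e0 : 0 < 4 * B by rewrite mulr_gt0.
have : 0 <= eps * dot x x by rewrite mulr_ge0 ?dot_ge0 // invr_ge0 ltW.
have : eps * dot x x < 1 / 4.
  by rewrite /eps mulrC ltr_pdivrMr // mulrA mul1r mulVf ?mul1r.
by rewrite /t; move: (eps * _) => q *; apply/andP; split; lra.
Qed.

(** The strict inequality c < c0 lets the two open sets overlap: s is regular on the collar and
    constant on the deep part, so it is regular on all of U. *)
Let near_or_deep x : U x -> G x \/ sigma x < 0.
Proof.
move=> [/= dc _]; have [dx|dx] := ltP (- c0) (delta x).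
  by left; apply: tube; rewrite ltr_norml dx (lt_trans dc).
right; rewrite sigma_lt0.
by apply: le_lt_trans dx _; rewrite ltrN2.
Qed.

Let open_deep : open [set x | sigma x < 0].
Proof.
have -> : [set x | sigma x < 0] = [set x | delta x < - c].
  by apply/seteqP; split=> x /=; rewrite sigma_lt0.
exact: open_sublevel.
Qed.

Let s_deep x : sigma x < 0 -> s x = -1.
Proof. by move=> sx; rewrite /s max_r ?(ltW sx) // expr0n add0r. Qed.

Let h2 V (f : 'rV[R]_n -> R) : open V -> holderC alpha r.+2 V f -> holderC alpha 2 V f.
Proof. by move=> oV; exact: (holderC_le alpha01 oV). Qed.

Let first_derivable V (f : 'rV[R]_n -> R) x i : holderC alpha r.+2 V f -> V x ->
  derivable f x (delta_mx 0 i).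
Proof. by case=> _ d _ Vx; exact: d. Qed.

Let openG : open G. Proof. by have [] := @collar_atU R n alpha r D. Qed.

Let delta_holder : holderC alpha r.+2 G delta.
Proof. by have [] := @collar_atU R n alpha r D. Qed.

Let cst_holder (V : set 'rV[R]_n) (k : R) : open V -> holderC alpha r.+2 V (fun=> k).
Proof. exact: holderC_cst. Qed.

Let sigma_holder : holderC alpha r.+2 G sigma.
Proof.
exact: (holderCD openG (holderCZ alpha01 c^-1 openG delta_holder) (cst_holder 1 openG)).
Qed.

Let sigma_max_holder : holderC alpha r.+2 G (fun y => Num.max (sigma y) 0 ^+ r.+3).
Proof. exact: (holderC_maxX alpha01 openG (ltnSn _) sigma_holder). Qed.

Let s_holder : holderC alpha r.+2 U s.
Proof.
apply: holderC_local => x /near_or_deep[Gx|sx].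
  exists G; first exact: Gx.
  exact: (holderCD openG sigma_max_holder (cst_holder (-1) openG)).
exists [set y | sigma y < 0]; first exact: sx.
apply: (eq_holderC open_deep _ (cst_holder (-1) open_deep)) => y.
by rewrite inE => /s_deep ->.
Qed.

Let sqnorm_scaled_holder : holderC alpha r.+2 U (fun y => eps * dot y y).
Proof. exact: (holderCZ alpha01 eps openU (sqnorm_holder alpha01 _ openU)). Qed.

Let t_holder : holderC alpha r.+2 U t.
Proof. exact: (holderCD openU sqnorm_scaled_holder (cst_holder _ openU)). Qed.

Let s_opp_holder : holderC alpha r.+2 U (fun y => -1 * s y).
Proof. exact: (holderCZ alpha01 (-1) openU s_holder). Qed.

Let u_holder : holderC alpha r.+2 U u.
Proof. exact: (holderCD openU t_holder s_opp_holder). Qed.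

Let u_max_holder : holderC alpha r.+2 U (fun y => Num.max (u y) 0 ^+ r.+3).
Proof. exact: (holderC_maxX alpha01 openU (ltnSn _) u_holder). Qed.

Let u_max_scaled_holder :
  holderC alpha r.+2 U (fun y => r.+3%:R^-1 * Num.max (u y) 0 ^+ r.+3).
Proof. exact: (holderCZ alpha01 _ openU u_max_holder). Qed.

Let rho_holder : holderC alpha r.+2 U rho.
Proof. exact: (holderCD openU s_holder u_max_scaled_holder). Qed.

Let grad_sigma x : G x -> grad sigma x = c^-1 *: grad delta x.
Proof.
move=> Gx; have dd i := @first_derivable _ _ _ i delta_holder Gx.
have dz i := @first_derivable _ _ _ i (holderCZ alpha01 c^-1 openG delta_holder) Gx.
have dc i := @first_derivable _ _ _ i (cst_holder 1 openG) Gx.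
by apply: (etrans (gradD dz dc)); rewrite (gradZ _ dd) grad_cst addr0.
Qed.

Let Hess_sigma x : G x -> Hess sigma x = c^-1 *: Hess delta x.
Proof.
move=> Gx; have hz := h2 openG (holderCZ alpha01 c^-1 openG delta_holder).
apply: (etrans (HessD openG Gx hz (h2 openG (cst_holder 1 openG)))).
by rewrite (HessZ _ openG Gx (h2 openG delta_holder)) Hess_cst addr0.
Qed.

Let rho_s x : u x <= 0 -> rho x = s x.
Proof. by move=> ux; rewrite /rho max_r // expr0n mulr0 addr0. Qed.

Let u_lt0 x : U x -> ~ D x -> u x < 0.
Proof.
move=> [_ /= /t_bound/andP[_ tx]] /s_ge0 sx; rewrite /u; lra.
Qed.

Let u_le_half x : U x -> u x <= 1 / 2.
Proof.
move=> [_ /= /t_bound/andP[_ tx]]; have := s_geN1 x; rewrite /u; lra.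
Qed.

(** Outside D, u < 0 and rho = s >= 0. Inside, where u > 0, the bound u <= 1/2 gives u^m / m <= u
    with m = r + 3, so rho <= s + u = t < 0. *)
Let rho_lt0 x : U x -> (rho x < 0) <-> D x.
Proof.
move=> Ux; split=> [|Dx].
  move=> rx; apply: contrapT => Dx; move: rx; rewrite rho_s ?(ltW (u_lt0 _ _)) //.
  by rewrite ltNge s_ge0.
have [ux|ux] := leP (u x) 0; first by rewrite rho_s // s_lt0.
have [_ /= /t_bound/andP[_ tx]] := Ux.
have uh := u_le_half Ux.
have : r.+3%:R^-1 * Num.max (u x) 0 ^+ r.+3 <= u x.
  rewrite max_l ?(ltW ux) //; apply: le_trans (_ : u x ^+ r.+3 <= _).
    by rewrite ler_piMl ?exprn_ge0 ?(ltW ux) // invf_le1 ?ler1n ?ltr0n.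
  rewrite -[leRHS]expr1 ler_wiXn2l ?(ltW ux) // (le_trans uh) //; lra.
rewrite /rho; move: (_ * Num.max _ _ ^+ _) => q; rewrite /u; lra.
Qed.

Let rho_eq0 x : U x -> (rho x = 0) <-> boundary D x.
Proof.
move=> Ux; split=> [rx|/[dup] bx /(boundaryE openD)[_ Dx]].
  have Dx : ~ D x by move=> /(rho_lt0 Ux); rewrite rx ltxx.
  apply/(signed_dist_eq0 n_gt0 openD bndD D_neq0).
  move: rx; rewrite rho_s ?(ltW (u_lt0 _ _)) // /s => /eqP; rewrite subr_eq0.
  have s1 := sigma_ge1 Dx.
  rewrite max_l ?(le_trans ler01) // pexpr_eq1 ?(le_trans ler01) //.
  by rewrite /sigma -subr_eq0 addrK mulf_eq0 invr_eq0 (gt_eqF c_gt0) => /eqP.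
have /(signed_dist_eq0 n_gt0 openD bndD D_neq0) dx := bx.
rewrite rho_s ?(ltW (u_lt0 _ _)) // /s /sigma dx mulr0 add0r.
by rewrite max_l ?expr1n ?subrr.
Qed.

Let rho_grad x : boundary D x -> grad rho x != 0.
Proof.
move=> bx; have [_ _ GP] := @collar_atU R n alpha r D.
have Gx := bG bx; have [g1 _ _] := GP x Gx.
have /(boundaryE openD)[cx Dx] := bx; have Ux := closureU cx.
have /(signed_dist_eq0 n_gt0 openD bndD D_neq0) dx := bx.
have ds i := @first_derivable _ _ _ i s_holder Ux.
have du i := @first_derivable _ _ _ i u_holder Ux.
have dm i := @first_derivable _ _ _ i u_max_holder Ux.
have dmz i := @first_derivable _ _ _ i u_max_scaled_holder Ux.
have dg i := @first_derivable _ _ _ i sigma_holder Gx.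
have dgm i := @first_derivable _ _ _ i sigma_max_holder Gx.
have dc i := @first_derivable _ _ _ i (cst_holder (-1) openG) Gx.
have gs : grad s x = (r.+3%:R * c^-1) *: grad delta x.
  apply: (etrans (gradD dgm dc)); rewrite grad_cst addr0 (grad_maxX _ dg) grad_sigma //.
  by rewrite /sigma dx mulr0 add0r max_l // expr1n mulr1 scalerA.
have -> : grad rho x = grad s x.
  apply: (etrans (gradD ds dmz)); rewrite (gradZ _ dm) (grad_maxX _ du).
  by rewrite max_r ?(ltW (u_lt0 _ _)) // expr0n mulr0 scale0r scaler0 addr0.
rewrite gs scaler_eq0 mulf_eq0 invr_eq0 pnatr_eq0 (gt_eqF c_gt0) /=.
by apply: contra_eq_neq g1 => ->; rewrite dot0l eq_sym oner_neq0.
Qed.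

Lemma rho_defining : holder_defining_function r.+2 alpha D rho.
Proof.
exists U; split.
- by split.
- exact/holder_classP.
- apply/seteqP; split=> [x Dx|x [/= rx Ux]]; last exact/(rho_lt0 Ux).
  have Ux : U x by exact/closureU/subset_closure.
  by split=> //=; apply/(rho_lt0 Ux).
- apply/seteqP; split=> [x bx|x [/= rx Ux]]; last exact/(rho_eq0 Ux).
  have Ux : U x by apply: closureU; case: bx.
  by split=> //=; apply/(rho_eq0 Ux).
- exact: rho_grad.
Qed.

Section Trace.
Variables (x : 'rV[R]_n) (e : 'I_p -> 'rV[R]_n).
Hypotheses (cx : closure D x) (e_on : orthonormal e).

Let dx0 : delta x <= 0.
Proof.
have [Dx|Dx] := pselect (D x).
  by rewrite ltW //; apply/(signed_dist_lt0 n_gt0 openD bndD).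
have /(signed_dist_eq0 n_gt0 openD bndD D_neq0) -> // : boundary D x.
exact/(boundaryE openD).
Qed.

Let Ux : U x. Proof. exact: closureU. Qed.

Let T := \sum_i qform (Hess s x) (e i).

Let Hess_s : G x -> Hess s x =
  (c^-1 * (r.+3%:R * Num.max (sigma x) 0 ^+ r.+2)) *: Hess delta x +
  (c^-1 ^+ 2 * (r.+3%:R * r.+2%:R * Num.max (sigma x) 0 ^+ r.+1)) *:
    ((grad delta x)^T *m grad delta x).
Proof.
move=> Gx; apply: (etrans (HessD openG Gx (h2 openG sigma_max_holder)
  (h2 openG (cst_holder (-1) openG)))).
rewrite Hess_cst addr0 (Hess_maxX _ openG Gx (h2 openG sigma_holder)).
rewrite (Hess_sigma Gx) (grad_sigma Gx).
rewrite scalerA [X in X *: _ + _]mulrC; congr (_ + _).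
rewrite [(_ *: _)^T]linearZ /= -scalemxAl -scalemxAr !scalerA; congr (_ *: _).
by rewrite expr2; ring.
Qed.

Let T_ge0 : 0 <= T /\ (0 < sigma x -> D x -> ~ (exists y, boundary D y /\
    forall i, (i < p)%N -> (nu y)`_i = 0) -> 0 < T).
Proof.
have [Gx|sx] := near_or_deep Ux; last first.
  have -> : T = 0.
    rewrite /T big1 // => i _; rewrite (eq_Hess (g := fun=> -1) open_deep sx).
      by rewrite Hess_cst /qform mulmx0 dot0l.
    by move=> y; rewrite inE => /s_deep.
  by split=> // sx'; have := lt_trans sx sx'; rewrite ltxx.
(* Common factor of both terms of Hess s, with m = r + 3: there remains sigma Hess delta + ((m -
   1)/c) g^T g. Since sigma <= 1 <= m - 1, its trace is at least that of sigma (Hess delta + c^-1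
   g^T g), which is [curvature_trace] with kappa = 1/c. *)
pose k := r.+3%:R * Num.max (sigma x) 0 ^+ r.+1 / c : R.
have TE : T = k * (Num.max (sigma x) 0 * \sum_i qform (Hess delta x) (e i) +
    r.+2%:R / c * \sum_i dot (e i) (grad delta x) ^+ 2).
  rewrite /T mulrDr [_ * (_ * \sum_i _)]mulrA [k * (_ / c * _)]mulrA !mulr_sumr -big_split.
  apply: eq_bigr => i _; rewrite (Hess_s Gx) qformD !qformZ qform_rank1 /k exprS.
  congr (_ * _ + _ * _); first by ring.
  by rewrite expr2; ring.
have [sx|sx] := leP (sigma x) 0.
  have -> : T = 0 by rewrite TE /k max_r // expr0n mulr0 !mul0r.
  by [].
have k0 : 0 < k by rewrite /k max_l ?(ltW sx) // divr_gt0 // mulr_gt0 // ?exprn_gt0 ?ltr0n.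
have dxM : - delta x * M <= 1 / 2.
  apply: le_trans cM; rewrite ler_wpM2r ?(ltW M0) //.
  by rewrite lerNl ltW // -sigma_gt0.
have s1 : sigma x <= 1.
  by rewrite /sigma gerDr pmulr_rle0 // invr_gt0.
have kM : M < c^-1.
  by rewrite -[ltRHS]mul1r ltr_pdivlMr // mulrC (le_lt_trans cM) //; lra.
have [C1 C2] := curvature_trace alpha01 p_gt0 pn bG nuP nu_ge0 HM Gx dx0 dxM kM e_on.
set W := \sum_i dot (e i) (grad delta x) ^+ 2 in TE C1 C2.
have W0 : 0 <= W by apply: sumr_ge0 => i _; exact: sqr_ge0.
have low : k * (sigma x * (\sum_i qform (Hess delta x) (e i) + c^-1 * W)) <= T.
  rewrite TE ler_pM2l // max_l ?(ltW sx) // mulrDr lerD2l mulrA ler_wpM2r //.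
  rewrite ler_wpM2r ?invr_ge0 ?(ltW c_gt0) // (le_trans s1) // ler1n //.
split; first exact: le_trans (mulr_ge0 (ltW k0) (mulr_ge0 (ltW sx) C1)) low.
move=> _ Dx nf; apply: lt_le_trans low; apply: mulr_gt0 k0 (mulr_gt0 sx _).
by apply: C2 nf; apply/(signed_dist_lt0 n_gt0 openD bndD).
Qed.

Let P := Num.max (u x) 0 ^+ r.+2.

Let P_bound : 0 <= P <= 1 / 2.
Proof.
have m0 : 0 <= Num.max (u x) 0 by rewrite le_max lexx orbT.
have m1 : Num.max (u x) 0 <= 1 / 2 by rewrite ge_max (u_le_half Ux) /=; lra.
rewrite /P exprn_ge0 //=; apply: (le_trans _ m1).
by rewrite -[leRHS]expr1 ler_wiXn2l // (le_trans m1) //; lra.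
Qed.

(** The term with the square of the gradient of u is nonnegative and dropped; Hess t is 2 eps times
    the identity and contributes 2 eps p. *)
Let trace_low : (1 - P) * T + P * (eps * 2 * p%:R) <= \sum_i qform (Hess rho x) (e i).
Proof.
have Ht : Hess t x = (eps * 2)%:M.
  apply: (etrans (HessD openU Ux (h2 openU sqnorm_scaled_holder)
    (h2 openU (cst_holder _ openU)))).
  rewrite Hess_cst addr0 (HessZ _ openU Ux (sqnorm_holder alpha01 2 openU)).
  by rewrite Hess_sqnorm scale_scalar_mx.
have Hu : Hess u x = (eps * 2)%:M + -1 *: Hess s x.
  rewrite -Ht -(HessZ (-1) openU Ux (h2 openU s_holder)).
  exact: (HessD openU Ux (h2 openU t_holder) (h2 openU s_opp_holder)).
have Hr : Hess rho x = Hess s x + r.+3%:R^-1 *: Hess (fun y => Num.max (u y) 0 ^+ r.+3) x.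
  rewrite -(HessZ _ openU Ux (h2 openU u_max_holder)).
  exact: (HessD openU Ux (h2 openU s_holder) (h2 openU u_max_scaled_holder)).
have e1 i : dot (e i) (e i) = 1 by rewrite e_on eqxx.
have -> : (1 - P) * T + P * (eps * 2 * p%:R) =
    \sum_i ((1 - P) * qform (Hess s x) (e i) + P * (eps * 2)).
  rewrite big_split /= -mulr_sumr sumr_const card_ord -[X in _ = _ + X]mulr_natr.
  by rewrite !mulrA.
apply: ler_sum => i _; rewrite Hr qformD qformZ (Hess_maxX _ openU Ux (h2 openU u_holder)).
rewrite qformD !qformZ Hu qformD qformZ qform_rank1 -/P.
have -> : qform (eps * 2)%:M (e i) = eps * 2 by rewrite /qform mul_mx_scalar dotZl e1 mulr1.
have m0 : 0 <= Num.max (u x) 0 ^+ r.+1 by rewrite exprn_ge0 // le_max lexx orbT.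
have q0 : 0 <= dot (e i) (grad u x) ^+ 2 by exact: sqr_ge0.
move: (qform (Hess s x) (e i)) (dot (e i) (grad u x) ^+ 2) q0 (Num.max _ 0 ^+ r.+1) m0.
move=> a q q0 m m0; have r0 : r.+3%:R != 0 :> R by rewrite pnatr_eq0.
rewrite -[_ * P * _]mulrA -[_ * _ * m * q]mulrA -[_ * _ * (m * q)]mulrA -mulrDr mulKf //.
have : 0 <= r.+2%:R * (m * q) by rewrite !mulr_ge0.
by move: (r.+2%:R * (m * q)) P (eps * 2) => z P' z' z0; lra.
Qed.

Lemma rho_trace_ge0 : 0 <= \sum_i qform (Hess rho x) (e i).
Proof.
case/andP: P_bound => P0 P1; have [T0 _] := T_ge0.
apply: le_trans trace_low; rewrite addr_ge0 // mulr_ge0 //; first by lra.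
by rewrite !mulr_ge0 // invr_ge0 mulr_ge0 // ltW.
Qed.

(** Where u > 0 the quadratic t contributes a positive amount. Where u <= 0 one has sigma > 0, for
    otherwise s = -1 and u = t + 1 >= 1/4; then the trace of Hess s is positive. *)
Lemma rho_trace_gt0 : D x -> ~ (exists y, boundary D y /\
    forall i, (i < p)%N -> (nu y)`_i = 0) -> 0 < \sum_i qform (Hess rho x) (e i).
Proof.
move=> Dx nf; case/andP: P_bound => P0 P1; have [T0 T1] := T_ge0.
have e0 : 0 < eps * 2 * p%:R.
  by rewrite !mulr_gt0 ?ltr0n // invr_gt0 mulr_gt0.
apply: lt_le_trans trace_low; have [ux|ux] := leP (u x) 0; last first.
  have P_gt0 : 0 < P by rewrite /P exprn_gt0 // lt_max ux.
  apply: ltr_wpDl (mulr_gt0 P_gt0 e0); apply: mulr_ge0 T0.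
  by rewrite subr_ge0 (le_trans P1) //; lra.
have -> : P = 0 by rewrite /P max_r // expr0n.
rewrite subr0 mul1r mul0r addr0; apply: T1 => //.
rewrite ltNge; apply/negP => sx.
have [_ /= /t_bound/andP[tx _]] := Ux.
move: ux; rewrite /u /s (max_r sx) expr0n /= add0r; lra.
Qed.

End Trace.

Lemma exists_defining_function : exists f : 'rV[R]_n -> R,
  [/\ holder_defining_function r.+2 alpha D f,
      forall x (e : 'I_p -> 'rV[R]_n), closure D x -> orthonormal e ->
        0 <= \sum_i qform (Hess f x) (e i) &
      ~ (exists y, boundary D y /\ forall i, (i < p)%N -> (nu y)`_i = 0) ->
      forall x (e : 'I_p -> 'rV[R]_n), D x -> orthonormal e ->
        0 < \sum_i qform (Hess f x) (e i)].
Proof.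
exists rho; split; first exact: rho_defining.
  by move=> x e; exact: rho_trace_ge0.
by move=> nf x e Dx e_on; apply: rho_trace_gt0 nf => //; exact: subset_closure.
Qed.

End DefiningFunction.

(** * From orthonormal families to p-planes, and choice of constants *)

Lemma trace_on_orthonormal (R : realType) n p (L : {vspace 'rV[R]_n}) : \dim L = p ->
  exists2 e : 'I_p -> 'rV[R]_n, orthonormal e &
    forall A, trace_on L A = \sum_i qform A (e i).
Proof.
move=> <-; have onb := onb_of_spec L.
exists (tnth (onb_of L)); first by have /orthonormal_basisP[] := onb.
by move=> A; rewrite (trace_onE _ onb).
Qed.

Lemma holder_defining_function_set0 (R : realType) n r (alpha : R) :
  holder_defining_function r alpha (set0 : set 'rV[R]_n) (fun=> 0).
Proof.
have b0 : boundary (set0 : set 'rV[R]_n) = set0.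
  by rewrite /boundary closure0 set0D.
exists set0; rewrite b0 closure0 !setI0; split=> //; first by split=> //; exact: open0.
by split=> // s _ x.
Qed.

Theorem theorem1p1 (R : realType) (n p r : nat) (alpha : R)
    (D : set 'rV[R]_n) (nu : 'rV[R]_n -> n.-1.-tuple R) :
  (3 <= n)%N -> (2 <= p <= n.-1)%N -> (2 <= r)%N -> 0 < alpha <= 1 ->
  open D -> connected D -> bounded_set D -> holder_boundary r alpha D ->
  (forall x, boundary D x -> principal_curvatures D x (nu x)) ->
  (forall x, boundary D x -> 0 <= \sum_(i < p) (nu x)`_i) ->
  (exists rho : 'rV[R]_n -> R,
     holder_defining_function r alpha D rho /\
     (forall x (L : {vspace 'rV[R]_n}), closure D x -> \dim L = p ->
        0 <= trace_on L (Hess rho x))) /\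
  (~ (exists x, boundary D x /\ forall i, (i < p)%N -> (nu x)`_i = 0) ->
   exists rho : 'rV[R]_n -> R,
     [/\ holder_defining_function r alpha D rho,
         forall x (L : {vspace 'rV[R]_n}), closure D x -> \dim L = p ->
           0 <= trace_on L (Hess rho x) &
         forall x (L : {vspace 'rV[R]_n}), D x -> \dim L = p ->
           0 < trace_on L (Hess rho x)]).
Proof.
case: r => [//|[//|r]] n3 /andP[p2 pn] _ a01 oD _ bD hD nuP nu0.
(* One function serves both assertions, as its construction does not depend on the absence of flat
   boundary points. *)
suff [f [fD f0 fp]] : exists f : 'rV[R]_n -> R,
    [/\ holder_defining_function r.+2 alpha D f,
        forall x (L : {vspace 'rV[R]_n}), closure D x -> \dim L = p ->
          0 <= trace_on L (Hess f x) &
        ~ (exists x, boundary D x /\ forall i, (i < p)%N -> (nu x)`_i = 0) ->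
        forall x (L : {vspace 'rV[R]_n}), D x -> \dim L = p ->
          0 < trace_on L (Hess f x)].
  split; first by exists f.
  by move=> nf; exists f; split=> //; exact: fp.
(* An empty D has no nearest boundary points; there the empty neighbourhood makes a constant a
   defining function. *)
have [DE|/set0P D0] := eqVneq D set0.
  exists (fun=> 0); rewrite DE; split; first exact: holder_defining_function_set0.
    by move=> x L; rewrite closure0.
  by move=> _ x L.
have n0 : (0 < n)%N by exact: leq_trans n3.
have p0 : (0 < p)%N by exact: leq_trans p2.
have bG : boundary D `<=` collar alpha r D.
  move=> x bx; have [U [phi [[oU Ux] /holder_classP hphi DU bDU gphi]]] := hD x bx.
  exact: (exists_collar a01 n0 oD bD D0 oU Ux hphi DU bDU gphi bx).
have [M M0 HM] := Hess_boundary_bound a01 n0 oD bD D0 bG.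
have [c0 c00 tube] := tube_radius n0 oD bD D0 bG.
have [N N0 HN] := closure_norm_le bD.
(* Half the tube radius leaves the overlap c < c0; the other bound gives c M <= 1/2, needed both for
   the comparison of Hessians at depth up to c and for M < 1/c. *)
pose c := Num.min (c0 / 2) (1 / (2 * M)).
have c_gt0 : 0 < c by rewrite lt_min !divr_gt0 // mulr_gt0.
have cc0 : c < c0 by rewrite gt_min ltr_pdivrMr // ltr_pMr // ltr1n.
have cM : c * M <= 1 / 2.
  rewrite -ler_pdivlMr // -[leRHS]mulrA -invfM ge_min lexx orbT //.
(* N bounds the sup norm on the closure, hence the factor n; the added 1 makes the inequality for
   |x|^2 strict and B positive. *)
pose B := (n%:R * N) ^+ 2 + 1.
have B0 : 0 < B by rewrite ltr_wpDl // sqr_ge0.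
have HB x : closure D x -> dot x x < B.
  move=> /HN xN; apply: (@le_lt_trans _ _ ((n%:R * N) ^+ 2)); last by rewrite ltrDl.
  rewrite -sqr_enorm ler_sqr ?nnegrE ?enorm_ge0 ?mulr_ge0 ?(ltW N0) //.
  by rewrite (le_trans (enorm_le_norm x)) // ler_wpM2l.
have [f [fD f0 fp]] :=
  exists_defining_function a01 p0 pn n0 oD bD D0 bG nuP nu0 M0 HM tube c_gt0 cc0 cM B0 HB.
exists f; split=> // [x L cx /trace_on_orthonormal[e eo ->]|nf x L Dx].
  exact: f0.
by move=> /trace_on_orthonormal[e eo ->]; exact: fp.
Qed.
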